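(* Let $A,B\colon\mathcal H\to2^{\mathcal H}$ be maximally monotone operators. Let $\tau>0$ and let $C\colon\mathcal H\to\mathcal H$ be $\tau$-cocoercive, with $Cx=\mathbb E_{\xi\sim\mathcal D}[C_\xi x]$ for all $x\in\mathcal H$, where $C_\xi\colon\mathcal H\to\mathcal H$ is $\tau$-cocoercive for $\mathcal D$-almost all $\xi$, and $\xi\mapsto C_\xi x$ is $\mathcal D$-measurable with finite expectation for all $x\in\mathcal H$. Assume $\mathrm{Zer}(A+B+C)\neq\emptyset$ and that there exists $\hat x_0\in\mathrm{Zer}(A+B+C)$ such that $\mathbb E[\|(C-C_\xi)\hat x_0\|^2]\le\sigma_*^2<+\infty$. Let $\rho\in(0,2\tau)$, let $x_0=(v_0,u_0)\in\mathcal H\times\mathcal H$, and let $x_k=(v_k,u_k)$ be generated, for $k\ge0$, by $$\begin{cases}(y_k^v,y_k^u)=(J_{\rho A}(v_k),\,u_k-\rho J_{\rho^{-1}B}(u_k/\rho)),\\ (z_k^v,z_k^u)=(2y_k^v-v_k-\rho C_{\xi_k}y_k^v,\,2y_k^u-u_k),\quad\xi_k\overset{\text{iid}}{\sim}\mathcal D,\\ (w_k^v,w_k^u)=(1+\rho^2)^{-1}(z_k^v-\rho z_k^u,\,\rho z_k^v+z_k^u),\\ (v_{k+1},u_{k+1})=(v_k-\lambda_k(y_k^v-w_k^v),\,u_k-\lambda_k(y_k^u-w_k^u)).\end{cases}$$ Let $\mathcal T$ be the operator on $\mathcal H\times\mathcal H$ defined in the context. Then, for any constant $\bar\lambda\in(0,1)$,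 $$\mathbb E[\|\mathcal Tx_{N_K}-x_{N_K}\|]\le\begin{cases}\mathcal O(K^{-\frac14})&\text{if }\lambda_k\equiv\bar\lambda K^{-\frac12},\\ \mathcal O(\ln(K)^{\frac12}K^{-\frac14})&\text{if }\lambda_k=\bar\lambda(k+1)^{-\frac12}\ln(k+e)^{-1},\end{cases}$$ where $N_K$ is the random index defined in the context, and $$\mathbb E[\|\mathcal Tx_K-x_K\|]\le\begin{cases}\mathcal O(K^{-\frac16})&\text{if }\lambda_k\equiv\bar\lambda K^{-\frac23},\\ \mathcal O(\ln(K)^{\frac12}K^{-\frac16})&\text{if }\lambda_k=\bar\lambda(k+1)^{-\frac23}.\end{cases}$$ Moreover, for each of the two schedules that do not depend on the horizon, namely $\lambda_k=\bar\lambda(k+1)^{-\frac12}\ln(k+e)^{-1}$ and $\lambda_k=\bar\lambda(k+1)^{-\frac23}$, $(x_k)$ converges weakly almost surely to a point $\hat x=(\hat v,\hat u)\in\mathrm{Fix}(\mathcal T)$ satisfying $J_{\rho A}(\hat v)\in\mathrm{Zer}(A+B+C)$, and $\|\mathcal Tx_k-x_k\|\to0$ almost surely.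
   Context: $\mathcal H$ is a real separable Hilbert space with inner product $\langle\cdot,\cdot\rangle$ and norm $\|\cdot\|$; $\mathcal H\times\mathcal H$ carries the product Hilbert structure. $\mathcal D$ is a probability distribution. $I$ is the identity; $J_{M}=(I+M)^{-1}$ is the resolvent of an operator $M$. $C$ is $\tau$-cocoercive if $\langle Cx-Cy,x-y\rangle\ge\tau\|Cx-Cy\|^2$ for all $x,y$. $\mathrm{Zer}(M)=\{x\colon0\in Mx\}$; $\mathrm{Fix}(\mathcal T)=\{x\colon\mathcal Tx=x\}$. Expectations of Hilbert-space-valued maps are Bochner integrals. On $\mathcal H\times\mathcal H$ define $\mathcal A(v,u)=Av\times B^{-1}u$, $\mathcal B(v,u)=(u,-v)$, and $\mathcal C_\xi(v,u)=(C_\xi v,0)$. Define $$\mathcal T_\xi=I-J_{\rho\mathcal A}+J_{\rho\mathcal B}\circ(2J_{\rho\mathcal A}-I-\rho\,\mathcal C_\xi\circ J_{\rho\mathcal A}),\qquad\mathcal T=\mathbb E_{\xi\sim\mathcal D}[\mathcal T_\xi].$$ (The iteration is $x_{k+1}=(1-\lambda_k)x_k+\lambda_k\mathcal T_{\xi_k}x_k$.) Define $\Lambda_k=\prod_{i=0}^{k-1}(1+2\lambda_i^2)^{-1}$. The random index $N_K\in\{0,\dots,K-1\}$ is independent of the algorithmic randomness $(\xi_k)$ and satisfies $$\mathbb P(N_K=k)=\frac{\Lambda_{k+1}\lambda_k(1-\lambda_k)}{\sum_{k'=0}^{K-1}\Lambda_{k'+1}\lambda_{k'}(1-\lambda_{k'})},\quad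 k=0,\dots,K-1.$$ $\mathbb E$ is over all sources of randomness. For the schedules $\lambda_k\equiv\bar\lambda K^{-1/2}$ and $\lambda_k\equiv\bar\lambda K^{-2/3}$, for each horizon $K$ the algorithm is run afresh for $K$ iterations with that constant parameter. $\mathcal O(\cdot)$ is understood as $K\to\infty$ with constants not depending on $K$. The starting point $x_0$ is deterministic, and the weak limit may be random. *)

(* Defs.v *)
From HB Require Import structures.
From mathcomp Require Import all_boot all_order all_algebra finmap.
From mathcomp Require Import all_classical all_reals all_analysis.

Set Implicit Arguments.
Unset Strict Implicit.
Unset Printing Implicit Defensive.

Import Order.TTheory GRing.Theory Num.Theory.
Import numFieldNormedType.Exports.

Local Open Scope classical_set_scope.
Local Open Scope ring_scope.

Section SetValuedOperators.
Context {R : realType} {V : lmodType R}.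
Implicit Types (A B M : V -> set V).

Definition op_inv A : V -> set V := fun u => [set x | A x u].
Definition op_scale (a : R) A : V -> set V := fun x => [set a *: u | u in A x].
Definition op_add A B : V -> set V :=
  fun x => [set u + v | u in A x & v in B x].
Definition op_fun (F : V -> V) : V -> set V := fun x => [set F x].

Definition zer M : set V := [set x | M x 0].
Definition fixpoints (F : V -> V) : set V := [set x | F x = x].

(* (I + M)^-1 as a function: [op_inv (op_add (op_fun id) M) x] is a singleton
   for every x when M is maximally monotone; 0 is a junk value. *)
Definition resolvent M : V -> V :=
  fun x => xget 0 (op_inv (op_add (op_fun id) M) x).

End SetValuedOperators.

Section HilbertSpace.
Context {R : realType} {H : normedModType R}.

Definition separable (T : topologicalType) : Prop :=
  exists S : set T, countable S /\ dense S.

Definition monotone (ip : H -> H -> R) (A : H -> set H) : Prop :=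
  forall x y u v, A x u -> A y v -> 0 <= ip (u - v) (x - y).

Definition maximally_monotone (ip : H -> H -> R) (A : H -> set H) : Prop :=
  monotone ip A /\
  forall A', monotone ip A' -> (forall x, A x `<=` A' x) ->
    forall x, A' x `<=` A x.

Definition cocoercive (ip : H -> H -> R) (tau : R) (C : H -> H) : Prop :=
  forall x y, tau * `|C x - C y| ^+ 2 <= ip (C x - C y) (x - y).

(* The Hilbert structure of H * H. The library's norm on a product is the
   (equivalent) maximum norm, hence this explicit definition. *)
Definition ip2 (ip : H -> H -> R) (x y : H * H) : R :=
  ip x.1 y.1 + ip x.2 y.2.
Definition norm2 (x : H * H) : R := Num.sqrt (`|x.1| ^+ 2 + `|x.2| ^+ 2).

Definition weak_cvg2 (ip : H -> H -> R) (x_ : nat -> H * H) (x : H * H) : Prop :=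
  forall y, ip2 ip (x_ k) y @[k --> \oo] --> ip2 ip x y.

End HilbertSpace.

(* Only the topology of V matters below: equivalent norms yield the same
   strongly measurable maps and the same integral. *)
Section Bochner.
Context {d : measure_display} {T : measurableType d} {R : realType}
  {V : normedModType R}.
Variable P : probability T R.
Implicit Types (f : T -> V).

Definition simple (s : T -> V) : Prop :=
  finite_set (range s) /\ forall y, measurable (s @^-1` [set y]).

Definition simple_integral (s : T -> V) : V :=
  \sum_(y \in range s) fine (P (s @^-1` [set y])) *: y.

Definition strongly_measurable f : Prop :=
  exists s : nat -> T -> V, (forall n, simple (s n)) /\
    {ae P, forall t, s n t @[n --> \oo] --> f t}.

(* The library's integral of a nonnegative function is a supremum over simple
   functions below it; strong measurability of f makes the integrand equal
   almost everywhere to a measurable function. *)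
Definition bochner_approx f (s : nat -> T -> V) : Prop :=
  (forall n, simple (s n)) /\
  (\int[P]_t (`|f t - s n t|)%:E @[n --> \oo] --> 0)%E.

Definition bochner_integrable f : Prop :=
  strongly_measurable f /\ exists s, bochner_approx f s.

Definition is_bochner_integral f (m : V) : Prop :=
  strongly_measurable f /\
  exists s, bochner_approx f s /\ simple_integral (s n) @[n --> \oo] --> m.

Definition bochner f : V := xget 0 [set m | is_bochner_integral f m].

End Bochner.

Section Algorithm.
Context {R : realType} {H : completeNormedModType R}.
Variables (rho : R) (A B : H -> set H).

Definition prod_A (x : H * H) : set (H * H) := A x.1 `*` op_inv B x.2.
Definition prod_B (x : H * H) : H * H := (x.2, - x.1).
Definition prod_C (c : H -> H) (x : H * H) : H * H := (c x.1, 0).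

Definition splitting_op (c : H -> H) (x : H * H) : H * H :=
  let JA := resolvent (op_scale rho prod_A) in
  let JB := resolvent (op_scale rho (op_fun prod_B)) in
  x - JA x + JB (2 *: JA x - x - rho *: prod_C c (JA x)).

Definition mean_splitting_op {d : measure_display} {Xi : measurableType d}
    (D : probability Xi R) (Cs : Xi -> H -> H) (x : H * H) : H * H :=
  bochner D (fun xi => splitting_op (Cs xi) x).

Definition iter_step (c : H -> H) (lambda : R) (x : H * H) : H * H :=
  let: (v, u) := x in
  let yv := resolvent (op_scale rho A) v in
  let yu := u - rho *: resolvent (op_scale rho^-1 B) (rho^-1 *: u) in
  let zv := 2 *: yv - v - rho *: c yv in
  let zu := 2 *: yu - u in
  let wv := (1 + rho ^+ 2)^-1 *: (zv - rho *: zu) in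
  let wu := (1 + rho ^+ 2)^-1 *: (rho *: zv + zu) in
  (v - lambda *: (yv - wv), u - lambda *: (yu - wu)).

Fixpoint iterate (c : nat -> H -> H) (lambda : nat -> R) (x0 : H * H)
    (k : nat) : H * H :=
  if k is j.+1 then iter_step (c j) (lambda j) (iterate c lambda x0 j) else x0.

End Algorithm.

Section Randomness.
Context {d d' : measure_display} {Omega : measurableType d}
  {Xi : measurableType d'} {R : realType}.
Variables (P : probability Omega R) (D : probability Xi R).

Definition mutually_independent (xi : nat -> {mfun Omega >-> Xi}) : Prop :=
  forall (J : {fset nat}) (E : nat -> set Xi), (forall k, measurable (E k)) ->
    P (\bigcap_(k in [set` J]) xi k @^-1` E k) =
    (\prod_(k <- J) P (xi k @^-1` E k))%E.

Definition iid (xi : nat -> {mfun Omega >-> Xi}) : Prop :=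
  (forall k E, measurable E -> distribution P (xi k) E = D E) /\
  mutually_independent xi.

Definition independent_of_process (N : {mfun Omega >-> nat})
    (xi : nat -> {mfun Omega >-> Xi}) : Prop :=
  forall (F : set nat) (E : set Omega),
    <<s \bigcup_k preimage_set_system setT (xi k) measurable >> E ->
    P (N @^-1` F `&` E) = (P (N @^-1` F) * P E)%E.

Definition Lambda (lambda : nat -> R) (k : nat) : R :=
  \prod_(i < k) (1 + 2 * lambda i ^+ 2)^-1.

Definition index_weight (lambda : nat -> R) (k : nat) : R :=
  Lambda lambda k.+1 * lambda k * (1 - lambda k).

Definition random_index (xi : nat -> {mfun Omega >-> Xi}) (lambda : nat -> R)
    (K : nat) (N : {mfun Omega >-> nat}) : Prop :=
  [/\ forall w, (N w < K)%N,
      forall k, (k < K)%N ->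
        P (N @^-1` [set k]) =
        (index_weight lambda k / \sum_(j < K) index_weight lambda j)%:E
    & independent_of_process N xi].

End Randomness.

Definition bigO_infty {R : realType} (e : nat -> \bar R) (r : nat -> R) : Prop :=
  exists c : R, \forall K \near \oo, (e K <= (c * r K)%:E)%E.

(* Main.v *)
Require Import Defs.
From HB Require Import structures.
From mathcomp Require Import all_boot all_order all_algebra finmap.
From mathcomp Require Import all_classical all_reals all_analysis.
From mathcomp Require Import measurable_realfun.
From mathcomp Require Import ring lra.

Set Implicit Arguments.
Unset Strict Implicit.
Unset Printing Implicit Defensive.

Import Order.TTheory GRing.Theory Num.Theory.
Import numFieldNormedType.Exports.

Local Open Scope classical_set_scope.
Local Open Scope ring_scope.

(* The update is a relaxed step x + l (T_xi x - x) of the nonexpansive operator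
   T_xi, and T = E[T_xi] is the splitting operator of C itself, because C_xi
   enters T_xi affinely. The distance to a fixed point satisfies
   E|x' - p|^2 <= (1 + 8 l^2) |x - p|^2 + 2 s l^2 - l (1 - l) |Tx - x|^2,
   whence the bound on sum l_k E|T x_k - x_k|^2 and the rate at the random index.
   For the last iterate, let ubar be the averaged noise,
   ubar' = (1 - l) ubar + l (T_xi x - T x). Then z = x - ubar follows the
   noiseless scheme z' = z + l (T (z + ubar) - z), whose squared residual grows
   pathwise by at most l / (1 - l) |ubar|^2 per step, while E|ubar|^2 is
   contracted. Almost sure convergence follows from the supermartingale
   convergence theorem applied to |x - p|^2 and |x - p|^2 + |ubar|^2 for p in a
   countable dense set of fixed points, and from Opial's lemma. *)

(** * Inner products and maximally monotone operators *)

Record inner_product {R : realType} {V : lmodType R} (f : V -> V -> R) : Prop :=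
  InnerProduct {
  ipDl : forall x y z, f (x + y) z = f x z + f y z;
  ipZl : forall a x y, f (a *: x) y = a * f x y;
  ipC : forall x y, f x y = f y x;
  ip_ge0 : forall x, 0 <= f x x;
  ip_eq0 : forall x, f x x = 0 -> x = 0 }.

Section InnerProductTheory.
Context {R : realType} {V : lmodType R} {f : V -> V -> R}.
Hypothesis fi : inner_product f.

Lemma ipDr x y z : f x (y + z) = f x y + f x z.
Proof. by rewrite (ipC fi) (ipDl fi) (ipC fi y) (ipC fi z). Qed.

Lemma ipZr a x y : f x (a *: y) = a * f x y.
Proof. by rewrite (ipC fi) (ipZl fi) (ipC fi y). Qed.

Lemma ipNl x y : f (- x) y = - f x y.
Proof. by rewrite -scaleN1r (ipZl fi) mulN1r. Qed.

Lemma ipNr x y : f x (- y) = - f x y.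
Proof. by rewrite (ipC fi) ipNl (ipC fi y). Qed.

Lemma ip0l x : f 0 x = 0.
Proof. by rewrite -(scale0r 0) (ipZl fi) mul0r. Qed.

Lemma ip0r x : f x 0 = 0.
Proof. by rewrite (ipC fi) ip0l. Qed.

Definition ipE := (ipDl fi, ipDr, ipNl, ipNr, ipZl fi, ipZr, ip0l, ip0r).

Lemma ip_young a x y : 0 < a -> 2 * f x y <= a * f x x + a^-1 * f y y.
Proof.
move=> a0; have := ip_ge0 fi (a *: x - y); rewrite !ipE (ipC fi y x) => h.
rewrite -(ler_pM2l a0) mulrDr mulrA (mulrA _ a^-1) divff ?gt_eqF// mul1r; move=> *; lra.
Qed.

Lemma ip_le x y : 2 * f x y <= f x x + f y y.
Proof. by have := @ip_young 1 x y ltr01; rewrite invr1 !mul1r. Qed.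

Lemma ip_sqD x y : f (x + y) (x + y) <= 2 * f x x + 2 * f y y.
Proof. have := ip_le x y; rewrite !ipE (ipC fi y x); move=> *; lra. Qed.

Lemma ip_sqB x y : f (x - y) (x - y) <= 2 * f x x + 2 * f y y.
Proof. by apply: (le_trans (ip_sqD x (- y))); rewrite !ipE opprK. Qed.

Lemma ip_sqC x y : f (x - y) (x - y) = f (y - x) (y - x).
Proof. by rewrite -opprB ipNl ipNr opprK. Qed.

Lemma ip_cauchy_schwarz x y : f x y ^+ 2 <= f x x * f y y.
Proof.
have [x0|x0] := eqVneq (f x x) 0.
  by rewrite (ip_eq0 fi x0) !ipE expr0n mul0r.
have xp : 0 < f x x by rewrite lt_neqAle eq_sym x0 ip_ge0.
have := ip_ge0 fi (f x x *: y - f x y *: x); rewrite !ipE (ipC fi y x) => h.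
rewrite -subr_ge0 -(pmulr_rge0 _ xp); nra.
Qed.

End InnerProductTheory.

Lemma inner_product_ip2 {R : realType} {H : normedModType R} (ip : H -> H -> R) :
  inner_product ip -> inner_product (ip2 ip).
Proof.
move=> fi; split; rewrite /ip2 /=.
- by move=> x y z; rewrite !(ipDl fi); ring.
- by move=> a x y; rewrite !(ipZl fi); ring.
- by move=> x y; rewrite (ipC fi) (ipC fi x.2).
- by move=> x; rewrite addr_ge0// ip_ge0.
- move=> [x y] /= /eqP; rewrite paddr_eq0 ?ip_ge0// => /andP[/eqP h1 /eqP h2].
  by rewrite (ip_eq0 fi h1) (ip_eq0 fi h2).
Qed.

Lemma inner_product_dot {R : realType} {H : normedModType R}
    (ip : {dot H for idfun}) : (forall x : H, ip x x = `|x| ^+ 2) ->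
  inner_product (ip : H -> H -> R).
Proof.
move=> ipn; split=> [x y z|a x y|x y|x|x].
- by rewrite linearDl.
- by rewrite linearZl_LR.
- by rewrite hermC expr0 mul1r.
- by rewrite ipn exprn_ge0.
- by rewrite ipn => /eqP; rewrite expf_eq0/= normr_eq0 => /eqP.
Qed.

Lemma cauchy_seq_cvg {R : realType} {V : completeNormedModType R} (u : nat -> V) :
  (forall e : R, 0 < e -> exists N, forall m n, (N <= m)%N -> (N <= n)%N ->
     `|u m - u n| < e) -> exists l : V, u @ \oo --> l.
Proof.
move=> hu; suff /cvg_ex[l ul] : cvg (u @ \oo) by exists l.
apply/cauchy_cvgP; apply: cauchy_exP => e e0.
have [N hN] := hu e e0.
exists (u N); exists N => // n /= Nn; rewrite -ball_normE /=; exact: hN.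
Qed.

Lemma lipschitz_continuous {R : realType} (V W : normedModType R) (F : V -> W) K :
  (forall x y, `|F x - F y| <= K * `|x - y|) -> continuous F.
Proof.
move=> LF x; apply/cvgrPdist_le => r r0.
have M0 : 0 < `|K| + 1 by rewrite ltr_wpDl.
near=> y; apply: le_trans (LF _ _) _.
apply: (@le_trans _ _ ((`|K| + 1) * `|x - y|)).
  by rewrite ler_wpM2r// (le_trans (ler_norm _))// lerDl.
rewrite mulrC -ler_pdivlMr//; near: y.
have : (fun y => y) @ x --> x by exact: cvg_id.
by move/cvgrPdist_le; apply; rewrite divr_gt0.
Unshelve. all: by end_near. Qed.

Section InnerProductTopology.
Context {R : realType} {H : normedModType R} {f : H -> H -> R}.
Hypotheses (fi : inner_product f) (fn : forall x, f x x = `|x| ^+ 2).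

Lemma ip_le_norm x y : `|f x y| <= `|x| * `|y|.
Proof.
rewrite -(ler_pXn2r (n := 2)) ?nnegrE ?mulr_ge0//.
by rewrite exprMn -!fn -normrX ger0_norm ?sqr_ge0// ip_cauchy_schwarz.
Qed.

Lemma ip_cvg (T : Type) (F : set_system T) (FF : Filter F) (u v : T -> H) x y :
  u @ F --> x -> v @ F --> y -> f (u t) (v t) @[t --> F] --> f x y.
Proof.
have pol a b : f a b = 4^-1 * (`|a + b| ^+ 2 - `|a - b| ^+ 2).
  by rewrite -!fn !(ipE fi) (ipC fi b a); field.
move=> ux vy; rewrite pol; under eq_fun do rewrite pol.
apply: cvgM; first exact: cvg_cst.
apply: cvgB; apply: cvgM; apply: cvg_norm; first [exact: cvgD|exact: cvgB].
Qed.

End InnerProductTopology.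

Section Minty.
Context {R : realType} {H : completeNormedModType R} {ip : H -> H -> R}.
Hypotheses (fi : inner_product ip) (fn : forall x, ip x x = `|x| ^+ 2).

(* Convex hull in H * H * R of the points (a, b, <a, b>) with (a, b) in the
   graph G. *)
Inductive graph_hull (G : H -> H -> Prop) : H -> H -> R -> Prop :=
| hull_base a b of G a b : graph_hull G a b (ip a b)
| hull_conv t a b s a' b' s' of 0 <= t <= 1 & graph_hull G a b s &
    graph_hull G a' b' s' :
    graph_hull G (a + t *: (a' - a)) (b + t *: (b' - b)) (s + t * (s' - s)).

Lemma graph_hull_monotone G a b s a' b' s' :
  (forall a b a' b', G a b -> G a' b' -> 0 <= ip (b - b') (a - a')) ->
  graph_hull G a b s -> graph_hull G a' b' s' -> ip a b' + ip a' b <= s + s'.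
Proof.
move=> mG h; elim: h a' b' s' => {a b s} [a b Gab|t a b s c d r t01 h IH h' IH'].
  move=> a' b' s'; elim=> {a' b' s'} [a' b' G'|t a' b' s' c d r t01 h IH h' IH'].
    have := mG _ _ _ _ Gab G'; rewrite !(ipE fi) (ipC fi b a) (ipC fi b' a').
    rewrite (ipC fi b a') (ipC fi b' a); move=> *; lra.
  by rewrite !(ipE fi); case/andP: t01 => t0 t1; nra.
move=> a' b' s' k; have := IH _ _ _ k; have := IH' _ _ _ k.
by rewrite !(ipE fi); case/andP: t01 => t0 t1; nra.
Qed.

(* The wanted point minimizes g_b (y) = |y|^2 + <b - a, y> - <a, b> for all
   (a, b) in G; it is found by maximizing over the hull the minimal value
   - |b - a|^2 / 4 - s of |y|^2 + <b - a, y> - s. *)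
Lemma monotone_common_point (G : H -> H -> Prop) : (exists a b, G a b) ->
  (forall a b a' b', G a b -> G a' b' -> 0 <= ip (b - b') (a - a')) ->
  exists y, forall a b, G a b -> 0 <= ip (b + y) (a - y).
Proof.
move=> [a0 [b0 G0]] mG.
pose phi (k : H * H * R) := - (4^-1 * ip (k.1.2 - k.1.1) (k.1.2 - k.1.1)) - k.2.
pose hull := [set k : H * H * R | graph_hull G k.1.1 k.1.2 k.2].
have phi_le0 k : hull k -> phi k <= 0.
  move=> hk; have := graph_hull_monotone mG hk hk; have := ip_ge0 fi (k.1.2 + k.1.1).
  by rewrite /phi !(ipE fi) (ipC fi k.1.2 k.1.1); move=> *; lra.
pose S := sup (phi @` hull).
have Ssup : has_sup (phi @` hull).
  split; first by exists (phi (a0, b0, ip a0 b0)), (a0, b0, ip a0 b0) => //; exact: hull_base.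
  by exists 0 => _ [k hk <-]; exact: phi_le0.
have phiS k : hull k -> phi k <= S.
  by move=> hk; apply: ub_le_sup; [case: Ssup|exists k].
have S0 : S <= 0 by apply: ge_sup => [|_ [k hk <-]]; [case: Ssup|exact: phi_le0].
have /choice[k hk] : forall n : nat, exists k, hull k /\ S - n.+1%:R^-1 < phi k.
  move=> n; have n0 : 0 < n.+1%:R^-1 :> R by rewrite invr_gt0.
  by have [_ [k hk <-] ?] := sup_adherent n0 Ssup; exists k.
have hullk n : hull (k n) by case: (hk n).
have phik n : S - n.+1%:R^-1 < phi (k n) by case: (hk n).
pose d n := (k n).1.2 - (k n).1.1.
have dB m n : ip (d m - d n) (d m - d n) <= 8 * (m.+1%:R^-1 + n.+1%:R^-1).
  have h01 : 0 <= (2^-1 : R) <= 1 by apply/andP; split; move=> *; lra.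
  have := phiS (_, _, _) (hull_conv h01 (hullk m) (hullk n)).
  have := phik m; have := phik n; rewrite /phi /d /=.
  case: (k m) => [[a b] s]; case: (k n) => [[a' b'] s'] /=.
  rewrite !(ipE fi) (ipC fi b a) (ipC fi a' a) (ipC fi b' a) (ipC fi a' b).
  rewrite (ipC fi b' b) (ipC fi b' a').
  set p := n.+1%:R^-1; set q := m.+1%:R^-1; move=> h1 h2 h3; move=> *; lra.
have [z dz] : exists z : H, d @ \oo --> z.
  apply: cauchy_seq_cvg => e e0.
  have [N _ hN] := near_infty_natSinv_lt (PosNum (divr_gt0 (exprn_gt0 2 e0) (ltr0Sn R 15))).
  exists N => m n Nm Nn; rewrite -(ltr_pXn2r (n := 2)) ?nnegrE ?(ltW e0)//.
  rewrite -fn (le_lt_trans (dB m n))//.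
  have := hN m Nm; have := hN n Nn; rewrite /=; set p := n.+1%:R^-1; set q := m.+1%:R^-1.
  by move=> h1 h2; move=> *; lra.
exists (- 2^-1 *: z) => a b Gab.
have key t n : 0 < t <= 1 ->
    - (4^-1 * ip (d n) (d n) - 2^-1 * ip (b - a) (d n) - ip a b) >=
    - (n.+1%:R^-1 / t + t * ip (b - a - d n) (b - a - d n)).
  case/andP=> t0 t1.
  have h01 : 0 <= t <= 1 by rewrite t1 ltW.
  have := phiS (_, _, _) (hull_conv h01 (hullk n) (hull_base Gab)).
  have : t * phi (k n) <= 0 by rewrite pmulr_rle0 ?phi_le0.
  have := phik n; rewrite /phi /d /=.
  case: (k n) => [[a' b'] s] /=.
  have := mulr_ge0 (sqr_ge0 t) (ip_ge0 fi (b - a - (b' - a'))).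
  move=> h1 h2 h3 h4; rewrite -(ler_pM2l t0) mulrN mulrDr; move: h1 h2 h3 h4.
  rewrite [t * (_ / t)]mulrC divfK ?gt_eqF//.
  set e := n.+1%:R^-1.
  rewrite !(ipE fi) (ipC fi b a) (ipC fi a' a) (ipC fi b' a) (ipC fi a' b).
  by rewrite (ipC fi b' b) (ipC fi b' a') => h1 h2 h3 h4; lra.
have {}key t : 0 < t <= 1 ->
    - (t * ip (b - a - z) (b - a - z)) <=
    - (4^-1 * ip z z - 2^-1 * ip (b - a) z - ip a b).
  move=> t01.
  have c1 : - (n.+1%:R^-1 / t + t * ip (b - a - d n) (b - a - d n))
      @[n --> \oo] --> - (0 / t + t * ip (b - a - z) (b - a - z)).
    apply: cvgN; apply: cvgD; first by apply: cvgMr_tmp; exact: cvg_harmonic.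
    by apply: cvgMl_tmp; apply: (ip_cvg fi fn); apply: cvgB => //; exact: cvg_cst.
  have c2 : - (4^-1 * ip (d n) (d n) - 2^-1 * ip (b - a) (d n) - ip a b)
      @[n --> \oo] --> - (4^-1 * ip z z - 2^-1 * ip (b - a) z - ip a b).
    apply: cvgN; apply: cvgB; last exact: cvg_cst.
    apply: cvgB; apply: cvgMl_tmp; apply: (ip_cvg fi fn) => //; exact: cvg_cst.
  rewrite mul0r add0r in c1; apply: (ler_cvg_to c1 c2).
  by apply: nearW => n; exact: key.
pose L := - (4^-1 * ip z z - 2^-1 * ip (b - a) z - ip a b).
pose M := ip (b - a - z) (b - a - z).
have {}key t : 0 < t <= 1 -> - (t * M) <= L by exact: key.
have L0 : 0 <= L.
  rewrite leNgt; apply/negP => L0.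
  have M0 : 0 <= M by exact: ip_ge0.
  pose t := Num.min 1 (- L / (2 * (1 + M))).
  have t01 : 0 < t <= 1.
    by rewrite ge_min lexx lt_min ltr01 divr_gt0//; move=> *; lra.
  have := key _ t01; have : t * (1 + M) <= - L / 2.
    have -> : - L / 2 = - L / (2 * (1 + M)) * (1 + M) by field; move=> *; lra.
    by rewrite ler_wpM2r ?ge_min ?lexx ?orbT//; move=> *; lra.
  case/andP: t01; nra.
move: L0; rewrite /L !(ipE fi) (ipC fi b a) (ipC fi z a) => *; lra.
Qed.

Lemma minty (A : H -> set H) : maximally_monotone ip A ->
  forall x, exists y, A y (x - y).
Proof.
move=> [mA maxA] x.
pose G a b := A a (b + x).
have GA a b : A a b -> G a (b - x) by rewrite /G subrK.
have mG a b a' b' : G a b -> G a' b' -> 0 <= ip (b - b') (a - a').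
  move=> h h'; have := mA _ _ _ _ h h'.
  by rewrite (_ : b + x - (b' + x) = b - b')// opprD addrACA subrr addr0.
have maxA' y v : (forall a b, A a b -> 0 <= ip (v - b) (y - a)) -> A y v.
  move=> h; apply: (maxA (fun z => A z `|` [set w | z = y /\ w = v])); last by right.
    move=> z z' w w' [Azw|[-> ->]] [Azw'|[-> ->]].
    - exact: mA Azw Azw'.
    - by rewrite -opprB -[z - y]opprB (ipNl fi) (ipNr fi) opprK; exact: h.
    - exact: h.
    - by rewrite !subrr ip0l.
  by move=> z w Azw; left.
have [[a [b Aab]]|noA] := pselect (exists a b, A a b); last first.
  exists x; rewrite subrr; apply: maxA' => a b Aab.
  by case: noA; exists a, b.
have [|y hy] := monotone_common_point _ mG.
  by exists a, (b - x); exact: GA.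
exists y; apply: maxA' => a' b' /GA /hy.
have -> : x - y - b' = - (b' - x + y) by rewrite opprD opprB addrAC.
by rewrite -(opprB a' y) (ipNl fi) (ipNr fi) opprK.
Qed.

Lemma maximally_monotone_scale (A : H -> set H) (r : R) : 0 < r ->
  maximally_monotone ip A -> maximally_monotone ip (op_scale r A).
Proof.
move=> r0 [mA maxA]; split.
  move=> x y _ _ [u Au <-] [v Av <-].
  by rewrite -scalerBr (ipZl fi) mulr_ge0 ?(ltW r0)//; exact: mA.
move=> A' mA' AA' x u A'u.
exists (r^-1 *: u); last by rewrite scalerA divff ?scale1r// gt_eqF.
apply: (maxA (fun z => [set w | A' z (r *: w)])).
- move=> z z' w w' /= hw hw'; have := mA' _ _ _ _ hw hw'.
  by rewrite -scalerBr (ipZl fi) pmulr_rge0.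
- by move=> z w Azw /=; apply: AA'; exists w.
- by rewrite /= scalerA divff ?scale1r// gt_eqF.
Qed.

End Minty.

(** * Resolvents and the splitting operator *)

Lemma ip_ext {R : realType} {V : lmodType R} {f : V -> V -> R} :
  inner_product f -> forall u v, (forall h, f u h = f v h) -> u = v.
Proof.
move=> fi u v h; apply/eqP; rewrite -subr_eq0; apply/eqP; apply: (ip_eq0 fi).
by rewrite (ipDl fi) (ipNl fi) h subrr.
Qed.

Section Resolvent.
Context {R : realType} {V : normedModType R} {f : V -> V -> R}.
Hypothesis fi : inner_product f.

Lemma resolvent_eq (M : V -> set V) x y :
  Defs.monotone f M -> M y (x - y) -> resolvent M x = y.
Proof.
move=> mM Mxy; apply: xget_unique.
  by exists y => //; exists (x - y) => //; rewrite addrC subrK.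
move=> z [_ -> [u Mzu e]]; rewrite -e /= in Mxy; have h := mM _ _ _ _ Mzu Mxy.
apply/eqP; rewrite -subr_eq0; apply/eqP; apply: (ip_eq0 fi); apply/eqP.
move: h; rewrite eq_le (ip_ge0 fi) andbT !(ipE fi).
rewrite (ipC fi y z) => h; lra.
Qed.

Lemma splitting_nonexpansive (rho tau : R) (dx dy dw dc : V) :
  0 <= rho <= 2 * tau ->
  0 <= f dy (dx - dy) -> 0 <= f dw (2 *: dy - dx - rho *: dc - dw) ->
  tau * f dc dc <= f dy dc ->
  f (dx - dy + dw) (dx - dy + dw) <= f dx dx.
Proof.
case/andP=> rho0 rhot.
have := ip_ge0 fi (dw - dy + rho *: dc); have := ip_ge0 fi dc.
rewrite !(ipE fi) (ipC fi dy dx) (ipC fi dw dx) (ipC fi dw dy) (ipC fi dc dy).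
rewrite (ipC fi dc dw) => h1 h2 h3 h4 h5.
have h6 : rho * (tau * f dc dc) <= rho * f dy dc by rewrite ler_wpM2l.
have h7 : rho * (rho * f dc dc) <= rho * (2 * tau * f dc dc).
  by rewrite ler_wpM2l// ler_wpM2r.
lra.
Qed.

End Resolvent.

Section Splitting.
Context {R : realType} {H : completeNormedModType R} {ip : H -> H -> R}.
Hypotheses (fi : inner_product ip) (fn : forall x, ip x x = `|x| ^+ 2).
Variables (A B : H -> set H) (rho : R).
Hypotheses (maxA : maximally_monotone ip A) (maxB : maximally_monotone ip B).
Hypothesis rho_gt0 : 0 < rho.

Let fi2 := inner_product_ip2 fi.

Lemma resolventP (M : H -> set H) (r : R) x : 0 < r -> maximally_monotone ip M ->
  op_scale r M (resolvent (op_scale r M) x) (x - resolvent (op_scale r M) x).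
Proof.
move=> r0 maxM; have maxrM := maximally_monotone_scale fi r0 maxM.
have [y My] := minty fi fn maxrM x.
by rewrite (resolvent_eq fi maxrM.1 My).
Qed.

Definition prod_resolvent (x : H * H) : H * H :=
  (resolvent (op_scale rho A) x.1,
   x.2 - rho *: resolvent (op_scale rho^-1 B) (rho^-1 *: x.2)).

Definition rot_resolvent (z : H * H) : H * H :=
  ((1 + rho ^+ 2)^-1 *: (z.1 - rho *: z.2),
   (1 + rho ^+ 2)^-1 *: (rho *: z.1 + z.2)).

Lemma prod_A_monotone : Defs.monotone (ip2 ip) (op_scale rho (prod_A A B)).
Proof.
move=> [x1 x2] [y1 y2] _ _ [[u1 u2] [/= Au Bu] <-] [[v1 v2] [/= Av Bv] <-].
rewrite -scalerBr (ipZl fi2) pmulr_rge0// /ip2 /= addr_ge0//.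
  exact: maxA.1 Au Av.
rewrite (ipC fi); exact: maxB.1 Bu Bv.
Qed.

(* The second component is the resolvent of rho B^-1, by Moreau's identity. *)
Lemma prod_resolventP x :
  op_scale rho (prod_A A B) (prod_resolvent x) (x - prod_resolvent x).
Proof.
have [u Au eu] := resolventP x.1 rho_gt0 maxA.
have rhoV0 : 0 < rho^-1 by rewrite invr_gt0.
have [v Bv ev] := resolventP (rho^-1 *: x.2) rhoV0 maxB.
rewrite /prod_resolvent; set p := resolvent _ _ in Au eu *.
set q := resolvent _ _ in Bv ev *.
have rho0 : rho != 0 by rewrite gt_eqF.
exists (u, q).
  split => //=; rewrite /op_inv /=.
  rewrite (_ : x.2 - _ = v)//.
  have /(congr1 ( *:%R rho)) := ev.
  by rewrite scalerBr !scalerA divff// !scale1r => ->.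
have e2 : x.2 - (x.2 - rho *: q) = rho *: q by rewrite opprB addrCA subrr addr0.
by rewrite [RHS]surjective_pairing [LHS]surjective_pairing /= eu e2.
Qed.

Lemma resolvent_prod_A x : resolvent (op_scale rho (prod_A A B)) x = prod_resolvent x.
Proof. exact: (resolvent_eq fi2 prod_A_monotone (prod_resolventP x)). Qed.

Lemma prod_B_monotone : Defs.monotone (ip2 ip) (op_scale rho (op_fun (@prod_B R H))).
Proof.
move=> [x1 x2] [y1 y2] _ _ [_ -> <-] [_ -> <-].
rewrite -scalerBr (ipZl fi2) /prod_B /ip2 /= !(ipE fi) (ipC fi x2 x1).
rewrite (ipC fi x2 y1) (ipC fi y2 x1) (ipC fi y2 y1) le_eqVlt; apply/orP; left.
by apply/eqP; ring.
Qed.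

Lemma rot_resolventP z :
  op_scale rho (op_fun (@prod_B R H)) (rot_resolvent z) (z - rot_resolvent z).
Proof.
exists (prod_B (rot_resolvent z)) => //.
have d0 : 1 + rho ^+ 2 != 0 by rewrite gt_eqF// ltr_wpDr ?sqr_ge0.
apply: (ip_ext fi2) => -[h1 h2]; case: z => z1 z2.
by rewrite /rot_resolvent /prod_B /ip2 /= !(ipE fi); field.
Qed.

Lemma resolvent_prod_B z :
  resolvent (op_scale rho (op_fun (@prod_B R H))) z = rot_resolvent z.
Proof. exact: (resolvent_eq fi2 prod_B_monotone (rot_resolventP z)). Qed.

Lemma splitting_opE c x : splitting_op rho A B c x =
  x - prod_resolvent x +
  rot_resolvent (2 *: prod_resolvent x - x - rho *: prod_C c (prod_resolvent x)).
Proof. by rewrite /splitting_op resolvent_prod_A resolvent_prod_B. Qed.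

Lemma iter_stepE c l x : iter_step rho A B c l x =
  x + l *: (splitting_op rho A B c x - x).
Proof.
rewrite splitting_opE; case: x => v u.
rewrite /rot_resolvent /prod_resolvent /prod_C /iter_step /=.
by apply: (ip_ext fi2) => -[h1 h2]; rewrite /ip2 /= !(ipE fi); ring.
Qed.

Lemma splitting_op_nonexpansive tau c x x' : rho <= 2 * tau ->
  cocoercive ip tau c ->
  ip2 ip (splitting_op rho A B c x - splitting_op rho A B c x')
         (splitting_op rho A B c x - splitting_op rho A B c x')
  <= ip2 ip (x - x') (x - x').
Proof.
move=> rhot cc; rewrite !splitting_opE.
set y := prod_resolvent x; set y' := prod_resolvent x'.
set z := 2 *: y - x - _; set z' := 2 *: y' - x' - _.
have -> : x - y + rot_resolvent z - (x' - y' + rot_resolvent z') =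
    (x - x') - (y - y') + (rot_resolvent z - rot_resolvent z').
  by apply: (ip_ext fi2) => h; rewrite !(ipE fi2); ring.
apply: (splitting_nonexpansive fi2 (rho := rho) (tau := tau)
  (dc := prod_C c y - prod_C c y')).
- by rewrite ltW.
- have := prod_A_monotone (prod_resolventP x) (prod_resolventP x').
  rewrite (ipC fi2); congr (_ <= ip2 ip _ _).
  by apply: (ip_ext fi2) => h; rewrite !(ipE fi2); ring.
- have := prod_B_monotone (rot_resolventP z) (rot_resolventP z').
  rewrite (ipC fi2); congr (_ <= ip2 ip _ _).
  by apply: (ip_ext fi2) => h; rewrite /z /z' !(ipE fi2); ring.
- have := cc y.1 y'.1; rewrite /ip2 /= subrr !(ip0l fi) (ip0r fi) !addr0 -fn.
  by rewrite (ipC fi (y.1 - y'.1)).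
Qed.

Definition noise_map (w : H) : H * H :=
  (- (rho / (1 + rho ^+ 2))) *: (w, rho *: w).

Lemma splitting_op_affine c x : splitting_op rho A B c x =
  splitting_op rho A B (fun=> 0) x + noise_map (c (resolvent (op_scale rho A) x.1)).
Proof.
have d0 : 1 + rho ^+ 2 != 0 by rewrite gt_eqF// ltr_wpDr ?sqr_ge0.
rewrite !splitting_opE; case: x => v u.
apply: (ip_ext fi2) => -[h1 h2].
by rewrite /rot_resolvent /noise_map /prod_resolvent /prod_C /ip2 /= !(ipE fi); field.
Qed.

Lemma ip2_noise_map w w' : ip2 ip (noise_map w) (noise_map w') =
  rho ^+ 2 / (1 + rho ^+ 2) * ip w w'.
Proof.
have d0 : 1 + rho ^+ 2 != 0 by rewrite gt_eqF// ltr_wpDr ?sqr_ge0.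
by rewrite /noise_map /ip2 /= !(ipE fi); field.
Qed.

Lemma fixpoint_splitting_op_zero (C : H -> H) x : splitting_op rho A B C x = x ->
  zer (op_add (op_add A B) (op_fun C)) (resolvent (op_scale rho A) x.1).
Proof.
have rho0 : rho != 0 by rewrite gt_eqF.
rewrite splitting_opE; set y := prod_resolvent x; set z := (X in rot_resolvent X) => e.
have ry : rot_resolvent z = y.
  apply: (ip_ext fi2) => h; have := congr1 (fun t => ip2 ip t h) e.
  by rewrite !(ipE fi2) => *; lra.
have [[a b] [/= Aa Bb] eab] := prod_resolventP x.
have [_ -> ez] := rot_resolventP z.
rewrite -/y in Aa Bb eab; rewrite ry in ez.
change (zer (op_add (op_add A B) (op_fun C)) y.1).
have e1 : a + y.2 + C y.1 = 0.
  apply: (scalerI rho0); rewrite scaler0 !scalerDr.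
  apply: (ip_ext fi) => h.
  have := congr1 (fun t => ip t.1 h) eab; have := congr1 (fun t => ip t.1 h) ez.
  rewrite /z /=; rewrite !(ipE fi) => *; lra.
have e2 : b = y.1.
  apply: (scalerI rho0); apply: (ip_ext fi) => h.
  have := congr1 (fun t => ip t.2 h) eab; have := congr1 (fun t => ip t.2 h) ez.
  rewrite /z /=; rewrite !(ipE fi) => *; lra.
exists (a + y.2); last by exists (C y.1).
by exists a => //; exists y.2 => //; rewrite -e2.
Qed.

Lemma zero_fixpoint_splitting_op (C : H -> H) y :
  zer (op_add (op_add A B) (op_fun C)) y ->
  exists x, splitting_op rho A B C x = x /\ resolvent (op_scale rho A) x.1 = y.
Proof.
move=> [_ [a Aa [b Bb <-]] [_ -> e]].
pose x : H * H := (y + rho *: a, b + rho *: y).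
have px : prod_resolvent x = (y, b).
  rewrite -resolvent_prod_A; apply: (resolvent_eq fi2 prod_A_monotone).
  exists (a, y) => //=; congr pair => /=.
    by rewrite addrC addKr.
  by rewrite addrC addKr.
exists x; split; last by have := congr1 fst px.
rewrite splitting_opE px -resolvent_prod_B.
rewrite (@resolvent_eq _ _ _ fi2 _ _ (y, b)) ?subrK//; first exact: prod_B_monotone.
exists (prod_B (y, b)) => //.
apply: (ip_ext fi2) => -[h1 h2]; have := congr1 (fun t => ip t h1) e.
by rewrite /x /prod_B /prod_C /ip2 /= !(ipE fi) => h; nra.
Qed.

End Splitting.

(** * Krasnoselskii-Mann steps and Opial's lemma *)

Section KrasnoselskiiMann.
Context {R : realType} {V : lmodType R} {f : V -> V -> R}.
Hypothesis fi : inner_product f.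
Variable T : V -> V.
Hypothesis neT : forall x y, f (T x - T y) (T x - T y) <= f (x - y) (x - y).

Lemma km_descent x p l : 0 <= l -> T p = p ->
  f (x + l *: (T x - x) - p) (x + l *: (T x - x) - p) <=
  f (x - p) (x - p) - l * (1 - l) * f (T x - x) (T x - x).
Proof.
move=> l0 Tp; have := neT x p; rewrite Tp.
set r := T x - x; have -> : T x = x + r by rewrite /r addrC subrK.
clearbody r; rewrite !(ipE fi) (ipC fi p x) (ipC fi p r) (ipC fi r x) => h1.
have : 0 <= l * (- f r r - 2 * f x r + 2 * f r p) by rewrite mulr_ge0//; lra.
by move=> h2; nra.
Qed.

Lemma km_residual z u l z' : 0 < l < 1 -> z' = z + l *: (T (z + u) - z) ->
  f (T z' - z') (T z' - z') <= f (T z - z) (T z - z) + l / (1 - l) * f u u.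
Proof.
case/andP=> l0 l1 z'E.
have := neT z' z; have := neT (z + u) z; rewrite (addrC z) addrK.
set e := T (u + z) - T z; set r := T z - z; pose d := T z' - z' - r.
have ez' : z' - z = l *: (r + e).
  by rewrite z'E /r /e (addrC z u); apply: (ip_ext fi) => h; rewrite !(ipE fi); ring.
have -> : T z' - T z = l *: (r + e) + d.
  by rewrite -ez' /d /r; apply: (ip_ext fi) => h; rewrite !(ipE fi); ring.
have -> : T z' - z' = r + d by rewrite /d [RHS]addrC subrK.
clearbody d e r; rewrite ez' => h1 h2.
have k0 : 0 < l / (1 - l) by rewrite divr_gt0// subr_gt0.
have hu : l / (1 - l) * f e e <= l / (1 - l) * f u u by rewrite ler_pM2l.
have := ip_young fi e (- d) k0; rewrite !(ipE fi) opprK.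
have -> : (l / (1 - l))^-1 = l^-1 - 1 by field; rewrite !gt_eqF//; lra.
have h3 : 2 * (f r d + f e d) + l^-1 * f d d <= 0.
  rewrite -(pmulr_rle0 _ l0) mulrDr !mulrA divff ?gt_eqF//.
  by move: h2; rewrite !(ipE fi) (ipC fi d e) (ipC fi d r); lra.
rewrite (ipC fi d r); move: hu h3; set k := l / _; set m := l^-1; nra.
Qed.

Lemma residual_perturb x u :
  f (T x - x) (T x - x) <=
  2 * f (T (x - u) - (x - u)) (T (x - u) - (x - u)) + 8 * f u u.
Proof.
have h : f (T x - T (x - u)) (T x - T (x - u)) <= f u u.
  by have := neT x (x - u); rewrite opprB addrCA subrr addr0.
move: h; set a := T x - x; set b := T (x - u) - _.
have -> : T x - T (x - u) = a - b + u.
  by rewrite /a /b; apply: (ip_ext fi) => h; rewrite !(ipE fi); ring.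
move=> h; have := ip_sqD fi (a - b + u) (- u); rewrite addrK.
have := ip_sqD fi (a - b) b; rewrite subrK !(ipNl fi) !(ipNr fi) opprK; lra.
Qed.

End KrasnoselskiiMann.

Section Opial.
Context {R : realType} {V : lmodType R} {f : V -> V -> R}.
Hypothesis fi : inner_product f.
Hypothesis complete : forall u : nat -> V,
  (forall e, 0 < e -> exists N, forall m n, (N <= m)%N -> (N <= n)%N ->
     f (u m - u n) (u m - u n) < e) ->
  exists l, forall e, 0 < e -> exists N, forall n, (N <= n)%N ->
     f (u n - l) (u n - l) < e.

Lemma ip_midpoint x a b : f (x - 2^-1 *: (a + b)) (x - 2^-1 *: (a + b)) =
  2^-1 * f (x - a) (x - a) + 2^-1 * f (x - b) (x - b) - 4^-1 * f (a - b) (a - b).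
Proof.
by rewrite !(ipE fi) (ipC fi a x) (ipC fi b x) (ipC fi b a); field.
Qed.

Lemma ip_perturb (m e : R) : 0 <= m -> 0 < e -> exists2 d, 0 < d & forall x y,
  f x x <= m + d -> f y y <= d -> f (x + y) (x + y) <= m + e.
Proof.
move=> m0 e0; pose a := Num.min 1 (e / (4 * (m + 1))).
have ma0 : 0 < 4 * (m + 1) by lra.
have a0 : 0 < a by rewrite lt_min ltr01 divr_gt0.
have a1 : a <= 1 by rewrite ge_min lexx.
have am : a * (m + 1) <= e / 4.
  have -> : e / 4 = e / (4 * (m + 1)) * (m + 1) by field; rewrite !gt_eqF//; lra.
  by rewrite ler_wpM2r ?ge_min ?lexx ?orbT//; lra.
have b0 : 0 < 1 + a^-1 by rewrite addr_gt0// invr_gt0.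
pose d := Num.min (e / 4) (e / 4 / (1 + a^-1)).
have d0 : 0 < d by rewrite lt_min !divr_gt0.
have d1 : d <= e / 4 by rewrite ge_min lexx.
have d2 : d * (1 + a^-1) <= e / 4 by rewrite -ler_pdivlMr// ge_min lexx orbT.
exists d => // x y hx hy.
have := ip_young fi x y a0; rewrite !(ipE fi) (ipC fi y x).
have := ler_wpM2l (ltW a0) hx; have := ler_wpM2r (ltW b0) hy.
have : a * d <= 1 * d by rewrite ler_wpM2r// ltW.
by move=> h1 h2 h3 h4; lra.
Qed.

Definition asymptotic_center (x : nat -> V) (c : V) (m : R) : Prop :=
  (forall e, 0 < e -> exists N, forall k, (N <= k)%N ->
     f (x k - c) (x k - c) <= m + e) /\
  (forall y r N, (forall k, (N <= k)%N -> f (x k - y) (x k - y) <= r) ->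
     m + 2^-1 * f (y - c) (y - c) <= r).

Lemma asymptotic_center_exists (x : nat -> V) M : (forall k, f (x k) (x k) <= M) ->
  exists c m, asymptotic_center x c m.
Proof.
move=> xM.
pose U := [set r | exists y N, forall k, (N <= k)%N -> f (x k - y) (x k - y) <= r].
have U0 r : U r -> 0 <= r.
  by move=> [y [N h]]; apply: le_trans (h N (leqnn N)); exact: ip_ge0.
have infU : has_inf U.
  split; last by exists 0 => r /U0.
  by exists M, 0, 0%N => k _; rewrite subr0.
pose m := inf U.
have mU y r N : (forall k, (N <= k)%N -> f (x k - y) (x k - y) <= r) -> m <= r.
  by move=> h; apply: ge_inf; [case: infU|exists y, N].
have /choice[y hy] : forall n : nat, exists y, exists N, forall k, (N <= k)%N ->
    f (x k - y) (x k - y) <= m + n.+1%:R^-1.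
  move=> n; have n0 : 0 < n.+1%:R^-1 :> R by rewrite invr_gt0.
  have [r [y [N h]] rm] := inf_adherent n0 infU.
  by exists y, N => k Nk; apply: le_trans (h k Nk) _; exact: ltW.
have ymn a b : f (y a - y b) (y a - y b) <= 2 * (a.+1%:R^-1 + b.+1%:R^-1).
  have [N hN] := hy a; have [N' hN'] := hy b.
  have := @mU (2^-1 *: (y a + y b))
    (2^-1 * (m + a.+1%:R^-1) + 2^-1 * (m + b.+1%:R^-1)
     - 4^-1 * f (y a - y b) (y a - y b)) (maxn N N').
  set p := a.+1%:R^-1; set q := b.+1%:R^-1 => h.
  have {}h : m <= 2^-1 * (m + p) + 2^-1 * (m + q) - 4^-1 * f (y a - y b) (y a - y b).
    apply: h => k; rewrite geq_max => /andP[/hN h1 /hN' h2].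
    by rewrite ip_midpoint; move: h1 h2; rewrite -/p -/q => h1 h2; lra.
  lra.
have inv_small e : 0 < e -> exists N, forall n, (N <= n)%N -> n.+1%:R^-1 < e :> R.
  by move=> e0; have [N _ hN] := near_infty_natSinv_lt (PosNum e0); exists N.
have [c hc] : exists c, forall e, 0 < e -> exists N, forall n, (N <= n)%N ->
    f (y n - c) (y n - c) < e.
  apply: complete => e e0.
  have e40 : 0 < e / 4 by rewrite divr_gt0.
  have [N hN] := inv_small _ e40; exists N => a b /hN ha /hN hb.
  by apply: le_lt_trans (ymn a b) _; move: ha hb; set p := a.+1%:R^-1; set q := b.+1%:R^-1 => ha hb; lra.
have P1 e : 0 < e -> exists N, forall k, (N <= k)%N -> f (x k - c) (x k - c) <= m + e.
  move=> e0; have m0 : 0 <= m by apply: lb_le_inf; [case: infU|exact: U0].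
  have [d d0 hd] := ip_perturb m0 e0.
  have [N1 hN1] := inv_small _ d0; have [N2 hN2] := hc _ d0.
  have h1 := hN1 (maxn N1 N2) (leq_maxl _ _); have h2 := hN2 (maxn N1 N2) (leq_maxr _ _).
  have [N hN] := hy (maxn N1 N2); exists N => k /hN h3.
  rewrite (_ : x k - c = (x k - y (maxn N1 N2)) + (y (maxn N1 N2) - c)); last by rewrite addrA subrK.
  apply: hd; last exact: ltW.
  by apply: le_trans h3 _; rewrite lerD2l ltW.
exists c, m; split=> // z r N hr.
apply/ler_addgt0Pr => e e0.
have [N' hN'] := P1 _ e0.
have := @mU (2^-1 *: (c + z)) (2^-1 * (m + e) + 2^-1 * r - 4^-1 * f (c - z) (c - z))
   (maxn N N').
rewrite [f (c - z) _](ip_sqC fi) => h.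
have {}h : m <= 2^-1 * (m + e) + 2^-1 * r - 4^-1 * f (z - c) (z - c).
  apply: h => k; rewrite geq_max => /andP[/hr h1 /hN' h2].
  by rewrite ip_midpoint [f (c - z) _](ip_sqC fi); lra.
lra.
Qed.

Variable T : V -> V.
Hypothesis neT : forall x y, f (T x - T y) (T x - T y) <= f (x - y) (x - y).

Lemma asymptotic_center_fixpoint x c m :
  (forall e, 0 < e -> exists N, forall k, (N <= k)%N ->
     f (T (x k) - x k) (T (x k) - x k) < e) ->
  asymptotic_center x c m -> T c = c.
Proof.
move=> xT [P1 P2]; apply/eqP; rewrite -subr_eq0; apply/eqP; apply: (ip_eq0 fi).
apply/eqP; rewrite eq_le (ip_ge0 fi) andbT; apply/ler_addgt0Pr => e e0.
have m0 : 0 <= m.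
  apply/ler_addgt0Pr => d d0; have [N hN] := P1 _ d0.
  exact: le_trans (ip_ge0 fi _) (hN N (leqnn N)).
have e20 : 0 < e / 2 by rewrite divr_gt0.
have [d d0 hd] := ip_perturb m0 e20.
have [N1 hN1] := P1 _ d0; have [N2 hN2] := xT _ d0.
have := P2 (T c) (m + e / 2) (maxn N1 N2).
rewrite add0r => h.
have {}h : m + 2^-1 * f (T c - c) (T c - c) <= m + e / 2.
  apply: h => k; rewrite geq_max => /andP[/hN1 h1 /hN2 h2].
  rewrite (_ : x k - T c = (T (x k) - T c) + (x k - T (x k))).
    by apply: hd; [exact: le_trans (neT _ _) h1|rewrite (ip_sqC fi) ltW].
  by rewrite [RHS]addrC addrA subrK.
lra.
Qed.

(* Opial's lemma without weak compactness: every subsequence has the same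
   asymptotic center. *)
Lemma opial_weak_cvg x p0 : T p0 = p0 ->
  (forall p, T p = p -> exists l, f (x k - p) (x k - p) @[k --> \oo] --> (l : R)) ->
  (forall e, 0 < e -> exists N, forall k, (N <= k)%N ->
     f (T (x k) - x k) (T (x k) - x k) < e) ->
  exists c, T c = c /\ forall y, f (x k) y @[k --> \oo] --> f c y.
Proof.
move=> Tp0 xcvg xT.
have cvgN p l : f (x k - p) (x k - p) @[k --> \oo] --> (l : R) ->
    forall e, 0 < e -> exists N, forall k, (N <= k)%N ->
    l - e <= f (x k - p) (x k - p) <= l + e.
  move=> /cvgrPdist_le h e /h[N _ hN]; exists N => k /hN /=.
  by rewrite distrC ler_distl.
have [M xM] : exists M, forall k, f (x k) (x k) <= M.
  have [l hl] := xcvg _ Tp0.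
  have /cvg_seq_bounded[M [_ hM]] : cvgn (fun k => f (x k - p0) (x k - p0)).
    by apply/cvg_ex; exists l.
  exists (2 * (M + 1) + 2 * f p0 p0) => k.
  have M1 : M < M + 1 by rewrite ltrDl.
  have /(le_trans (ler_norm _)) h := hM (M + 1) M1 k I.
  by have := ip_sqD fi (x k - p0) p0; rewrite subrK; lra.
have [c [m cx]] := asymptotic_center_exists xM.
have Tc := asymptotic_center_fixpoint xT cx.
have centerE (s : nat -> nat) c' m' l : (forall n, (n <= s n)%N) ->
    asymptotic_center (x \o s) c' m' ->
    f (x k - c') (x k - c') @[k --> \oo] --> (l : R) -> l = m'.
  move=> sn [P1 P2] /cvgN hl; apply/eqP; rewrite eq_le; apply/andP; split.
    apply/ler_addgt0Pr => e e0.
    have e20 : 0 < e / 2 by lra.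
    have [N hN] := P1 _ e20; have [N' hN'] := hl _ e20.
    have := hN (maxn N N') (leq_maxl _ _).
    have := hN' (s (maxn N N')) (leq_trans (leq_maxr _ _) (sn _)).
    by move=> /= /andP[h1 h2] h3; lra.
  apply/ler_addgt0Pr => e /hl[N hN].
  have := P2 c' (l + e) N; rewrite subrr (ip0l fi) mulr0 addr0; apply => k Nk.
  by have /andP[] := hN (s k) (leq_trans Nk (sn k)).
have [l hl] := xcvg _ Tc.
have lm : l = m by apply: (centerE id _ _ _ _ cx hl).
exists c; split=> // y.
suff key z e : 0 < e -> exists N, forall k, (N <= k)%N -> f (x k - c) z < e.
  apply/cvgrPdist_lt => e e0.
  have [N hN] := key y e e0; have [N' hN'] := key (- y) e e0.
  exists (maxn N N') => // k /=; rewrite geq_max => /andP[/hN h1 /hN' h2].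
  by rewrite distrC ltr_distl; move: h1 h2; rewrite !(ipE fi) => h1 h2; apply/andP; split; lra.
move=> e0; apply: contrapT => /forallNP h.
have /choice[s hs] : forall N, exists k, (N <= k)%N /\ e <= f (x k - c) z.
  move=> N; have /existsNP[k /not_implyP[Nk /negP]] := h N.
  by rewrite -leNgt => ek; exists k.
have sn n : (n <= s n)%N by case: (hs n).
have sT d : 0 < d -> exists N, forall k, (N <= k)%N ->
    f (T (x (s k)) - x (s k)) (T (x (s k)) - x (s k)) < d.
  move=> /xT[N hN]; exists N => k Nk; apply: hN; exact: leq_trans (sn k).
have [c' [m' cx']] := asymptotic_center_exists (fun k => xM (s k)).
have Tc' := asymptotic_center_fixpoint sT cx'.
have [l' hl'] := xcvg _ Tc'.
have lm' : l' = m' := centerE _ _ _ _ sn cx' hl'.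
have cc' : f (c' - c) (c' - c) <= 0.
  apply/ler_addgt0Pr => d d0; have d20 : 0 < d / 2 by lra.
  have [N hN] := cvgN _ _ hl' _ d20.
  have h1 := cx.2 c' (l' + d / 2) N (fun k Nk => proj2 (andP (hN k Nk))).
  have [N' hN'] := cvgN _ _ hl _ d20.
  have h2 := cx'.2 c (l + d / 2) N'
    (fun k Nk => proj2 (andP (hN' (s k) (leq_trans Nk (sn k))))).
  move: h1 h2; rewrite (ip_sqC fi c) lm lm'; lra.
have ecc : c' = c.
  apply/eqP; rewrite -subr_eq0; apply/eqP; apply: (ip_eq0 fi).
  by apply/eqP; rewrite eq_le cc' ip_ge0.
rewrite ecc in cx' hl'.
have em : m' = m by rewrite -lm -lm'; apply: (cvg_unique _ hl' hl).
rewrite em in cx'.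
pose t := e / (f z z + 1).
have z0 := ip_ge0 fi z.
have t0 : 0 < t by rewrite divr_gt0//; lra.
have tz : t * (f z z + 1) = e by rewrite /t divfK ?gt_eqF//; lra.
have te0 : 0 < t * e by rewrite mulr_gt0.
have te20 : 0 < t * e / 2 by rewrite divr_gt0.
have [N hN] := cx'.1 _ te20.
have := cx'.2 (c + t *: z) (m - t * e / 2) N.
have := ip_ge0 fi (c + t *: z - c) => h1 h2.
suff : m + 2^-1 * f (c + t *: z - c) (c + t *: z - c) <= m - t * e / 2 by lra.
apply: h2 => k /hN /= h3.
have [_ h4] := hs k.
have -> : x (s k) - (c + t *: z) = (x (s k) - c) - t *: z by rewrite opprD addrA.
set w := x (s k) - c in h3 h4 *; clearbody w.
rewrite (ipDl fi) !(ipDr fi) !(ipNl fi) !(ipNr fi) !(ipZl fi) !(ipZr fi) (ipC fi z w).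
have h5 : t * e <= t * f w z by rewrite ler_pM2l.
have h6 : t * (t * f z z) <= t * e by rewrite ler_pM2l// -tz; lra.
lra.
Qed.

End Opial.

(** * Measurability in separable normed spaces *)

Definition dense_seq {R : realType} {V : normedModType R} (e : nat -> V) : Prop :=
  forall x (r : R), 0 < r -> exists i, `|x - e i| < r.

Lemma separable_dense_seq {R : realType} (V : normedModType R) :
  separable V -> exists e : nat -> V, dense_seq e.
Proof.
move=> [S [cS dS]].
have dS' x (r : R) : 0 < r -> exists2 s, S s & `|x - s| < r.
  move=> r0; have [||s [xs Ss]] := dS (ball x r).
  - by exists x; exact: ballxx.
  - exact: ball_open.
  by exists s => //; move: xs; rewrite -ball_normE.
have [S0|[f]] := pfcard_geP cS.
  by have [s] := dS' 0 1 ltr01; rewrite S0.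
exists f => x r /(dS' x)[s Ss xs].
by have [i _ fi] := @surj _ _ _ _ f s Ss; exists i; rewrite fi.
Qed.

Lemma dense_seq_pair {R : realType} {V W : normedModType R}
    (e : nat -> V) (e' : nat -> W) : dense_seq e -> dense_seq e' ->
  exists e2 : nat -> V * W, dense_seq e2.
Proof.
move=> he he'.
exists (fun n => if (choice.unpickle n : option (nat * nat)) is Some (i, j)
  then (e i, e' j) else (0, 0)).
move=> [x y] r r0; have [i hi] := he x r r0; have [j hj] := he' y r r0.
by exists (choice.pickle (i, j)); rewrite choice.pickleK prod_normE /= gt_max hi hj.
Qed.

Section VectorMeasurability.
Context {d} {M : measurableType d} {R : realType}.

Definition vmeasurable {V : normedModType R} (f : M -> V) : Prop :=
  forall y, measurable_fun setT (fun w => `|f w - y|).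

Lemma measurable_fun_caratheodory {V : normedModType R} (e : nat -> V)
    (f : M -> V) (G : M -> V -> R) : dense_seq e -> vmeasurable f ->
  (forall v, measurable_fun setT (G ^~ v)) -> (forall w, continuous (G w)) ->
  measurable_fun setT (fun w => G w (f w)).
Proof.
move=> he mf mG cG.
have n0 n : 0 < n.+1%:R^-1 :> R by rewrite invr_gt0.
have hex n w : exists i, `|f w - e i| < n.+1%:R^-1 by exact: he.
pose idx n w := ex_minn (hex n w).
have mA n i : measurable [set w | `|f w - e i| < n.+1%:R^-1].
  have -> : [set w | `|f w - e i| < n.+1%:R^-1] =
      (fun w => `|f w - e i|) @^-1` [set` `]-oo, n.+1%:R^-1[%R].
    by apply/seteqP; split => w /=; rewrite in_itv.
  by rewrite -[X in measurable X]setTI; exact: mf.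
have mE n i : measurable [set w | idx n w = i].
  have -> : [set w | idx n w = i] = [set w | `|f w - e i| < n.+1%:R^-1] `&`
      \bigcap_j (if (j < i)%N then ~` [set w | `|f w - e j| < n.+1%:R^-1] else setT).
    apply/seteqP; split => w /=.
      rewrite /idx; case: ex_minnP => m mm hm <-; split=> // j _.
      case: ltnP => // jm /= hj; by have := hm j hj; rewrite leqNgt jm.
    move=> [h1 h2]; rewrite /idx; case: ex_minnP => m mm hm.
    apply/eqP; rewrite eqn_leq hm//= leqNgt; apply/negP => mi.
    by have := h2 m I; rewrite mi /=.
  apply: measurableI; first exact: mA.
  apply: bigcapT_measurable => j; case: ifP => // _; exact/measurableC/mA.
apply: (@measurable_fun_cvg _ _ _ _ (fun n w => G w (e (idx n w)))).
  move=> n.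
  have -> : [set: M] = \bigcup_i [set w | idx n w = i].
    by apply/seteqP; split=> // w _; exists (idx n w).
  apply/measurable_fun_bigcup => [i|i]; first exact: mE.
  apply: (@eq_measurable_fun _ _ _ _ _ (G ^~ (e i))); last exact: measurable_funTS.
  by move=> w; rewrite inE /= => ->.
move=> w _; apply: (cvg_comp (fun n => e (idx n w)) (G w)); last exact: cG.
apply/cvgrPdist_lt => r r0.
have [N _ hN] := near_infty_natSinv_lt (PosNum r0); exists N => // n Nn /=.
rewrite /idx; case: ex_minnP => m mm _; exact: lt_trans mm (hN n Nn).
Qed.

Lemma vmeasurable_comp {V W : normedModType R} (e : nat -> V) (f : M -> V)
    (F : V -> W) : dense_seq e -> vmeasurable f -> continuous F ->
  vmeasurable (F \o f).
Proof.
move=> he mf cF y; apply: (measurable_fun_caratheodory (G := fun _ v => `|F v - y|) he mf).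
  by move=> v; exact: measurable_cst.
move=> _ v; apply: cvg_norm; apply: cvgB; [exact: cF|exact: cvg_cst].
Qed.

Lemma measurable_comp_continuous {V : normedModType R} (e : nat -> V) (f : M -> V)
    (F : V -> R) : dense_seq e -> vmeasurable f -> continuous F ->
  measurable_fun setT (F \o f).
Proof.
move=> he mf cF; apply: (measurable_fun_caratheodory (G := fun _ v => F v) he mf).
  by move=> v; exact: measurable_cst.
by [].
Qed.

Lemma vmeasurable_cst {V : normedModType R} (v : V) : vmeasurable (fun=> v).
Proof. by move=> y; exact: measurable_cst. Qed.

Lemma vmeasurable_pair {V W : normedModType R} (f : M -> V) (g : M -> W) :
  vmeasurable f -> vmeasurable g -> vmeasurable (fun w => (f w, g w)).
Proof.
move=> mf mg [y z]; rewrite (_ : (fun w => _) =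
  (fun w => Num.max `|f w - y| `|g w - z|)); first exact: measurable_maxr.
by apply/funext => w; rewrite prod_normE.
Qed.

Lemma vmeasurable_cvg {V : normedModType R} (h : nat -> M -> V) (f : M -> V) :
  (forall n, vmeasurable (h n)) -> (forall w, h n w @[n --> \oo] --> f w) ->
  vmeasurable f.
Proof.
move=> mh hf y; apply: (@measurable_fun_cvg _ _ _ _ (fun n w => `|h n w - y|)).
  by move=> n; exact: mh.
by move=> w _; apply: cvg_norm; apply: cvgB; [exact: hf|exact: cvg_cst].
Qed.

Lemma simple_preimage {V : normedModType R} (s : M -> V) (B : set V) :
  simple s -> measurable (s @^-1` B).
Proof.
move=> [fs ms].
have -> : s @^-1` B = \bigcup_(y in range s `&` B) s @^-1` [set y].
  apply/seteqP; split=> [w Bw|w [y [_ By] /= ->]] //=.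
  by exists (s w) => //; split=> //; exists w.
by apply: fin_bigcup_measurable => //; exact: sub_finite_set fs.
Qed.

Lemma simple_measurable {V : normedModType R} (s : M -> V) (F : V -> R) :
  simple s -> measurable_fun setT (F \o s).
Proof. by move=> ss _ B mB; rewrite setTI comp_preimage; exact: simple_preimage. Qed.

Lemma simple_comp {V W : normedModType R} (s : M -> V) (F : V -> W) :
  simple s -> simple (F \o s).
Proof.
move=> ss; split; last by move=> y; rewrite comp_preimage; exact: simple_preimage.
rewrite (_ : range _ = F @` range s); first by apply: finite_image; case: ss.
by rewrite image_comp.
Qed.

Lemma simple_if {V : normedModType R} (s : M -> V) (N : set M) (v : V) :
  measurable N -> simple s -> simple (fun w => if w \in N then v else s w).
Proof.
move=> mN ss; split.
  apply: (@sub_finite_set _ _ (v |` range s)).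
    by move=> _ [w _ <-]; case: ifPn => _; [left|right; exists w].
  by rewrite finite_setU; split; [exact: finite_set1|case: ss].
move=> y.
have -> : (fun w => if w \in N then v else s w) @^-1` [set y] =
    (N `&` [set w | v = y]) `|` (~` N `&` s @^-1` [set y]).
  apply/seteqP; split => w /=.
    by case: ifPn; rewrite ?inE ?notin_setE => Nw e; [left|right].
  by case=> -[Nw]; [rewrite mem_set|rewrite memNset].
apply: measurableU.
  apply: measurableI => //; have [->|vy] := pselect (v = y).
    by rewrite (_ : [set _ | _] = setT)//; apply/seteqP.
  by rewrite (_ : [set _ | _] = set0)//; apply/seteqP; split.
by apply: measurableI; [exact: measurableC|exact: simple_preimage].
Qed.

End VectorMeasurability.

Lemma vmeasurable_compl {d d'} {M : measurableType d} {M' : measurableType d'}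
    {R : realType} {V : normedModType R} (f : M' -> V) (g : M -> M') :
  measurable_fun setT g -> vmeasurable f -> vmeasurable (f \o g).
Proof. by move=> mg mf y; exact: (measurableT_comp (mf y) mg). Qed.

(** * Markov chains driven by an i.i.d. sequence *)

Section Independence.
Context {d d' : measure_display} {Omega : measurableType d}
  {Xi : measurableType d'} {R : realType}.
Variables (P : probability Omega R) (D : probability Xi R).
Variable xi : nat -> {mfun Omega >-> Xi}.

Definition history (k : nat) : set (set Omega) :=
  \bigcup_(j in [set j | (j < k)%N]) preimage_set_system setT (xi j) measurable.

Lemma history_measurable k : <<s history k >> `<=` measurable.
Proof.
apply: smallest_sub; first exact: sigma_algebra_measurable.
by move=> E [j _ [B mB <-]]; exact: measurable_funPT.
Qed.

Lemma history_mono k m : (k <= m)%N -> <<s history k >> `<=` <<s history m >>.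
Proof.
move=> km; apply: sub_sigma_algebra2; apply: bigcup_subset => j /= jk.
exact: leq_trans km.
Qed.

Lemma history_indep k E B : iid P D xi -> <<s history k >> E -> measurable B ->
  P (E `&` xi k @^-1` B) = (P E * D B)%E.
Proof.
move=> [iidD indep] hE mB.
have mxB : measurable (xi k @^-1` B) by rewrite -[X in measurable X]setTI; exact: measurable_funP.
have PxB : P (xi k @^-1` B) = D B by exact: iidD.
pose I := [set E | exists2 A : nat -> set Xi, (forall j, measurable (A j)) &
   E = \bigcap_(j in [set j | (j < k)%N]) xi j @^-1` A j].
have mI : I `<=` measurable.
  move=> _ [A mA ->]; apply: bigcap_measurableType => j _.
  by rewrite -[X in measurable X]setTI; exact: measurable_funP.
have histI : history k `<=` I.
  move=> _ [j /= jk [C mC <-]].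
  exists (fun i => if i == j then C else setT).
    by move=> i; case: ifP.
  apply/seteqP; split=> w /=.
    by move=> [_ Cw] i /= ik; case: eqVneq => [->|].
  by move=> /(_ j jk); rewrite eqxx.
have IT : I setT.
  by exists (fun=> setT) => //; apply/seteqP; split.
pose r : {nonneg R} := NngNum (fine_ge0 (measure_ge0 D B)).
have rE : r%:num%:E = D B by rewrite /= fineK// fin_num_measure.
rewrite muleC -rE -[LHS]/(mrestr P mxB E) -[RHS]/(mscale r P E).
apply: (g_sigma_algebra_measure_unique I mI (fun=> setT)) => //.
- by rewrite bigcup_const.
- move=> _ _ [A1 mA1 ->] [A2 mA2 ->]; exists (fun j => A1 j `&` A2 j).
    by move=> j; exact: measurableI.
  by rewrite -bigcapI.
- move=> _ [A mA ->]; rewrite /= /mrestr /mscale rE.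
  pose J := [fset x in iota 0 k]%fset.
  have kJ : k \notin J by rewrite !inE mem_iota /= ltnn.
  have JE : [set` J] = [set j | (j < k)%N].
    by apply/seteqP; split=> j /=; rewrite !inE mem_iota.
  pose A' j := if j == k then B else A j.
  have mA' j : measurable (A' j) by rewrite /A'; case: ifP.
  have eA' : \bigcap_(j in [set j | (j < k)%N]) xi j @^-1` A j =
     \bigcap_(j in [set` J]) xi j @^-1` A' j.
    by rewrite JE; apply: eq_bigcapr => j /= jk; rewrite /A' ltn_eqF.
  have := indep (k |` J)%fset A' mA'; rewrite big_fsetU1//= -indep// -eA'.
  have A'k : A' k = B by rewrite /A' eqxx.
  rewrite A'k PxB => <-; congr (P _).
  by rewrite set_fsetU1 bigcap_setU bigcap_set1 -eA' A'k setIC.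
- by move=> n; rewrite -ge0_fin_numE ?fin_num_measure//; apply: measurableI.
- exact: sub_sigma_algebra2 hE.
Qed.

(* Freezing lemma: when Z is independent of <<s G>>, an integrand that depends
   on w through <<s G>> and through Z w may be integrated over Z first. *)
Lemma ge0_integral_indep (d3 : measure_display) (Y : measurableType d3)
    (G : set (set Omega)) (Z : {mfun Omega >-> Y}) (Q : probability Y R)
    (phi : g_sigma_algebraType G * Y -> \bar R) :
  <<s G >> `<=` measurable ->
  (forall E B, <<s G >> E -> measurable B ->
     P (E `&` Z @^-1` B) = (P E * Q B)%E) ->
  measurable_fun setT phi -> (forall z, 0 <= phi z)%E ->
  (\int[P]_w phi (w, Z w) = \int[P]_w \int[Q]_y phi (w, y))%E.
Proof.
move=> mG indep mphi phi0.
have mid : measurable_fun setT (id : Omega -> g_sigma_algebraType G).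
  by move=> _ E hE; rewrite setTI; exact: mG.
pose idG : {mfun Omega >-> g_sigma_algebraType G} :=
  HB.pack (id : Omega -> g_sigma_algebraType G)
    (isMeasurableFun.Build _ _ _ _ _ mid).
have mp : measurable_fun setT (fun w : Omega => (w : g_sigma_algebraType G, Z w)).
  by apply: measurable_fun_pair => //; exact: measurable_funP.
pose pr : {mfun Omega >-> (g_sigma_algebraType G * Y)%type} :=
  HB.pack (fun w : Omega => (w : g_sigma_algebraType G, Z w))
    (isMeasurableFun.Build _ _ _ _ _ mp).
transitivity (\int[distribution P pr]_z phi z)%E.
  by rewrite ge0_integral_distribution.
transitivity (\int[(distribution P idG \x Q)%E]_z phi z)%E.
  apply: eq_measure_integral => E mE _; apply/esym.
  exact: product_measure_unique.
rewrite fubini_tonelli1//.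
rewrite ge0_integral_distribution//.
  exact: measurable_fun_fubini_tonelli_F.
by move=> w; apply: integral_ge0.
Qed.

End Independence.

Section MarkovChain.
Context {d d' : measure_display} {Omega : measurableType d}
  {Xi : measurableType d'} {R : realType} {V : normedModType R}.
Variables (P : probability Omega R) (D : probability Xi R).
Variable xi : nat -> {mfun Omega >-> Xi}.
Hypothesis xi_iid : iid P D xi.
Variables (step : nat -> V -> Xi -> V) (v0 : V) (e : nat -> V).
Hypothesis e_dense : dense_seq e.
Hypothesis step_meas : forall k v, vmeasurable (step k v).
Hypothesis step_cont : forall k z, continuous (step k ^~ z).

Fixpoint chain (k : nat) (w : Omega) : V :=
  if k is j.+1 then step j (chain j w) (xi j w) else v0.

Definition Om k := g_sigma_algebraType (history xi k).

Lemma history_measurable_fun k d3 (U : measurableType d3) (g : Omega -> U) :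
  measurable_fun setT (g : Om k -> U) -> measurable_fun setT g.
Proof.
by move=> mg _ B mB; apply: (@history_measurable _ _ _ _ xi k); exact: mg.
Qed.

Lemma xi_history k : measurable_fun setT (xi k : Om k.+1 -> Xi).
Proof.
move=> _ B mB; apply: sub_sigma_algebra; exists k; first exact: ltnSn.
by exists B.
Qed.

Lemma step_measurable_prod d3 (M : measurableType d3) k (f : M -> V) :
  vmeasurable f -> vmeasurable (fun z : M * Xi => step k (f z.1) z.2).
Proof.
move=> mf y.
apply: (measurable_fun_caratheodory (G := fun (z : M * Xi) v => `|step k v z.2 - y|) e_dense).
- by apply: (vmeasurable_compl _ mf); exact: measurable_fst.
- move=> v; exact: (measurableT_comp (step_meas k v y) measurable_snd).
- move=> z v; apply: cvg_norm; apply: cvgB; [exact: step_cont|exact: cvg_cst].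
Qed.

Lemma chain_vmeasurable k m : (k <= m)%N -> vmeasurable (chain k : Om m -> V).
Proof.
elim: k m => [|k IH] m km; first exact: vmeasurable_cst.
have mk := IH m (ltnW km).
have mxi : measurable_fun setT (xi k : Om m -> Xi).
  move=> _ B mB; apply: (history_mono km).
  exact: (xi_history measurableT mB).
have := @vmeasurable_compl _ _ (Om m) (Om m * Xi)%type R V
  (fun z => step k (chain k z.1) z.2) (fun w => (w, xi k w)).
apply; first by apply: measurable_fun_pair => //; exact: measurable_id.
exact: step_measurable_prod.
Qed.

Lemma chain_measurable_comp k (phi : V -> R) : continuous phi ->
  measurable_fun setT (phi \o chain k).
Proof.
move=> cphi; apply: (history_measurable_fun (k := k)).
exact: (measurable_comp_continuous e_dense (chain_vmeasurable (leqnn k))).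
Qed.

Lemma markov_step k (phi psi : V -> R) (E : set Omega) :
  continuous phi -> (forall v, 0 <= phi v) ->
  continuous psi -> (forall v, 0 <= psi v) ->
  (forall v, \int[D]_z (phi (step k v z))%:E <= (psi v)%:E)%E ->
  <<s history xi k >> E ->
  (\int[P]_(w in E) (phi (chain k.+1 w))%:E <= \int[P]_(w in E) (psi (chain k w))%:E)%E.
Proof.
move=> cphi phi0 cpsi psi0 phipsi hE.
have mE := history_measurable hE.
pose f (z : Om k * Xi) : \bar R :=
  (\1_E z.1 * phi (step k (chain k z.1) z.2))%:E.
have mf : measurable_fun setT f.
  apply/measurable_EFinP; apply: measurable_funM.
    apply: (@measurableT_comp _ _ _ _ _ _ (\1_E : Om k -> R)).
      exact: measurable_indic.
    exact: measurable_fst.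
  apply: (measurable_comp_continuous e_dense _ cphi).
  by apply: step_measurable_prod; exact: chain_vmeasurable.
have f0 z : (0 <= f z)%E by rewrite lee_fin mulr_ge0.
have h := ge0_integral_indep (P := P) (Z := xi k) (Q := D)
  (@history_measurable _ _ _ _ xi k) (fun E B => @history_indep _ _ _ _ _ _ _ xi k E B xi_iid) mf f0.
rewrite integral_mkcond.
have -> : (\int[P]_w ((fun w => (phi (chain k.+1 w))%:E) \_ E) w =
   \int[P]_w f (w, xi k w))%E.
  apply: eq_integral => w _; rewrite /f patchE indicE /=.
  by case: ifP; rewrite ?mul1r ?mul0r.
rewrite h [leRHS]integral_mkcond; apply: ge0_le_integral => //.
- by move=> w _; exact: integral_ge0.
- apply: (history_measurable_fun (k := k)).
  exact: (measurable_fun_fubini_tonelli_F f).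
- apply/(measurable_restrictT _ mE); apply: measurable_funTS; apply/measurable_EFinP.
  exact: chain_measurable_comp.
move=> w _; rewrite /f /= patchE indicE; case: ifP => wE.
  by apply: le_trans (phipsi _); under eq_integral do rewrite mul1r.
by under eq_integral do rewrite mul0r; rewrite integral0.
Qed.

End MarkovChain.

(** * Supermartingale convergence *)

Section Crossings.
Context {R : realType}.
Implicit Types (a b : R) (y : nat -> R).

(* Number of completed half-crossings: an even phase waits for y < a, an odd
   phase waits for b <= y. *)
Fixpoint phase a b y (n : nat) : nat :=
  if n is m.+1 then
    phase a b y m + (if odd (phase a b y m) then b <= y m else y m < a)
  else 0%N.

Lemma phase_mono a b y m n : (m <= n)%N -> (phase a b y m <= phase a b y n)%N.
Proof.
move=> /subnK <-; elim: (n - m)%N => // k IH.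
by rewrite addSn /=; apply: leq_trans IH _; exact: leq_addr.
Qed.

Lemma phase_unbounded a b y :
  (forall N, exists n, (N <= n)%N /\ y n < a) ->
  (forall N, exists n, (N <= n)%N /\ b <= y n) ->
  forall M, exists n, (M <= phase a b y n)%N.
Proof.
move=> ha hb; elim=> [|M [n Mn]]; first by exists 0%N.
have [m [nm hm]] : exists m, (n <= m)%N /\
    (if odd (phase a b y n) then b <= y m else y m < a).
  by case: odd.
have [neq|eq] := boolP (phase a b y n != phase a b y m).
  exists m; apply: leq_ltn_trans Mn _.
  by rewrite ltn_neqAle neq phase_mono.
exists m.+1 => /=; rewrite negbK in eq; rewrite -(eqP eq) hm addn1.
by rewrite ltnS.
Qed.

Lemma cvg_of_bounded_phase y C : (forall n, 0 <= y n) ->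
  (forall N, exists n, (N <= n)%N /\ y n <= C) ->
  (forall i n : nat, exists M, forall m,
     (phase (i%:R / n.+1%:R) (i.+1%:R / n.+1%:R) y m <= M)%N) ->
  exists l : R, y k @[k --> \oo] --> l.
Proof.
move=> y0 yC hph.
suff osc n : exists c N, forall k, (N <= k)%N -> `|y k - c| <= n.+1%:R^-1.
  apply: (@cauchy_seq_cvg R R^o y) => e e0.
  have e20 : 0 < e / 2 by lra.
  have [N _ hN] := near_infty_natSinv_lt (PosNum e20).
  have [c [N' hN']] := osc N; exists N' => m k /hN' hm /hN' hk.
  have /= := hN N (leqnn N); move: hm hk; set r := N.+1%:R^-1 => hm hk hlt.
  have -> : y m - y k = (y m - c) - (y k - c) by rewrite opprB addrA subrK.
  by apply: le_lt_trans (ler_normB _ _) _; lra.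
pose d : R := n.+1%:R^-1; have d0 : 0 < d by rewrite invr_gt0.
pose Q i := `[<forall N, exists k, (N <= k)%N /\ y k < i%:R * d>].
have exQ : exists i, Q i.
  exists (Num.truncn (C / d)).+1; apply/asboolP => N.
  have [k [Nk hk]] := yC N; exists k; split => //.
  apply: le_lt_trans hk _; rewrite -ltr_pdivrMr//.
  exact: truncnS_gt.
case: (ex_minnP exQ) => i Qi imin.
case: i Qi imin => [|i] /asboolP Qi imin.
  by have [k [_]] := Qi 0%N; rewrite mul0r ltNge y0.
have [M hM] := hph i.+1 n.
have [N1 hN1] : exists N, forall k, (N <= k)%N -> y k < i.+2%:R * d.
  apply: contrapT => /forallNP h.
  have hb N : exists k, (N <= k)%N /\ i.+2%:R / n.+1%:R <= y k.
    have /existsNP[k /not_implyP[Nk /negP]] := h N.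
    by rewrite -leNgt => ek; exists k.
  have [k] := phase_unbounded Qi hb M.+1.
  by rewrite ltnNge hM.
have [N2 hN2] : exists N, forall k, (N <= k)%N -> i%:R * d <= y k.
  apply: contrapT => /forallNP h.
  have : Q i.
    apply/asboolP => N; have /existsNP[k /not_implyP[Nk /negP]] := h N.
    by rewrite -ltNge => ek; exists k.
  by move/imin; rewrite ltnn.
exists (i.+1%:R * d), (maxn N1 N2) => k; rewrite geq_max => /andP[/hN1 h1 /hN2 h2].
have e1 : i.+1%:R = i%:R + 1 :> R by rewrite natr1.
have e2 : i.+2%:R = i%:R + 2 :> R by rewrite -natr1 e1; ring.
rewrite ler_distl -/d e1; move: h1 h2; rewrite e2 => h1 h2.
by apply/andP; split; lra.
Qed.

End Crossings.

Lemma phase_potential {R : realType} (a b y : R) p :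
  (b - a) * ((p + (if odd p then b <= y else y < a))./2)%:R +
    (if odd (p + (if odd p then b <= y else y < a)) then y else a) <=
  (b - a) * (p./2)%:R + (if odd p then y else a).
Proof.
have [op|ep] := boolP (odd p).
  have [h|h] := boolP (b <= y); last by rewrite addn0 op.
  rewrite addn1 /= op uphalf_half op /= add1n -natr1; lra.
have [h|h] := boolP (y < a); last by rewrite addn0 (negbTE ep).
by rewrite addn1 /= ep uphalf_half (negbTE ep) /= add0n lerD2l ltW.
Qed.

Lemma limn_einf_ub {R : realType} (u : nat -> \bar R) c :
  (forall n, u n <= c)%E -> (limn_einf u <= c)%E.
Proof.
move=> uc; rewrite limn_einf_lim; apply: lime_le; first exact: is_cvg_einfs.
apply: nearW => n; apply: le_trans (uc n); apply: ereal_inf_lbound.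
by exists n => /=.
Qed.

Lemma limn_einf_lb {R : realType} (u : nat -> \bar R) c N :
  (forall n, (N <= n)%N -> c <= u n)%E -> (c <= limn_einf u)%E.
Proof.
move=> uc; rewrite limn_einf_lim; apply: lime_ge; first exact: is_cvg_einfs.
exists N => // n /= Nn; apply: le_ereal_inf_tmp => _ [k /= nk <-].
by apply: uc; exact: leq_trans nk.
Qed.

Lemma ae_bounded_nondecreasing {d} {Omega : measurableType d} {R : realType}
    (P : probability Omega R) (f : nat -> Omega -> R) (B : R) :
  (forall n w, 0 <= f n w) -> (forall n, measurable_fun setT (f n)) ->
  (forall w, nondecreasing_seq (f ^~ w)) ->
  (forall n, \int[P]_w (f n w)%:E <= B%:E)%E ->
  {ae P, forall w, exists M, forall n, f n w <= M}.
Proof.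
move=> f0 mf ndf If.
pose g w := limn (fun n => (f n w)%:E).
have cg w : cvgn (fun n => (f n w)%:E).
  by apply: ereal_nondecreasing_is_cvgn => m n mn; rewrite lee_fin; exact: ndf.
have g0 w : (0 <= g w)%E.
  by apply: lime_ge; [exact: cg|apply: nearW => n; rewrite lee_fin].
have mg : measurable_fun setT g.
  apply: (emeasurable_fun_cvg (fun n w => (f n w)%:E)) => [n|w _]; last exact: cg.
  exact/measurable_EFinP.
have Ig : P.-integrable setT g.
  apply/integrableP; split=> //.
  under eq_integral do rewrite gee0_abs//.
  have -> : (\int[P]_w g w = limn (fun n => \int[P]_w (f n w)%:E))%E.
    apply: monotone_convergence => // [n|n w _|w _ m n mn].
    - exact/measurable_EFinP.
    - by rewrite lee_fin.
    - by rewrite lee_fin; exact: ndf.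
  apply: (@le_lt_trans _ _ B%:E); last exact: ltry.
  apply: lime_le; last by apply: nearW => n; exact: If.
  apply: ereal_nondecreasing_is_cvgn => m n mn.
  apply: ge0_le_integral => //.
  - by move=> w _; rewrite lee_fin.
  - exact/measurable_EFinP.
  - exact/measurable_EFinP.
  - by move=> w _; rewrite lee_fin; exact: ndf.
have := integrable_ae measurableT Ig.
apply: filterS => w /(_ I) gfin; exists (fine (g w)) => n.
rewrite -lee_fin fineK//; apply: lime_ge; first exact: cg.
by exists n => // m /= nm; rewrite lee_fin; exact: ndf.
Qed.

Section Supermartingale.
Context {d : measure_display} {Omega : measurableType d} {R : realType}.
Variables (P : probability Omega R) (G : nat -> set (set Omega)).
Hypothesis Gm : forall k, <<s G k >> `<=` measurable.
Hypothesis G_mono : forall k, <<s G k >> `<=` <<s G k.+1 >>.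
Variable Y : nat -> Omega -> R.
Hypothesis Y0 : forall k w, 0 <= Y k w.
Hypothesis mY : forall k, measurable_fun setT (Y k : g_sigma_algebraType (G k) -> R).
Variables (eps : nat -> R) (S : R).
Hypothesis eps_sum : forall n, \sum_(i < n) eps i <= S.
Hypothesis eps0 : forall n, 0 <= eps n.
Hypothesis Y_step : forall k E, <<s G k >> E ->
  (\int[P]_(w in E) (Y k.+1 w)%:E <= \int[P]_(w in E) (Y k w)%:E + (eps k)%:E)%E.

Let mYO k : measurable_fun setT (Y k).
Proof. by move=> _ B mB; apply: (@Gm k); exact: mY. Qed.

Lemma phase_measurable d' (M : measurableType d') (Z : nat -> M -> R) a b n :
  (forall i, (i < n)%N -> measurable_fun setT (Z i)) ->
  measurable_fun setT (fun w => phase a b (Z ^~ w) n).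
Proof.
elim: n => [|n IH] mZ /=; first exact: measurable_cst.
have mph : measurable_fun setT (fun w => phase a b (Z ^~ w) n).
  by apply: IH => i ni; apply: mZ; exact: ltnW.
have modd : measurable_fun setT (fun w => odd (phase a b (Z ^~ w) n)).
  exact: (@measurableT_comp _ _ _ _ _ _ odd).
have mc : measurable_fun setT (fun w => if odd (phase a b (Z ^~ w) n)
    then b <= Z n w else Z n w < a).
  apply: measurable_fun_ifT => //.
    by apply: measurable_fun_ler => //; exact: mZ.
  by apply: measurable_fun_ltr => //; exact: mZ.
apply: measurable_fun_addn => //.
exact: (@measurableT_comp _ _ _ _ _ _ nat_of_bool).
Qed.

Let phase_history a b n :
  measurable_fun setT ((fun w => phase a b (Y ^~ w) n.+1) : g_sigma_algebraType (G n) -> nat).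
Proof.
apply: (@phase_measurable _ (g_sigma_algebraType (G n)) Y) => i /=; rewrite ltnS => ni.
move=> _ B mB; rewrite -(subnK ni); elim: (n - i)%N => [|k IH]; first exact: mY.
by rewrite addSn; exact: G_mono.
Qed.

Lemma upcrossing_bound a b n : 0 <= a -> a < b ->
  (\int[P]_w ((b - a) * (phase a b (Y ^~ w) n.+1)./2%:R +
     (if odd (phase a b (Y ^~ w) n.+1) then Y n w else a))%:E <= (a + S)%:E)%E.
Proof.
move=> a0 ab.
pose q n w := phase a b (Y ^~ w) n.
pose E n := [set w | odd (q n.+1 w)].
have mq n' : measurable_fun setT (q n').
  by apply: phase_measurable => i _; exact: mYO.
have hE m : <<s G m >> (E m).
  have := @phase_history a b m measurableT [set k | odd k] I.
  by rewrite setTI.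
have mE m : measurable (E m) by apply: (@Gm m); exact: hE.
have ba0 : 0 < b - a by rewrite subr_gt0.
pose W m m' w := (b - a) * (q m.+1 w)./2%:R + (if odd (q m.+1 w) then Y m' w else a).
have W0 m m' w : 0 <= W m m' w.
  by rewrite addr_ge0 ?mulr_ge0 ?(ltW ba0)//; case: ifP.
pose F m w := (b - a) * (q m.+1 w)./2%:R + a * \1_(~` E m) w.
have F0 m w : 0 <= F m w.
  by rewrite addr_ge0 ?mulr_ge0 ?(ltW ba0)// indicE.
have mF m : measurable_fun setT (F m).
  apply: measurable_funD.
    exact: (@measurableT_comp _ _ _ _ _ _ (fun k : nat => (b - a) * k./2%:R)).
  by apply: measurable_funM => //; apply: measurable_indic; exact: measurableC.
have WFY m m' w : W m m' w = F m w + \1_(E m) w * Y m' w.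
  rewrite /W /F !indicE in_setC -addrA; congr (_ + _).
  have -> : (w \in E m) = odd (q m.+1 w) by apply/idP/idP; rewrite inE.
  by case: odd => /=; ring.
have mEY m m' : measurable_fun setT (fun w => \1_(E m) w * Y m' w).
  by apply: measurable_funM => //; exact: measurable_indic.
have mW m m' : measurable_fun setT (W m m').
  rewrite (_ : W m m' = fun w => F m w + \1_(E m) w * Y m' w).
    exact: measurable_funD.
  by apply/funext => w; rewrite WFY.
have WE m m' : (\int[P]_w (W m m' w)%:E =
   \int[P]_w (F m w)%:E + \int[P]_(w in E m) (Y m' w)%:E)%E.
  rewrite [in X in (_ + X)%E]integral_mkcond.
  transitivity (\int[P]_w ((F m w)%:E + (\1_(E m) w * Y m' w)%:E))%E.
    by apply: eq_integral => w _; rewrite WFY.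
  rewrite ge0_integralD//.
  - congr (_ + _)%E; apply: eq_integral => w _; rewrite patchE indicE.
    by case: ifP => _; rewrite ?mul1r ?mul0r.
  - by move=> w _; rewrite lee_fin.
  - exact/measurable_EFinP.
  - by move=> w _; rewrite lee_fin mulr_ge0// indicE.
  - exact/measurable_EFinP.
have key m : (\int[P]_w (W m m w)%:E <= (a + \sum_(i < m) eps i)%:E)%E.
  elim: m => [|m IH].
    rewrite big_ord0 addr0 -[leRHS]mule1 -(probability_setT P) -integral_cst//.
    apply: ge0_le_integral => //.
    - by move=> w _; rewrite lee_fin.
    - exact/measurable_EFinP.
    move=> w _; rewrite lee_fin /W /q /=.
    by have [h|h] := boolP (Y 0 w < a); rewrite /= mulr0 add0r// ltW.
  apply: (@le_trans _ _ (\int[P]_w (W m m.+1 w)%:E)%E).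
    apply: ge0_le_integral => //.
    - by move=> w _; rewrite lee_fin.
    - exact/measurable_EFinP.
    - exact/measurable_EFinP.
    - by move=> w _; rewrite lee_fin; exact: phase_potential.
  rewrite WE.
  apply: le_trans (leeD2l _ (Y_step (hE m))) _.
  rewrite addeA -WE big_ord_recr /= addrA EFinD.
  exact: leeD2r.
apply: le_trans (key n) _; rewrite lee_fin lerD2l; exact: eps_sum.
Qed.

Lemma ae_bounded_phase a b : 0 <= a -> a < b ->
  {ae P, forall w, exists M, forall n, (phase a b (Y ^~ w) n <= M)%N}.
Proof.
move=> a0 ab; have ba0 : 0 < b - a by rewrite subr_gt0.
pose f n w : R := (b - a) * (phase a b (Y ^~ w) n.+1)./2%:R.
have mf n : measurable_fun setT (f n).
  apply: (@measurableT_comp _ _ _ _ _ _ (fun k : nat => (b - a) * k./2%:R)) => //.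
  by apply: phase_measurable => i _; exact: mYO.
suff : {ae P, forall w, exists M, forall n, f n w <= M}; last first.
  apply: (@ae_bounded_nondecreasing _ _ _ P f (a + S)) => // [n w|w m n mn|n].
  - by rewrite mulr_ge0// ltW.
  - rewrite ler_wpM2l ?(ltW ba0)// ler_nat; apply: half_leq; exact: phase_mono.
  apply: le_trans (upcrossing_bound n a0 ab); apply: ge0_le_integral => //.
  - by move=> w _; rewrite lee_fin mulr_ge0// ltW.
  - exact/measurable_EFinP.
  - apply/measurable_EFinP; apply: measurable_funD; first exact: (mf n).
    apply: measurable_fun_ifT => //.
    apply: (@measurableT_comp _ _ _ _ _ _ odd) => //.
    by apply: phase_measurable => i _; exact: mYO.
  - by move=> w _; rewrite lee_fin lerDl; case: ifP.
apply: filterS => w [M hM].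
exists (2 * (Num.truncn (M / (b - a))).+1)%N => n.
apply: leq_trans (phase_mono a b _ (leqnSn n)) _.
have := hM n; rewrite /f mulrC -ler_pdivlMr//.
set p := phase _ _ _ _ => h.
have : p./2%:R < (Num.truncn (M / (b - a))).+1%:R :> R.
  by apply: le_lt_trans h _; exact: truncnS_gt.
rewrite ltr_nat => {}h.
rewrite -[p]odd_double_half -muln2 mulnC.
case: (odd p); rewrite ?add0n ?add1n.
  by apply: (@leq_trans (2 * (p./2).+1)); [rewrite mulnS|rewrite leq_mul2l].
by rewrite leq_mul2l/= ltnW.
Qed.

Lemma ae_cvg_supermartingale (C : R) : (\int[P]_w (Y 0 w)%:E <= C%:E)%E ->
  {ae P, forall w, exists l : R, Y k w @[k --> \oo] --> l}.
Proof.
move=> Y0C.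
have YC n : (\int[P]_w (Y n w)%:E <= (C + S)%:E)%E.
  apply: (@le_trans _ _ (C + \sum_(i < n) eps i)%:E); last by rewrite lee_fin lerD2l.
  elim: n => [|n IH]; first by rewrite big_ord0 addr0.
  have T0 : <<s G n >> setT.
    by have := @measurableT _ (g_sigma_algebraType (G n)).
  apply: le_trans (Y_step T0) _; rewrite big_ord_recr /= addrA EFinD.
  exact: leeD2r.
have mEY n : measurable_fun setT (fun w => (Y n w)%:E) by exact/measurable_EFinP.
have fat : (\int[P]_w limn_einf (fun n => (Y n w)%:E) <=
    limn_einf (fun n => \int[P]_w (Y n w)%:E))%E.
  by apply: fatou => // n w _; rewrite lee_fin.
pose g w := limn_einf (fun n => (Y n w)%:E).
have mg : measurable_fun setT g.
  apply: (emeasurable_fun_cvg (fun n w => einfs (fun n => (Y n w)%:E) n)).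
    by move=> n; exact: measurable_fun_einfs.
  by move=> w _; rewrite /g limn_einf_lim; exact: is_cvg_einfs.
have g0 w : (0 <= g w)%E by apply: (@limn_einf_lb _ _ _ 0%N) => n _; rewrite lee_fin.
have Ig : P.-integrable setT g.
  apply/integrableP; split=> //; under eq_integral do rewrite gee0_abs//.
  apply: le_lt_trans fat _; apply: (@le_lt_trans _ _ (C + S)%:E); last exact: ltry.
  exact: limn_einf_ub.
have aeC := integrable_ae measurableT Ig.
have aeph : {ae P, forall w, forall i n : nat, exists M, forall m,
     (phase (i%:R / n.+1%:R) (i.+1%:R / n.+1%:R) (Y ^~ w) m <= M)%N}.
  apply: ae_foralln => i; apply: ae_foralln => n; apply: ae_bounded_phase.
    by rewrite divr_ge0.
  by rewrite ltr_pM2r ?invr_gt0// ltr_nat.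
move: aeC aeph; apply: filterS2 => w /(_ I) gfin hph.
apply: (@cvg_of_bounded_phase _ _ (fine (g w) + 1)) => //.
move=> N; apply: contrapT => /forallNP h.
have : ((fine (g w) + 1)%:E <= g w)%E.
  apply: (@limn_einf_lb _ _ _ N) => n Nn; rewrite lee_fin leNgt; apply/negP => Yn.
  by apply: (h n); split=> //; exact: ltW.
by rewrite -[leRHS](fineK gfin) lee_fin gerDl ler10.
Qed.

End Supermartingale.

(** * Bochner integrals *)

Lemma cvge0_lt {R : realType} (u : nat -> \bar R) (r : R) : 0 < r ->
  u n @[n --> \oo] --> 0%E -> \forall n \near \oo, (u n < r%:E)%E.
Proof.
move=> r0 /fine_cvgP[ufin /cvgrPdist_lt /(_ r r0)].
apply: filterS2 ufin => n un; rewrite sub0r normrN => h.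
by rewrite -(fineK un) lte_fin (le_lt_trans (ler_norm _)).
Qed.

Lemma measurable_mem {d} {T : measurableType d} (N : set T) : measurable N ->
  measurable_fun setT (fun x => x \in N).
Proof.
move=> mN; apply: (measurable_fun_bool true); rewrite setTI (_ : _ @^-1` _ = N)//.
by apply/seteqP; split=> x /=; [exact: set_mem|exact: mem_set].
Qed.

Section LowerIntegral.
Context {d} {T : measurableType d} {R : realType}.
Variable mu : {measure set T -> \bar R}.
Local Open Scope ereal_scope.

(* No measurability is assumed: the library's integral of a nonnegative
   function is a lower integral. *)
Lemma ge0_integral_mono (f g : T -> \bar R) : (forall x, 0 <= f x) ->
  (forall x, f x <= g x) -> \int[mu]_x f x <= \int[mu]_x g x.
Proof.
move=> f0 fg; have g0 x : 0 <= g x by apply: le_trans (f0 x) (fg x).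
rewrite !ge0_integralTE//; apply: ereal_sup_le => _ [h hf <-]; exists h => //= x.
exact: le_trans (hf x) (fg x).
Qed.

Lemma ge0_integral_modify (N : set T) (c : \bar R) (g : T -> \bar R) :
  measurable N -> mu N = 0 -> 0 <= c -> (forall x, 0 <= g x) -> measurable_fun setT g ->
  \int[mu]_x (if x \in N then c else g x) = \int[mu]_x g x.
Proof.
move=> mN N0 c0 g0 mg; apply: ge0_ae_eq_integral => //.
- by apply: measurable_fun_ifT => //; exact: measurable_mem.
- by move=> x _; case: ifP.
exists N; split=> // x /= /not_implyP[_ hx]; apply: contrapT => Nx; apply: hx.
by rewrite memNset.
Qed.

Lemma ge0_integral_ae_mono (f g : T -> \bar R) : (forall x, 0 <= f x) ->
  (forall x, 0 <= g x) -> measurable_fun setT g ->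
  {ae mu, forall x, f x <= g x} -> \int[mu]_x f x <= \int[mu]_x g x.
Proof.
move=> f0 g0 mg [N [mN N0 hN]]; rewrite -(ge0_integral_modify mN N0 (leey 0) g0 mg).
apply: ge0_integral_mono => // x; case: ifPn => [_|]; first exact: leey.
by rewrite notin_setE => Nx; apply: contrapT => nfg; apply: Nx; exact: hN.
Qed.

Lemma ge0_integral_ae_eq (f g : T -> \bar R) : (forall x, 0 <= f x) ->
  (forall x, 0 <= g x) -> measurable_fun setT g ->
  {ae mu, forall x, f x = g x} -> \int[mu]_x f x = \int[mu]_x g x.
Proof.
move=> f0 g0 mg fg; apply/eqP; rewrite eq_le; apply/andP; split.
  by apply: ge0_integral_ae_mono => //; apply: filterS fg => x ->.
case: fg => N [mN N0 hN]; rewrite -(ge0_integral_modify mN N0 (lexx 0) g0 mg).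
apply: ge0_integral_mono => x; first by case: ifP.
case: ifPn => [//|]; rewrite notin_setE => Nx.
by suff -> : f x = g x by []; apply: contrapT => fgx; apply: Nx; exact: hN.
Qed.

End LowerIntegral.

Lemma probability_integral_cst {d} {T : measurableType d} {R : realType}
  (D : probability T R) (r : R) : (\int[D]_t r%:E = r%:E)%E.
Proof. by rewrite -[RHS]mule1 -(probability_setT D) -integral_cst. Qed.

Section WeakBochner.
Context {d} {T : measurableType d} {R : realType} {V : normedModType R}.
Variable D : probability T R.

Lemma simple_bounded (s : T -> V) : simple s -> exists K, forall t, `|s t| <= K.
Proof.
move=> [fs _].
exists (\sum_(y <- fset_set (range s)) `|y|) => t.
rewrite (bigD1_seq (s t)) ?fset_uniq//=; last by rewrite in_fset_set// mem_set.
by rewrite lerDl sumr_ge0.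
Qed.

Section Functional.
Variables (l : V -> R) (M : R).
Hypotheses (lD : forall u v, l (u + v) = l u + l v).
Hypotheses (lZ : forall a u, l (a *: u) = a * l u).
Hypotheses (lM : forall u, `|l u| <= M * `|u|).

Let lB u v : l (u - v) = l u - l v.
Proof. by rewrite -scaleN1r lD lZ mulN1r. Qed.

Lemma bounded_functional_continuous : continuous l.
Proof. by apply: (lipschitz_continuous (K := M)) => x y; rewrite -lB. Qed.

Lemma simple_functional_integrable (s : T -> V) : simple s ->
  D.-integrable setT (fun t => (l (s t))%:E).
Proof.
move=> ss; have [K hK] := simple_bounded ss.
apply: measurable_bounded_integrable => //.
- exact: fin_num_fun_lty.
- exact: (simple_measurable l ss).
- exists (`|M| * `|K|); split; first exact: num_real.
  move=> x Mx t _; apply: le_trans (lM _) _; apply: le_trans (ltW Mx).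
  apply: (@le_trans _ _ (`|M| * `|s t|)); first by rewrite ler_wpM2r// ler_norm.
  by rewrite ler_wpM2l// (le_trans (hK t))// ler_norm.
Qed.

Lemma simple_integral_functional (s : T -> V) : simple s ->
  (\int[D]_t (l (s t))%:E = (l (simple_integral D s))%:E)%E.
Proof.
move=> ss; have [fs ms] := ss.
have l0 : l 0 = 0 by rewrite -(scale0r 0) lZ mul0r.
rewrite /simple_integral fsbig_finite//=.
set r := fset_set (range s).
have -> : l (\sum_(y <- r) fine (D (s @^-1` [set y])) *: y) =
    \sum_(y <- r) fine (D (s @^-1` [set y])) * l y.
  by elim/big_ind2 : _ => [//|x1 x2 y1 y2 <- <-|y _]; rewrite ?lD ?lZ.
have sE t : (l (s t))%:E = (\sum_(y <- r) (l y)%:E * (\1_(s @^-1` [set y]) t)%:E)%E.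
  rewrite (bigD1_seq (s t)) ?fset_uniq//=; last by rewrite in_fset_set// mem_set.
  rewrite indicE mem_set// mule1 big1 ?adde0// => y ysn.
  by rewrite indicE memNset ?mule0//= => e; rewrite e eqxx in ysn.
under eq_integral do rewrite sE.
have mi y : D.-integrable setT (fun t => (\1_(s @^-1` [set y]) t)%:E).
  exact: integrable_indic.
rewrite integral_sum//; last by move=> y; apply: integrableZl.
rewrite -sumEFin; apply: eq_bigr => y _.
rewrite integralZl// integral_indic// setIT muleC EFinM fineK//.
exact: fin_num_measure.
Qed.

Variable e : nat -> V.
Hypothesis e_dense : dense_seq e.
Variables (f f' : T -> V) (m : V).
Hypothesis (ff' : {ae D, forall t, f t = f' t}) (mf' : vmeasurable f').

Lemma vmeasurable_normB (g h : T -> V) : vmeasurable g -> vmeasurable h ->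
  measurable_fun setT (fun t => `|g t - h t|).
Proof.
move=> mg mh.
apply: (measurable_fun_caratheodory (G := fun t v => `|v - h t|) e_dense mg).
  move=> v; rewrite (_ : (fun t => _) = (fun t => `|h t - v|)); first exact: mh.
  by apply/funext => t; rewrite distrC.
by move=> t v; apply: cvg_norm; apply: cvgB; [exact: cvg_id|exact: cvg_cst].
Qed.

Lemma simple_vmeasurable (s : T -> V) : simple s -> vmeasurable s.
Proof. by move=> ss y; exact: (simple_measurable (fun v => `|v - y|) ss). Qed.

Lemma bochner_approx_mod (s : nat -> T -> V) : bochner_approx D f s ->
  (\int[D]_t (`|f' t - s n t|)%:E @[n --> \oo] --> 0)%E.
Proof.
move=> [ss cs]; rewrite (_ : (fun n => _) =
  (fun n => \int[D]_t (`|f t - s n t|)%:E)%E)//.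
apply/funext => n; apply/esym/ge0_integral_ae_eq.
- by move=> t; rewrite lee_fin.
- by move=> t; rewrite lee_fin.
- by apply/measurable_EFinP; apply: vmeasurable_normB => //; exact: simple_vmeasurable.
- by apply: filterS ff' => t ->.
Qed.

Lemma is_bochner_integral_weak : is_bochner_integral D f m ->
  D.-integrable setT (fun t => (l (f' t))%:E) /\
  (\int[D]_t (l (f' t))%:E = (l m)%:E)%E.
Proof.
move=> [_ [s [sa si]]]; have as0 := bochner_approx_mod sa.
have ss n : simple (s n) by exact: sa.1.
have md n : measurable_fun setT (fun t => `|f' t - s n t|).
  by apply: vmeasurable_normB => //; exact: simple_vmeasurable.
have ml : measurable_fun setT (fun t => l (f' t)).
  exact: (measurable_comp_continuous e_dense mf' bounded_functional_continuous).
have M0 : 0 <= `|M| by [].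
have lM' u : `|l u| <= `|M| * `|u|.
  by apply: le_trans (lM u) _; rewrite ler_wpM2r// ler_norm.
have il : D.-integrable setT (fun t => (l (f' t))%:E).
  have [n hn] : exists n, (\int[D]_t (`|f' t - s n t|)%:E < +oo)%E.
    have [n _ hn] := cvge0_lt ltr01 as0.
    by exists n; apply: lt_trans (hn n (leqnn n)) _; exact: ltry.
  have id : D.-integrable setT (fun t => (`|M| * `|f' t - s n t|)%:E).
    apply/integrableP; split; first by apply/measurable_EFinP; exact: measurable_funM.
    under eq_integral do rewrite gee0_abs ?lee_fin ?mulr_ge0// EFinM.
    rewrite ge0_integralZl_EFin//; first exact: lte_mul_pinfty.
    exact/measurable_EFinP.
  have is' := simple_functional_integrable (ss n).
  have iad := integrableD measurableT id (integrable_abse is').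
  apply: (le_integrable measurableT _ _ iad); first exact/measurable_EFinP.
  move=> t _; rewrite -EFinD /= lee_fin [leRHS]ger0_norm; last by rewrite addr_ge0// mulr_ge0.
  rewrite -[X in l X](subrK (s n t)) lD.
  by apply: le_trans (ler_normD _ _) _; rewrite lerD2r.
split=> //.
have Ifin : (\int[D]_t (l (f' t))%:E)%E \is a fin_num.
  exact: integrable_fin_num.
rewrite -[LHS](fineK Ifin); congr EFin.
set I := fine _.
have lsi : l (simple_integral D (s n)) @[n --> \oo] --> l m.
  by apply: (cvg_comp (fun n => simple_integral D (s n)) l si); exact: bounded_functional_continuous.
suff : l (simple_integral D (s n)) @[n --> \oo] --> I.
  by move=> h; apply: (cvg_unique _ h lsi).
apply/cvgrPdist_le => eps eps0.
have e1 : 0 < eps / (`|M| + 1) by rewrite divr_gt0// ltr_wpDl.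
apply: filterS (cvge0_lt e1 as0) => n hn.
rewrite -lee_fin -abse_EFin EFinB -simple_integral_functional// fineK//.
rewrite -integralB_EFin//; last exact: simple_functional_integrable.
apply: le_trans (le_abse_integral _ _ _) _ => //.
  apply: emeasurable_funB; apply/measurable_EFinP => //.
  exact: (simple_measurable l (ss n)).
apply: (@le_trans _ _ (\int[D]_t (`|M|%:E * (`|f' t - s n t|)%:E))%E).
  apply: ge0_integral_mono => t; first exact: abse_ge0.
  by rewrite -EFinB -EFinM abse_EFin lee_fin -lB.
rewrite ge0_integralZl_EFin//; last exact/measurable_EFinP.
apply: (@le_trans _ _ (`|M|%:E * (eps / (`|M| + 1))%:E)%E).
  by rewrite lee_wpmul2l ?lee_fin// ltW.
rewrite -EFinM lee_fin mulrCA ger_pMr// ler_pdivrMr ?mul1r ?lerDl//.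
Qed.

End Functional.

Lemma strongly_measurable_mod (f : T -> V) : strongly_measurable D f ->
  exists2 f' : T -> V, vmeasurable f' & {ae D, forall t, f t = f' t}.
Proof.
move=> [s [ss [N [mN N0 hN]]]].
exists (fun t => if t \in N then 0 else f t); last first.
  exists N; split=> // t /= hf; apply: contrapT => Nt; apply: hf.
  by rewrite memNset.
apply: (@vmeasurable_cvg _ _ _ _ (fun n t => if t \in N then 0 else s n t)).
  by move=> n y; apply: (simple_measurable (fun v => `|v - y|)); exact: simple_if.
move=> t; case: ifPn => [_|]; first exact: cvg_cst.
by rewrite notin_setE => Nt; apply: contrapT => h; apply: Nt; exact: hN.
Qed.

End WeakBochner.

Section BochnerHilbert.
Context {d} {T : measurableType d} {R : realType} {V : normedModType R}.
Variable D : probability T R.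
Variable f : V -> V -> R.
Hypothesis fi : inner_product f.
Hypothesis f_bound : forall h, exists M, forall u, `|f u h| <= M * `|u|.
Variable e : nat -> V.
Hypothesis e_dense : dense_seq e.

Lemma is_bochner_integral_unique (g : T -> V) m m' :
  is_bochner_integral D g m -> is_bochner_integral D g m' -> m = m'.
Proof.
move=> gm gm'; apply: (ip_ext fi) => h.
have [g' mg' gg'] := strongly_measurable_mod gm.1.
have [M hM] := f_bound h.
have lD u v : f (u + v) h = f u h + f v h := ipDl fi u v h.
have lZ a u : f (a *: u) h = a * f u h := ipZl fi a u h.
have [_ e1] := is_bochner_integral_weak lD lZ hM e_dense gg' mg' gm.
have [_ e2] := is_bochner_integral_weak lD lZ hM e_dense gg' mg' gm'.
by apply: EFin_inj; rewrite -e1 -e2.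
Qed.

Lemma bochner_eq (g : T -> V) m : is_bochner_integral D g m -> bochner D g = m.
Proof.
move=> gm; apply: xget_unique => // m' gm'.
exact: is_bochner_integral_unique gm' gm.
Qed.

End BochnerHilbert.

Section BochnerComplete.
Context {d} {T : measurableType d} {R : realType} {H : completeNormedModType R}.
Variable D : probability T R.
Variable ip : H -> H -> R.
Hypotheses (fi : inner_product ip) (fn : forall x, ip x x = `|x| ^+ 2).
Variable e : nat -> H.
Hypothesis e_dense : dense_seq e.

Lemma ip_bound h : forall u, `|ip u h| <= `|h| * `|u|.
Proof. by move=> u; rewrite mulrC; exact: ip_le_norm. Qed.

Lemma simple_integral_dist (s t : T -> H) : simple s -> simple t ->
  (`|simple_integral D s - simple_integral D t|%:E <= \int[D]_w (`|s w - t w|)%:E)%E.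
Proof.
move=> ss st; set h := _ - _.
have [->|h0] := eqVneq h 0.
  by rewrite normr0; apply: integral_ge0 => w _; rewrite lee_fin.
have hp : 0 < `|h| by rewrite normr_gt0.
have lD u v : ip (u + v) h = ip u h + ip v h := ipDl fi u v h.
have lZ a u : ip (a *: u) h = a * ip u h := ipZl fi a u h.
have is1 := simple_functional_integrable D (ip_bound h) ss.
have is2 := simple_functional_integrable D (ip_bound h) st.
have mst : measurable_fun setT (fun w => `|s w - t w|).
  by apply: (vmeasurable_normB e_dense) => //; exact: simple_vmeasurable.
rewrite -(@lee_pmul2l _ `|h|%:E) ?lte_fin// -EFinM -expr2 -fn.
rewrite {1}/h (ipDl fi) (ipNl fi) EFinB.
rewrite -(simple_integral_functional D lD lZ ss).
rewrite -(simple_integral_functional D lD lZ st).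
rewrite -integralB_EFin// -ge0_integralZl_EFin//; last exact/measurable_EFinP.
apply: le_trans (lee_abs _) _.
apply: le_trans (le_abse_integral _ _ _) _ => //.
  by apply: emeasurable_funB; apply/measurable_EFinP; exact: (simple_measurable (ip^~ h)).
apply: ge0_integral_mono => w; first exact: abse_ge0.
rewrite -EFinB -EFinM abse_EFin lee_fin -(ipNl fi) -(ipDl fi).
exact: ip_bound.
Qed.

Lemma bochnerP (g : T -> H) : bochner_integrable D g ->
  is_bochner_integral D g (bochner D g).
Proof.
move=> [sg [s sa]].
have [g' mg' gg'] := strongly_measurable_mod sg.
have as0 := bochner_approx_mod e_dense gg' mg' sa.
have ss n : simple (s n) by exact: sa.1.
have md n : measurable_fun setT (fun t => `|g' t - s n t|).
  by apply: (vmeasurable_normB e_dense) => //; exact: simple_vmeasurable.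
have [m sm] : exists m : H, simple_integral D (s n) @[n --> \oo] --> m.
  apply: cauchy_seq_cvg => r r0.
  have r20 : 0 < r / 2 by lra.
  have [N _ hN] := cvge0_lt r20 as0; exists N => a b Na Nb.
  rewrite -lte_fin; apply: le_lt_trans (simple_integral_dist (ss a) (ss b)) _.
  apply: (@le_lt_trans _ _ (\int[D]_w ((`|g' w - s a w|)%:E + (`|g' w - s b w|)%:E))%E).
    apply: ge0_integral_mono => w /=; first by rewrite lee_fin.
    rewrite -EFinD lee_fin.
    by rewrite (distrC (g' w)) -(subrKA (g' w)) ler_normD.
  rewrite ge0_integralD//; try exact/measurable_EFinP.
  have -> : r = r / 2 + r / 2 by field.
  by rewrite EFinD; apply: lteD; exact: hN.
have gm : is_bochner_integral D g m by split=> //; exists s.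
rewrite /bochner; case: xgetP => [m' _ //|h]; by have := h m gm.
Qed.

Lemma bochner_weak (g g' : T -> H) h : bochner_integrable D g ->
  {ae D, forall t, g t = g' t} -> vmeasurable g' ->
  D.-integrable setT (fun t => (ip (g' t) h)%:E) /\
  (\int[D]_t (ip (g' t) h)%:E = (ip (bochner D g) h)%:E)%E.
Proof.
move=> ig gg' mg'; apply: (is_bochner_integral_weak (l := ip^~ h) (M := `|h|) _ _ _ e_dense gg' mg').
- by move=> u v; rewrite (ipDl fi).
- by move=> a u; rewrite (ipZl fi).
- exact: ip_bound.
- exact: bochnerP.
Qed.

Lemma is_bochner_integral_affine (W : normedModType R) (f2 : W -> W -> R)
    (g : T -> H) (a : W) (L : H -> W) (K : R) m :
  inner_product f2 ->
  (forall h, exists M, forall u, `|f2 u h| <= M * `|u|) ->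
  (forall u v, L (u + v) = L u + L v) -> (forall c u, L (c *: u) = c *: L u) ->
  (forall u, `|L u| <= K * `|u|) ->
  is_bochner_integral D g m ->
  is_bochner_integral D (fun t => a + L (g t)) (a + L m).
Proof.
move=> f2i f2b LD LZ LK [sg [s [sa si]]].
have LB u v : L (u - v) = L u - L v by rewrite -scaleN1r LD LZ scaleN1r.
have Lc : continuous L by apply: (lipschitz_continuous (K := K)) => x y; rewrite -LB.
have [g' mg' gg'] := strongly_measurable_mod sg.
have as0 := bochner_approx_mod e_dense gg' mg' sa.
have ss n : simple (s n) by exact: sa.1.
have sF n : simple (fun t => a + L (s n t)).
  exact: (simple_comp (fun c => a + L c)).
have siE n : simple_integral D (fun t => a + L (s n t)) = a + L (simple_integral D (s n)).
  apply: (ip_ext f2i) => h; have [M hM] := f2b h.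
  have := simple_integral_functional D (l := f2^~ h)
    (fun u v => ipDl f2i u v h) (fun c u => ipZl f2i c u h) (sF n).
  have lD u v : f2 (L (u + v)) h = f2 (L u) h + f2 (L v) h by rewrite LD (ipDl f2i).
  have lZ c u : f2 (L (c *: u)) h = c * f2 (L u) h by rewrite LZ (ipZl f2i).
  have lM u : `|f2 (L u) h| <= `|M| * K * `|u|.
    apply: le_trans (hM _) _; rewrite -mulrA.
    apply: (@le_trans _ _ (`|M| * `|L u|)); first by rewrite ler_wpM2r// ler_norm.
    by rewrite ler_wpM2l.
  have isn := simple_functional_integrable D (l := fun c => f2 (L c) h) lM (ss n).
  under eq_integral do rewrite (ipDl f2i) EFinD.
  rewrite integralD//; last first.
    exact: finite_measure_integrable_cst.
  rewrite probability_integral_cst.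
  have /= -> := simple_integral_functional D (l := fun c => f2 (L c) h) lD lZ (ss n).
  by rewrite -EFinD (ipDl f2i) => -[].
split.
  have [s' [ss' hs']] := sg.
  exists (fun n t => a + L (s' n t)); split.
    by move=> n; exact: (simple_comp (fun c => a + L c)).
  apply: filterS hs' => t ht; apply: cvgD; first exact: cvg_cst.
  by apply: (cvg_comp (fun n => s' n t) L ht); exact: Lc.
exists (fun n t => a + L (s n t)); split.
  split=> //.
  have K0' : 0 <= `|K| by [].
  apply: (@squeeze_cvge _ _ _ _ (fun=> 0%E) _ (fun n => `|K|%:E * \int[D]_t (`|g' t - s n t|)%:E)%E).
  - apply: nearW => n; apply/andP; split.
      by apply: integral_ge0 => t _; rewrite lee_fin.
    rewrite -ge0_integralZl_EFin//; last first.
      apply/measurable_EFinP.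
      by apply: (vmeasurable_normB e_dense) => //; exact: simple_vmeasurable.
    apply: ge0_integral_ae_mono.
    + by move=> t; rewrite lee_fin.
    + by move=> t; rewrite -EFinM lee_fin mulr_ge0.
    + apply: measurable_funeM; apply/measurable_EFinP.
      by apply: (vmeasurable_normB e_dense) => //; exact: simple_vmeasurable.
    + apply: filterS gg' => t ->; rewrite -EFinM lee_fin.
      rewrite opprD addrACA subrr add0r -LB.
      by apply: le_trans (LK _) _; rewrite ler_wpM2r// ler_norm.
  - exact: cvg_cst.
  - by rewrite -[X in _ --> X](mule0 `|K|%:E); apply: cvgeZl.
under eq_fun do rewrite siE.
apply: cvgD; first exact: cvg_cst.
by apply: (cvg_comp (fun n => simple_integral D (s n)) L si); exact: Lc.
Unshelve. all: by end_near. Qed.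

End BochnerComplete.

(** * Deterministic recursions *)

Section Recursions.
Context {R : realType}.
Variables (l a r : nat -> R) (s lb M : R) (K : nat).
Hypotheses (l_bound : forall k, (k < K)%N -> 0 < l k <= lb) (lb_lt1 : lb < 1).
Hypotheses (a_ge0 : forall k, 0 <= a k) (r_ge0 : forall k, 0 <= r k) (s_ge0 : 0 <= s).
Hypothesis l_sum : \sum_(k < K) l k ^+ 2 <= M.
Hypothesis a_step : forall k, (k < K)%N ->
  a k.+1 <= (1 + 8 * l k ^+ 2) * a k + 2 * s * l k ^+ 2 - l k * (1 - l k) * r k.

Definition bound_a (a0 : R) := expR (8 * M) * (a0 + s).
Definition bound_lr (a0 : R) := (a0 + (8 * bound_a a0 + 2 * s) * M) / (1 - lb).

Let l_ge0 k : (k < K)%N -> 0 <= l k.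
Proof. by move=> /l_bound /andP[/ltW]. Qed.

Lemma partial_sum_le k : (k <= K)%N -> \sum_(j < k) l j ^+ 2 <= M.
Proof.
move=> kK; apply: le_trans l_sum; rewrite -(subnKC kK) big_split_ord /= lerDl.
by apply: sumr_ge0 => i _; exact: sqr_ge0.
Qed.

Lemma recursion_bounded k : (k <= K)%N -> a k <= bound_a (a 0%N).
Proof.
move=> kK; apply: (@le_trans _ _ (a k + s)); first by rewrite lerDl.
apply: (@le_trans _ _ (expR (8 * \sum_(j < k) l j ^+ 2) * (a 0%N + s))); last first.
  by rewrite ler_wpM2r ?addr_ge0// ler_expR ler_pM2l// partial_sum_le.
elim: k kK => [_|k IH kK]; first by rewrite big_ord0 mulr0 expR0 mul1r.
rewrite big_ord_recr /= [8 * _]mulrDr expRD.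
have := IH (ltnW kK); have := a_step kK.
set e := expR _; set e' := expR (8 * l k ^+ 2) => h1 h2.
have he : 1 + 8 * l k ^+ 2 <= e' by exact: expR_ge1Dx.
have l0 := l_ge0 kK; have /andP[_ l1] := l_bound kK.
have lk1 : 0 <= 1 - l k by rewrite subr_ge0 (le_trans l1)// ltW.
have h3 : 0 <= l k * (1 - l k) * r k by rewrite !mulr_ge0.
have s2 : 0 <= s * l k ^+ 2 by rewrite mulr_ge0// sqr_ge0.
have h4 : a k.+1 + s <= (1 + 8 * l k ^+ 2) * (a k + s) by nra.
apply: le_trans h4 _.
rewrite [e * e']mulrC -mulrA; apply: ler_pM => //.
- by rewrite addr_ge0// mulr_ge0// sqr_ge0.
- exact: addr_ge0.
Qed.

Lemma recursion_lr : \sum_(k < K) l k * r k <= bound_lr (a 0%N).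
Proof.
have lb0 : 0 < 1 - lb by rewrite subr_gt0.
set A := bound_a (a 0%N).
have A0 : 0 <= A by rewrite mulr_ge0 ?expR_ge0// addr_ge0.
rewrite /bound_lr ler_pdivlMr// -/A.
suff h k : (k <= K)%N -> a k + (\sum_(j < k) l j * r j) * (1 - lb) <=
    a 0%N + (8 * A + 2 * s) * \sum_(j < k) l j ^+ 2.
  have := h K (leqnn K); have := a_ge0 K.
  have : (8 * A + 2 * s) * \sum_(j < K) l j ^+ 2 <= (8 * A + 2 * s) * M.
    by rewrite ler_wpM2l// addr_ge0// mulr_ge0.
  by move=> h1 h2 h3; lra.
elim: k => [_|k IH kK]; first by rewrite !big_ord0 mul0r addr0 mulr0 addr0.
rewrite !big_ord_recr /=; have := IH (ltnW kK); have := a_step kK.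
have ak := recursion_bounded (ltnW kK); rewrite -/A in ak.
have l0 := l_ge0 kK; have /andP[_ l1] := l_bound kK.
set S := \sum_(_ < _) _ * _; set Q := \sum_(_ < _) _ ^+ 2 => h1 h2.
have h3 : l k * r k * (1 - lb) <= l k * (1 - l k) * r k.
  by rewrite mulrAC ler_wpM2r// ler_wpM2l// lerD2l lerN2.
have h4 : 8 * l k ^+ 2 * a k <= 8 * l k ^+ 2 * A.
  by rewrite ler_wpM2l// mulr_ge0// sqr_ge0.
by nra.
Qed.

Variables (u g : nat -> R).
Hypotheses (u_ge0 : forall k, 0 <= u k) (u0 : u 0%N = 0).
Hypothesis u_step : forall k, (k < K)%N ->
  u k.+1 <= (1 - l k) * u k + l k ^+ 2 * (8 * a k + 2 * s).
Hypothesis g_step : forall k, (k < K)%N -> g k.+1 <= g k + l k / (1 - l k) * u k.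
Hypothesis gr : forall k, g k <= 2 * r k + 8 * u k.
Hypothesis rg : forall k, r k <= 2 * g k + 8 * u k.

Let S k := \sum_(j < k) l j.
Definition bound_last (a0 : R) :=
  4 * bound_lr a0 + (24 + 2 / (1 - lb)) * (8 * bound_a a0 + 2 * s).

Lemma recursion_noise_sum :
  u K + \sum_(j < K) l j * u j <= (8 * bound_a (a 0%N) + 2 * s) * \sum_(j < K) l j ^+ 2.
Proof.
suff h k : (k <= K)%N -> u k + \sum_(j < k) l j * u j <=
    (8 * bound_a (a 0%N) + 2 * s) * \sum_(j < k) l j ^+ 2 by exact: h.
elim: k => [_|k IH kK]; first by rewrite !big_ord0 u0 mulr0 addr0.
rewrite !big_ord_recr /=; have := IH (ltnW kK).
have := u_step kK; have := recursion_bounded (ltnW kK).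
set V := bound_a _ => hV.
have := ler_wpM2l (sqr_ge0 (l k)) hV.
set S1 := \sum_(_ < _) _ * _; set S2 := \sum_(_ < _) _ ^+ 2.
by move=> h1 h2 h3; lra.
Qed.

Lemma recursion_last :
  S K * r K <= bound_last (a 0%N) * (1 + \sum_(k < K) l k ^+ 2 * (1 + S k.+1)).
Proof.
have lb0 : 0 < 1 - lb by rewrite subr_gt0.
set A := bound_a (a 0%N); set B := bound_lr (a 0%N).
pose V := 8 * A + 2 * s; pose c := (1 - lb)^-1.
have A0 : 0 <= A by rewrite mulr_ge0 ?expR_ge0// addr_ge0.
have V0 : 0 <= V by rewrite addr_ge0// mulr_ge0.
have c0 : 0 <= c by rewrite invr_ge0 ltW.
have S0 k : (k <= K)%N -> 0 <= S k.
  by move=> kK; apply: sumr_ge0 => i _; apply: l_ge0; exact: leq_trans kK.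
have SS k : S k.+1 = S k + l k by rewrite /S big_ord_recr.
have uV k : (k < K)%N -> u k.+1 <= (1 - l k) * u k + l k ^+ 2 * V.
  move=> kK; apply: le_trans (u_step kK) _; rewrite lerD2l ler_wpM2l ?sqr_ge0//.
  by rewrite lerD2r ler_pM2l// recursion_bounded// ltnW.
have gc k : (k < K)%N -> g k.+1 <= g k + c * (l k * u k).
  move=> kK; apply: le_trans (g_step kK) _; rewrite lerD2l mulrC mulrA mulrC.
  have /andP[l0 l1] := l_bound kK.
  rewrite [u k * _]mulrC ler_wpM2r ?mulr_ge0 ?(ltW l0)//.
  by rewrite lef_pV2 ?posrE ?subr_gt0//; lra.
have i2 k : (k <= K)%N -> S k * u k + \sum_(j < k) l j * u j * S j.+1 <=
    \sum_(j < k) l j * u j + V * \sum_(j < k) l j ^+ 2 * S j.+1.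
  elim: k => [_|k IH kK]; first by rewrite /S !big_ord0 mul0r mulr0.
  rewrite !big_ord_recr /= -/(S k.+1); have := IH (ltnW kK).
  have : S k.+1 * u k.+1 <= S k.+1 * ((1 - l k) * u k + l k ^+ 2 * V).
    by rewrite ler_wpM2l ?S0 ?uV.
  by move=> h1 h2; rewrite SS in h1 *; lra.
have i3 k : (k <= K)%N -> S k * g k <= \sum_(j < k) l j * g j +
    c * \sum_(j < k) l j * u j * S j.+1.
  elim: k => [_|k IH kK]; first by rewrite /S !big_ord0 mul0r mulr0 addr0.
  rewrite !big_ord_recr /= -/(S k.+1); have := IH (ltnW kK).
  have : S k.+1 * g k.+1 <= S k.+1 * (g k + c * (l k * u k)).
    by rewrite ler_wpM2l ?S0 ?gc.
  by move=> h1 h2; rewrite SS in h1 *; lra.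
have i4 : \sum_(j < K) l j * g j <= 2 * B + 8 * \sum_(j < K) l j * u j.
  apply: (@le_trans _ _ (2 * (\sum_(j < K) l j * r j) + 8 * \sum_(j < K) l j * u j)).
    rewrite !mulr_sumr -big_split /=; apply: ler_sum => j _.
    have := gr j; have := l_ge0 (ltn_ord j) => h1 h2.
    by have := ler_wpM2l h1 h2; lra.
  by rewrite lerD2r ler_pM2l// recursion_lr.
set Q := \sum_(k < K) l k ^+ 2 * (1 + S k.+1).
have QE : Q = \sum_(k < K) l k ^+ 2 + \sum_(k < K) l k ^+ 2 * S k.+1.
  by rewrite /Q -big_split /=; apply: eq_bigr => k _; rewrite mulrDr mulr1.
have := recursion_noise_sum; have := i2 K (leqnn K); have := i3 K (leqnn K).
have := u_ge0 K; have := S0 K (leqnn K).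
have w0 : 0 <= \sum_(j < K) l j * u j * S j.+1.
  by apply: sumr_ge0 => j _; rewrite !mulr_ge0 ?l_ge0 ?S0.
have q1 : 0 <= \sum_(k < K) l k ^+ 2 by apply: sumr_ge0 => j _; exact: sqr_ge0.
have q2 : 0 <= \sum_(k < K) l k ^+ 2 * S k.+1.
  by apply: sumr_ge0 => j _; rewrite mulr_ge0 ?sqr_ge0 ?S0.
have B0 : 0 <= B.
  apply: le_trans recursion_lr; apply: sumr_ge0 => j _; rewrite mulr_ge0 ?l_ge0//.
rewrite /bound_last -/A -/B -/V -/c QE.
move: w0 q1 q2 i4.
set w := \sum_(j < K) l j * u j * S j.+1; set p := \sum_(k < K) l k ^+ 2.
set q := \sum_(k < K) l k ^+ 2 * S k.+1; set x := \sum_(j < K) l j * u j.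
set y := \sum_(j < K) l j * g j => w0 q1 q2 i4 SK uK h3 h2 h1.
have Su : 0 <= S K * u K by rewrite mulr_ge0.
have h4 : S K * r K <= S K * (2 * g K + 8 * u K) by rewrite ler_wpM2l.
have Vp : 0 <= V * p by rewrite mulr_ge0.
have Vq : 0 <= V * q by rewrite mulr_ge0.
have h5 : c * w <= c * (V * p + V * q) by rewrite ler_wpM2l//; lra.
have cVp : 0 <= c * (V * p) by rewrite mulr_ge0.
have cVq : 0 <= c * (V * q) by rewrite mulr_ge0.
have Bp : 0 <= B * (p + q) by rewrite mulr_ge0// addr_ge0.
have cV : 0 <= c * V by rewrite mulr_ge0.
by lra.
Qed.

End Recursions.

Section WeightedSums.
Context {R : realType}.
Variable l : nat -> R.
Hypothesis l_gt0 : forall k, 0 < l k.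
Hypothesis l_unbounded : forall B, exists n, B < \sum_(k < n) l k.

Lemma weighted_sum_small (g : nat -> R) (B e : R) (N : nat) : 0 < e ->
  (forall k, 0 <= g k) -> (forall n, \sum_(k < n) l k * g k <= B) ->
  exists2 k, (N <= k)%N & g k < e.
Proof.
move=> e0 g0 gB; apply: contrapT => h.
have ge k : (N <= k)%N -> e <= g k.
  by move=> Nk; rewrite leNgt; apply/negP => gk; apply: h; exists k.
have key n : (N <= n)%N ->
    e * (\sum_(k < n) l k - \sum_(k < N) l k) <= \sum_(k < n) l k * g k.
  move=> /subnK <-; elim: (n - N)%N => [|m IH].
    rewrite add0n subrr mulr0; apply: sumr_ge0 => k _; rewrite mulr_ge0//.
    exact: ltW.
  rewrite addSn !big_ord_recr /=; have := ler_wpM2l (ltW (l_gt0 (m + N)%N)) (ge _ (leq_addl m N)).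
  by move=> h1; lra.
have [n hn] := l_unbounded (\sum_(k < N) l k + B / e).
have B0 : 0 <= B by have := gB 0%N; rewrite big_ord0.
have Be : 0 <= B / e by rewrite divr_ge0// ltW.
have Nn : (N <= n)%N.
  rewrite leqNgt; apply/negP => nN; move: hn; rewrite ltNge => /negP; apply.
  apply: (@le_trans _ _ (\sum_(k < N) l k)); last by rewrite lerDl.
  rewrite -(subnKC (ltnW nN)) big_split_ord /= lerDl.
  by apply: sumr_ge0 => k _; exact: ltW.
have := le_trans (key n Nn) (gB n).
rewrite leNgt => /negP; apply.
by rewrite mulrC -ltr_pdivrMr//; lra.
Qed.

Lemma almost_monotone_cvg0 (g d : nat -> R) (B B' e : R) : 0 < e ->
  (forall k, 0 <= g k) -> (forall k, 0 <= d k) ->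
  (forall k, g k.+1 <= g k + d k) -> (forall n, \sum_(k < n) d k <= B') ->
  (forall n, \sum_(k < n) l k * g k <= B) ->
  exists N, forall k, (N <= k)%N -> g k < e.
Proof.
move=> e0 g0 d0 gd dB gB; have e20 : 0 < e / 2 by lra.
pose S n := \sum_(k < n) d k.
have supS : has_sup (range S).
  by split; [exists (S 0%N), 0%N|exists B' => _ [n _ <-]; exact: dB].
have [_ [N _ <-] hN] := sup_adherent e20 supS.
have Sub n : S n <= sup (range S) by apply: ub_le_sup; [exact: supS.2|exists n].
have Smono m n : (m <= n)%N -> S m <= S n.
  move=> mn; rewrite /S -(subnKC mn) big_split_ord /= lerDl.
  by apply: sumr_ge0.
have [K NK gK] := weighted_sum_small N e20 g0 gB.
exists K => n /subnK <-.
have : g (n - K + K)%N <= g K + (S (n - K + K)%N - S K).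
  elim: (n - K)%N => [|m IH]; first by rewrite add0n subrr addr0.
  rewrite addSn; apply: le_trans (gd _) _.
  have -> : S (m + K).+1 = S (m + K)%N + d (m + K)%N by rewrite /S big_ord_recr.
  lra.
by have := Sub (n - K + K)%N; have := Smono _ _ NK; lra.
Qed.

Lemma weighted_cvg0 (g : nat -> R) (B L : R) : (forall k, 0 <= g k) ->
  (forall n, \sum_(k < n) l k * g k <= B) ->
  g k @[k --> \oo] --> L ->
  forall e, 0 < e -> exists N, forall k, (N <= k)%N -> g k < e.
Proof.
move=> g0 gB gL e e0; move/cvgrPdist_lt : gL => gL.
have L0 : L <= 0.
  apply/ler_addgt0Pr => d d0; have d20 : 0 < d / 2 by lra.
  have [N _ hN] := gL _ d20.
  have [k Nk gk] := weighted_sum_small N d20 g0 gB.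
  by have := hN k Nk; rewrite /= ltr_distlC => /andP[h1 h2]; lra.
have [N _ hN] := gL _ e0; exists N => k /hN /=.
by rewrite distrC ltr_distl => /andP[h1 h2]; lra.
Qed.

End WeightedSums.

(** * The product Hilbert space *)

Lemma cvg_prod_normed {R : realType} {V W : normedModType R} (T : Type)
    (F : set_system T) (FF : Filter F) (u : T -> V) (v : T -> W) (x : V) (y : W) :
  u @ F --> x -> v @ F --> y -> (u t, v t) @[t --> F] --> (x, y).
Proof.
move=> ux vy; apply/cvgrPdist_lt => e e0.
move/cvgrPdist_lt : ux => /(_ e e0) ux; move/cvgrPdist_lt : vy => /(_ e e0).
by apply: filterS2 ux => t h1 h2; rewrite prod_normE /= gt_max h1 h2.
Qed.

Section ProductHilbert.
Context {R : realType} {H : completeNormedModType R} {ip : H -> H -> R}.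
Hypotheses (fi : inner_product ip) (fn : forall x, ip x x = `|x| ^+ 2).
Let fi2 := inner_product_ip2 fi.

Lemma ip2_sq (v : H * H) : ip2 ip v v = `|v.1| ^+ 2 + `|v.2| ^+ 2.
Proof. by rewrite /ip2 !fn. Qed.

Lemma norm_le_ip2 (v : H * H) : `|v| ^+ 2 <= ip2 ip v v.
Proof.
rewrite ip2_sq prod_normE /Num.max; case: ifP => _; first by rewrite lerDr sqr_ge0.
by rewrite lerDl sqr_ge0.
Qed.

Lemma ip2_le_norm (v : H * H) : ip2 ip v v <= 2 * `|v| ^+ 2.
Proof.
have h1 : `|v.1| ^+ 2 <= `|v| ^+ 2 by rewrite ler_sqr ?nnegrE// prod_normE le_max lexx.
have h2 : `|v.2| ^+ 2 <= `|v| ^+ 2 by rewrite ler_sqr ?nnegrE// prod_normE le_max lexx orbT.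
rewrite ip2_sq; lra.
Qed.

Lemma ip2_bound (h : H * H) : exists M, forall u, `|ip2 ip u h| <= M * `|u|.
Proof.
exists (`|h.1| + `|h.2|) => u; rewrite /ip2 mulrDl.
apply: le_trans (ler_normD _ _) _; apply: lerD.
  apply: le_trans (ip_le_norm fi fn _ _) _.
  by rewrite mulrC ler_wpM2l// prod_normE le_max lexx.
apply: le_trans (ip_le_norm fi fn _ _) _.
by rewrite mulrC ler_wpM2l// prod_normE le_max lexx orbT.
Qed.

Lemma ip2_cvg (T : Type) (F : set_system T) (FF : Filter F) (u v : T -> H * H) x y :
  u @ F --> x -> v @ F --> y -> ip2 ip (u t) (v t) @[t --> F] --> ip2 ip x y.
Proof.
move=> ux vy; apply: cvgD; apply: (ip_cvg fi fn).
- by apply: (cvg_comp u fst ux); exact: cvg_fst.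
- by apply: (cvg_comp v fst vy); exact: cvg_fst.
- by apply: (cvg_comp u snd ux); exact: cvg_snd.
- by apply: (cvg_comp v snd vy); exact: cvg_snd.
Qed.

Lemma nonexpansive_continuous (T : H * H -> H * H) :
  (forall x y, ip2 ip (T x - T y) (T x - T y) <= ip2 ip (x - y) (x - y)) ->
  continuous T.
Proof.
move=> neT x; apply/cvgrPdist_le => r r0; near=> y.
have h : `|T x - T y| ^+ 2 <= (2 * `|x - y|) ^+ 2.
  apply: le_trans (norm_le_ip2 _) _; apply: le_trans (neT _ _) _.
  apply: le_trans (ip2_le_norm _) _; rewrite exprMn.
  by rewrite ler_wpM2r ?sqr_ge0// expr2; lra.
rewrite ler_sqr ?nnegrE ?mulr_ge0// in h; apply: le_trans h _.
rewrite -ler_pdivlMl// mulrC; near: y.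
have : (fun y => y) @ x --> x by exact: cvg_id.
by move/cvgrPdist_le; apply; rewrite divr_gt0.
Unshelve. all: by end_near. Qed.

Lemma ip2_complete (u : nat -> H * H) :
  (forall e, 0 < e -> exists N, forall m n, (N <= m)%N -> (N <= n)%N ->
     ip2 ip (u m - u n) (u m - u n) < e) ->
  exists l, forall e, 0 < e -> exists N, forall n, (N <= n)%N ->
     ip2 ip (u n - l) (u n - l) < e.
Proof.
move=> hu.
have hc e : 0 < e -> exists N, forall m n, (N <= m)%N -> (N <= n)%N ->
    `|u m - u n| < e.
  move=> e0; have [N hN] := hu _ (exprn_gt0 2 e0); exists N => m n Nm Nn.
  rewrite -(ltr_pXn2r (n := 2)) ?nnegrE ?(ltW e0)//.
  exact: le_lt_trans (norm_le_ip2 _) (hN m n Nm Nn).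
have [l1 h1] : exists l : H, (u n).1 @[n --> \oo] --> l.
  apply: cauchy_seq_cvg => e /hc[N hN]; exists N => m n Nm Nn.
  by apply: le_lt_trans (hN m n Nm Nn); rewrite prod_normE le_max lexx.
have [l2 h2] : exists l : H, (u n).2 @[n --> \oo] --> l.
  apply: cauchy_seq_cvg => e /hc[N hN]; exists N => m n Nm Nn.
  by apply: le_lt_trans (hN m n Nm Nn); rewrite prod_normE le_max lexx orbT.
exists (l1, l2) => e e0.
have : ip2 ip (u n - (l1, l2)) (u n - (l1, l2)) @[n --> \oo] --> ip2 ip 0 0.
  have c1 : (u n).1 - l1 @[n --> \oo] --> (0 : H).
    by rewrite -(subrr l1); apply: cvgB => //; exact: cvg_cst.
  have c2 : (u n).2 - l2 @[n --> \oo] --> (0 : H).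
    by rewrite -(subrr l2); apply: cvgB => //; exact: cvg_cst.
  by apply: cvgD; apply: (ip_cvg fi fn).
rewrite (ip0l fi2) => /cvgrPdist_lt /(_ e e0)[N _ hN]; exists N => n /hN /=.
by rewrite sub0r normrN; apply: le_lt_trans; exact: ler_norm.
Qed.

Lemma norm2E (v : H * H) : norm2 v = Num.sqrt (ip2 ip v v).
Proof. by rewrite ip2_sq. Qed.

Lemma cocoercive_lipschitz tau (C : H -> H) : 0 < tau -> cocoercive ip tau C ->
  forall x y, `|C x - C y| <= tau^-1 * `|x - y|.
Proof.
move=> tau0 cC x y; have := cC x y => h.
have h2 := le_trans h (le_trans (ler_norm _) (ip_le_norm fi fn _ _)).
have [->|c0] := eqVneq `|C x - C y| 0; first by rewrite mulr_ge0// invr_ge0 ltW.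
have cp : 0 < `|C x - C y| by rewrite lt_neqAle eq_sym c0 normr_ge0.
by rewrite ler_pdivlMl// -(ler_pM2l cp) mulrCA -expr2.
Qed.

End ProductHilbert.

(** * The noise of the splitting operator *)

Section Modification.
Context {R : realType} {H : completeNormedModType R} {ip : H -> H -> R}.
Hypotheses (fi : inner_product ip) (fn : forall x, ip x x = `|x| ^+ 2).
Variable e : nat -> H.
Hypothesis e_dense : dense_seq e.
Context {dXi : measure_display} {Xi : measurableType dXi} (D : probability Xi R).
Variables (tau : R) (C : H -> H) (Cs : Xi -> H -> H).
Hypotheses (tau_gt0 : 0 < tau) (cocoC : cocoercive ip tau C).
Hypothesis cocoCs : {ae D, forall xi, cocoercive ip tau (Cs xi)}.
Hypothesis intCs : forall x, bochner_integrable D (fun xi => Cs xi x).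

(* On the exceptional null set, [Cs] is replaced by its mean. *)
Lemma cocoercive_modification : exists (Cm : Xi -> H -> H) (N : set Xi),
  [/\ measurable N, D N = 0%E, forall xi, cocoercive ip tau (Cm xi),
      forall x, vmeasurable (Cm ^~ x) & forall xi, ~ N xi -> Cm xi = Cs xi].
Proof.
have /choice[s hs] : forall i, exists s : nat -> Xi -> H, (forall n, simple (s n)) /\
    {ae D, forall t, s n t @[n --> \oo] --> Cs t (e i)}.
  by move=> i; have [[s]] := intCs (e i); exists s.
have ss i n : simple (s i n) by case: (hs i).
have aes : {ae D, forall t, forall i, s i n t @[n --> \oo] --> Cs t (e i)}.
  by apply: ae_foralln => i; case: (hs i).
have [N [mN N0 hN]] : {ae D, forall t, cocoercive ip tau (Cs t) /\
    forall i, s i n t @[n --> \oo] --> Cs t (e i)}.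
  by move: cocoCs aes; apply: filterS2.
have {}hN t : ~ N t -> cocoercive ip tau (Cs t) /\
    forall i, s i n t @[n --> \oo] --> Cs t (e i).
  by move=> Nt; apply: contrapT => h; apply: Nt; exact: hN.
pose Cm t := if t \in N then C else Cs t.
have cocoCm t : cocoercive ip tau (Cm t).
  by rewrite /Cm; case: ifPn => //; rewrite notin_setE => /hN[].
exists Cm, N; split=> // [x|t Nt]; last by rewrite /Cm memNset.
have me i : vmeasurable (Cm ^~ (e i)).
  apply: (@vmeasurable_cvg _ _ _ _ (fun n t => if t \in N then C (e i) else s i n t)).
    by move=> n; apply: simple_vmeasurable; exact: simple_if.
  move=> t; rewrite /Cm; case: ifPn; first by move=> _; exact: cvg_cst.
  by rewrite notin_setE => /hN[_]; exact.
have /choice[j hj] : forall n : nat, exists i, `|x - e i| < n.+1%:R^-1.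
  by move=> n; apply: e_dense; rewrite invr_gt0.
apply: (@vmeasurable_cvg _ _ _ _ (fun n t => Cm t (e (j n)))) => // t.
have ej : e (j n) @[n --> \oo] --> x.
  apply/cvgrPdist_lt => r r0.
  have [M _ hM] := near_infty_natSinv_lt (PosNum r0); exists M => // n Mn /=.
  exact: lt_trans (hj n) (hM n Mn).
apply: (cvg_comp (fun n => e (j n)) (Cm t) ej).
exact: (lipschitz_continuous (cocoercive_lipschitz fi fn tau_gt0 (cocoCm t))).
Qed.

End Modification.

Section Noise.
Context {R : realType} {H : completeNormedModType R} {ip : H -> H -> R}.
Hypotheses (fi : inner_product ip) (fn : forall x, ip x x = `|x| ^+ 2).
Variable e : nat -> H.
Hypothesis e_dense : dense_seq e.
Context {dXi : measure_display} {Xi : measurableType dXi} (D : probability Xi R).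
Variables (A B : H -> set H) (rho tau : R) (C : H -> H).
Hypotheses (maxA : maximally_monotone ip A) (maxB : maximally_monotone ip B).
Hypotheses (tau_gt0 : 0 < tau) (rho_gt0 : 0 < rho) (rho_le : rho <= 2 * tau).
Hypothesis cocoC : cocoercive ip tau C.

Let fi2 := inner_product_ip2 fi.
Local Notation sq v := (ip2 ip v v).
Local Notation T := (splitting_op rho A B C).

Let neT x y : sq (T x - T y) <= sq (x - y).
Proof. exact: (splitting_op_nonexpansive fi fn maxA maxB rho_gt0 x y rho_le cocoC). Qed.

Lemma noise_mapD u v : noise_map rho (u + v) = noise_map rho u + noise_map rho v :> H * H.
Proof. by apply: (ip_ext fi2) => -[h1 h2]; rewrite /noise_map /ip2 /= !(ipE fi); ring. Qed.

Lemma noise_mapZ a u : noise_map rho (a *: u) = a *: noise_map rho u :> H * H.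
Proof. by apply: (ip_ext fi2) => -[h1 h2]; rewrite /noise_map /ip2 /= !(ipE fi); ring. Qed.

Lemma noise_mapB u v : noise_map rho (u - v) = noise_map rho u - noise_map rho v :> H * H.
Proof. by rewrite -scaleN1r noise_mapD noise_mapZ scaleN1r. Qed.

Lemma noise_map_sq (w : H) : sq (noise_map rho w) <= `|w| ^+ 2.
Proof.
have d0 : 0 < 1 + rho ^+ 2 by rewrite ltr_wpDr ?sqr_ge0.
rewrite (ip2_noise_map fi) fn ler_piMl ?sqr_ge0// ler_pdivrMr// mul1r.
by rewrite lerDr.
Qed.

Lemma noise_map_norm (w : H) : `|noise_map rho w : H * H| <= 1 * `|w|.
Proof.
rewrite mul1r -ler_sqr ?nnegrE//.
exact: le_trans (norm_le_ip2 fn _) (noise_map_sq w).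
Qed.

Lemma noise_map_continuous : continuous (noise_map rho : H -> H * H).
Proof.
apply: (lipschitz_continuous (K := 1)) => x y.
by rewrite -noise_mapB noise_map_norm.
Qed.

Lemma splitting_op_diff c c' x : splitting_op rho A B c x - splitting_op rho A B c' x =
  noise_map rho (c (resolvent (op_scale rho A) x.1) - c' (resolvent (op_scale rho A) x.1)).
Proof.
rewrite (splitting_op_affine fi fn maxA maxB rho_gt0 c).
rewrite (splitting_op_affine fi fn maxA maxB rho_gt0 c').
by rewrite opprD addrACA subrr add0r noise_mapB.
Qed.

Variable Cs : Xi -> H -> H.
Hypothesis intCs : forall x, bochner_integrable D (fun xi => Cs xi x).
Hypothesis meanC : forall x, C x = bochner D (fun xi => Cs xi x).

Lemma mean_splitting_opE x : mean_splitting_op rho A B D Cs x = T x.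
Proof.
have [e2 he2] := dense_seq_pair e_dense e_dense.
rewrite /mean_splitting_op; apply: (bochner_eq fi2 (ip2_bound fi fn) he2).
set y := resolvent (op_scale rho A) x.1.
rewrite (splitting_op_affine fi fn maxA maxB rho_gt0 C) -/y.
rewrite (_ : (fun xi => _) = (fun xi => splitting_op rho A B (fun=> 0) x +
    noise_map rho (Cs xi y))); last first.
  by apply/funext => xi; rewrite (splitting_op_affine fi fn maxA maxB rho_gt0).
apply: (is_bochner_integral_affine e_dense _ fi2 (ip2_bound fi fn) noise_mapD noise_mapZ noise_map_norm).
by rewrite meanC; exact: (bochnerP fi fn e_dense).
Qed.

Variables (Cm : Xi -> H -> H) (N : set Xi).
Hypotheses (mN : measurable N) (DN : D N = 0%E).
Hypothesis cocoCm : forall xi, cocoercive ip tau (Cm xi).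
Hypothesis mCm : forall x, vmeasurable (Cm ^~ x).
Hypothesis CmCs : forall xi, ~ N xi -> Cm xi = Cs xi.

Local Notation Tx xi := (splitting_op rho A B (Cm xi)).

Lemma CsCm_ae x : {ae D, forall xi, Cs xi x = Cm xi x}.
Proof.
by exists N; split=> // xi h; apply: contrapT => Nxi; apply: h => /=; rewrite (CmCs Nxi).
Qed.

Lemma Cm_weak x h : D.-integrable setT (fun xi => (ip (Cm xi x - C x) h)%:E) /\
  (\int[D]_xi (ip (Cm xi x - C x) h)%:E = 0)%E.
Proof.
have [i1 i2] := bochner_weak fi fn e_dense h (intCs x) (CsCm_ae x) (mCm x).
have ic : D.-integrable setT (EFin \o cst (ip (C x) h)).
  exact: finite_measure_integrable_cst.
have E : (fun xi => (ip (Cm xi x - C x) h)%:E) =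
    (fun xi => ((ip (Cm xi x) h)%:E - (EFin \o cst (ip (C x) h)) xi)%E).
  by apply/funext => xi; rewrite (ipDl fi) (ipNl fi) EFinB.
rewrite E; split; first exact: integrableB.
rewrite integralB//= i2 probability_integral_cst -meanC.
by rewrite subee.
Qed.

Lemma Tx_vmeasurable x : vmeasurable (fun xi => Tx xi x).
Proof.
set y := resolvent (op_scale rho A) x.1.
rewrite (_ : (fun xi => _) =
  (fun c => splitting_op rho A B (fun=> 0) x + noise_map rho c) \o (Cm ^~ y)); last first.
  by apply/funext => xi; rewrite (splitting_op_affine fi fn maxA maxB rho_gt0).
apply: (vmeasurable_comp e_dense (mCm y)) => c.
apply: cvgD; [exact: cvg_cst|exact: noise_map_continuous].
Qed.

Lemma measurable_noise (F : H * H -> R) x : continuous F ->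
  measurable_fun setT (fun xi => F (Tx xi x)).
Proof.
move=> cF; have [e2 he2] := dense_seq_pair e_dense e_dense.
exact: (measurable_comp_continuous he2 (Tx_vmeasurable x) cF).
Qed.

Let sqB_continuous (p : H * H) : continuous (fun v : H * H => sq (v - p)).
Proof.
by move=> v; apply: (ip2_cvg fi fn); apply: cvgB; [exact: cvg_id|exact: cvg_cst| exact: cvg_id|exact: cvg_cst].
Qed.

Lemma measurable_noise_sq x p : measurable_fun setT (fun xi => sq (Tx xi x - p)).
Proof. exact: (measurable_noise (F := fun v => sq (v - p)) x (@sqB_continuous p)). Qed.

Lemma noise_weak x b : D.-integrable setT (fun xi => (ip2 ip b (Tx xi x - T x))%:E) /\
  (\int[D]_xi (ip2 ip b (Tx xi x - T x))%:E = 0)%E.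
Proof.
pose h := - (rho / (1 + rho ^+ 2)) *: (b.1 + rho *: b.2).
rewrite (_ : (fun xi => _) = (fun xi =>
   (ip (Cm xi (resolvent (op_scale rho A) x.1) - C (resolvent (op_scale rho A) x.1)) h)%:E)).
  exact: Cm_weak.
apply/funext => xi; rewrite splitting_op_diff; set w := _ - _; congr EFin.
clearbody w; rewrite /noise_map /ip2 /= !(ipE fi) (ipC fi w) (ipC fi w); ring.
Qed.

Lemma noise_sq_le xi x p : sq (Tx xi x - T x) <=
  2 * sq (Tx xi p - T p) + 8 * sq (x - p).
Proof.
have h1 := splitting_op_nonexpansive fi fn maxA maxB rho_gt0 x p rho_le (cocoCm xi).
have h2 := neT x p.
have -> : Tx xi x - T x = (Tx xi p - T p) + ((Tx xi x - Tx xi p) - (T x - T p)).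
  by apply: (ip_ext fi2) => h; rewrite !(ipE fi2); ring.
apply: le_trans (ip_sqD fi2 _ _) _; rewrite lerD2l.
have := ip_sqB fi2 (Tx xi x - Tx xi p) (T x - T p).
by move=> h3; lra.
Qed.

Lemma noise_second_moment x0 s0 : (\int[D]_xi (sq (Tx xi x0 - T x0))%:E <= s0%:E)%E ->
  forall p, exists2 s, 0 <= s & (\int[D]_xi (sq (Tx xi p - T p))%:E <= s%:E)%E.
Proof.
move=> h p; have s00 : 0 <= s0.
  by rewrite -lee_fin; apply: le_trans h; apply: integral_ge0 => xi _; rewrite lee_fin ip_ge0.
exists (2 * s0 + 8 * sq (p - x0)); first by rewrite addr_ge0// mulr_ge0// ip_ge0.
have m0 : measurable_fun setT (fun xi => (sq (Tx xi x0 - T x0))%:E).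
  by apply/measurable_EFinP; exact: measurable_noise_sq.
apply: (@le_trans _ _ (\int[D]_xi (2%:E * (sq (Tx xi x0 - T x0))%:E + (8 * sq (p - x0))%:E))%E).
  apply: ge0_integral_mono => xi; first by rewrite lee_fin ip_ge0.
  by rewrite -EFinM -EFinD lee_fin noise_sq_le.
rewrite ge0_integralD//.
- rewrite probability_integral_cst ge0_integralZl_EFin//.
    by rewrite [in leRHS]EFinD; apply: leeD2r; rewrite [in leRHS]EFinM lee_wpmul2l.
  by move=> xi _; rewrite lee_fin ip_ge0.
- by move=> xi _; rewrite -EFinM lee_fin mulr_ge0// ip_ge0.
- exact: measurable_funeM.
- by move=> xi _; rewrite lee_fin mulr_ge0// ip_ge0.
Qed.

(* The cross term integrates to 0 because the noise has mean 0. *)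
Lemma noise_step p s x b l : 0 <= s ->
  (\int[D]_xi (sq (Tx xi p - T p))%:E <= s%:E)%E ->
  (\int[D]_xi (sq (b + l *: (Tx xi x - T x)))%:E <=
    (sq b + l ^+ 2 * (8 * sq (x - p) + 2 * s))%:E)%E.
Proof.
move=> s0 hs.
have m0 : measurable_fun setT (fun xi => sq (Tx xi p - T p)) by exact: measurable_noise_sq.
have i0 : D.-integrable setT (fun xi => (sq (Tx xi p - T p))%:E).
  apply/integrableP; split; first exact/measurable_EFinP.
  under eq_integral do rewrite gee0_abs ?lee_fin ?(ip_ge0 fi2)//.
  by apply: le_lt_trans hs _; exact: ltry.
have [i1 i2] := noise_weak x b.
pose c0 := sq b + l ^+ 2 * 8 * sq (x - p).
have ic : D.-integrable setT (EFin \o cst c0) by exact: finite_measure_integrable_cst.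
have i1' := integrableZl measurableT (2 * l) i1.
have i0' := integrableZl measurableT (2 * l ^+ 2) i0.
apply: (@le_trans _ _ (\int[D]_xi ((EFin \o cst c0) xi +
   ((2 * l)%:E * (ip2 ip b (Tx xi x - T x))%:E +
    (2 * l ^+ 2)%:E * (sq (Tx xi p - T p))%:E)))%E).
  apply: ge0_integral_mono => xi; first by rewrite lee_fin ip_ge0.
  rewrite /= -!EFinM -!EFinD lee_fin.
  have := ler_wpM2l (sqr_ge0 l) (noise_sq_le xi x p).
  rewrite /c0; set w := Tx xi x - T x; set w0 := Tx xi p - T p; set d := sq (x - p).
  clearbody w w0 d.
  by rewrite !(ipE fi2) (ipC fi2 w b) => h; lra.
rewrite integralD//; last exact: integrableD.
rewrite integralD// !integralZl// i2 mule0 add0e probability_integral_cst.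
apply: (@le_trans _ _ (c0%:E + (2 * l ^+ 2)%:E * s%:E)%E).
  by apply: leeD2l; rewrite lee_wpmul2l// lee_fin mulr_ge0// sqr_ge0.
by rewrite -EFinM -EFinD lee_fin /c0; lra.
Qed.

End Noise.

(** * The noisy process *)

Section Process.
Context {R : realType} {H : completeNormedModType R} {ip : H -> H -> R}.
Hypotheses (fi : inner_product ip) (fn : forall x, ip x x = `|x| ^+ 2).
Variable e : nat -> H.
Hypothesis e_dense : dense_seq e.
Context {dXi : measure_display} {Xi : measurableType dXi} {D : probability Xi R}.
Context {dOmega : measure_display} {Omega : measurableType dOmega}
  {P : probability Omega R}.
Variable xi : nat -> {mfun Omega >-> Xi}.
Hypothesis xi_iid : iid P D xi.

Let fi2 := inner_product_ip2 fi.
Local Notation sq v := (ip2 ip v v).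

Variables (T : H * H -> H * H) (Tx : Xi -> H * H -> H * H).
Hypothesis neT : forall x y, sq (T x - T y) <= sq (x - y).
Hypothesis neTx : forall z x y, sq (Tx z x - Tx z y) <= sq (x - y).
Hypothesis mTx : forall x, vmeasurable (Tx ^~ x).

Variables (l : nat -> R) (lb : R) (x0 : H * H).
Hypotheses (l_bound : forall k, 0 < l k <= lb) (lb_lt1 : lb < 1).

(* The second component is the averaged noise ubar; the difference z = x - ubar
   then follows the noiseless scheme z' = z + l (T (z + ubar) - z). *)
Definition noisy_step (k : nat) (v : (H * H) * (H * H)) (z : Xi) : (H * H) * (H * H) :=
  (v.1 + l k *: (Tx z v.1 - v.1),
   (1 - l k) *: v.2 + l k *: (Tx z v.1 - T v.1)).

Definition state (k : nat) (w : Omega) := chain xi noisy_step (x0, 0) k w.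

Let l_gt0 k : 0 < l k. Proof. by case/andP: (l_bound k). Qed.
Let l_lt1 k : l k < 1. Proof. by case/andP: (l_bound k) => _ /le_lt_trans; apply. Qed.

Let cT : continuous T. Proof. exact: nonexpansive_continuous. Qed.
Let cTx z : continuous (Tx z). Proof. exact: nonexpansive_continuous. Qed.

Let dense4 : exists e4 : nat -> (H * H) * (H * H), dense_seq e4.
Proof. by have [e2 he2] := dense_seq_pair e_dense e_dense; exact: (dense_seq_pair he2 he2). Qed.

Lemma noisy_step_continuous k z : continuous (noisy_step k ^~ z).
Proof.
move=> v; have c1 : (fun v : (H * H) * (H * H) => v.1) @ v --> v.1 by exact: cvg_fst.
have c2 : (fun v : (H * H) * (H * H) => v.2) @ v --> v.2 by exact: cvg_snd.
have cx : Tx z x.1 @[x --> v] --> Tx z v.1 by apply: (cvg_comp fst (Tx z) c1); exact: cTx.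
have ct : T x.1 @[x --> v] --> T v.1 by apply: (cvg_comp fst T c1); exact: cT.
apply: cvg_prod_normed.
  by apply: cvgD => //; apply: cvgZ; [exact: cvg_cst|exact: cvgB].
by apply: cvgD; apply: cvgZ; try exact: cvg_cst; [|exact: cvgB].
Qed.

Lemma noisy_step_measurable k v : vmeasurable (noisy_step k v).
Proof.
have [e2 he2] := dense_seq_pair e_dense e_dense.
apply: vmeasurable_pair.
  apply: (vmeasurable_comp (F := fun y => v.1 + l k *: (y - v.1)) he2 (mTx v.1)).
  move=> y; apply: cvgD; first exact: cvg_cst.
  by apply: cvgZ; [exact: cvg_cst|apply: cvgB; [exact: cvg_id|exact: cvg_cst]].
apply: (vmeasurable_comp (F := fun y => (1 - l k) *: v.2 + l k *: (y - T v.1)) he2 (mTx v.1)).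
move=> y; apply: cvgD; first exact: cvg_cst.
by apply: cvgZ; [exact: cvg_cst|apply: cvgB; [exact: cvg_id|exact: cvg_cst]].
Qed.

Lemma state_measurable k (phi : (H * H) * (H * H) -> R) : continuous phi ->
  measurable_fun setT (fun w => phi (state k w)).
Proof.
have [e4 he4] := dense4.
move=> cphi.
have h := chain_measurable_comp xi (x0, 0) he4 noisy_step_measurable noisy_step_continuous k cphi.
exact: h.
Qed.

Lemma state_markov k (phi psi : (H * H) * (H * H) -> R) (E : set Omega) :
  continuous phi -> (forall v, 0 <= phi v) ->
  continuous psi -> (forall v, 0 <= psi v) ->
  (forall v, \int[D]_z (phi (noisy_step k v z))%:E <= (psi v)%:E)%E ->
  <<s history xi k >> E ->
  (\int[P]_(w in E) (phi (state k.+1 w))%:E <= \int[P]_(w in E) (psi (state k w))%:E)%E.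
Proof.
have [e4 he4] := dense4.
exact: (markov_step xi_iid (x0, 0) he4 noisy_step_measurable noisy_step_continuous).
Qed.

Variables (p : H * H) (s : R).
Hypotheses (Tp : T p = p) (s_ge0 : 0 <= s).
Hypothesis noiseE : forall x b c,
  (\int[D]_z (sq (b + c *: (Tx z x - T x)))%:E <=
    (sq b + c ^+ 2 * (8 * sq (x - p) + 2 * s))%:E)%E.

Definition dist_sq (v : (H * H) * (H * H)) : R := sq (v.1 - p).
Definition noise_sq (v : (H * H) * (H * H)) : R := sq v.2.
Definition res_sq (v : (H * H) * (H * H)) : R := sq (T v.1 - v.1).
Definition avg_res_sq (v : (H * H) * (H * H)) : R :=
  sq (T (v.1 - v.2) - (v.1 - v.2)).

Let sq0 (v : H * H) : 0 <= sq v. Proof. exact: ip_ge0. Qed.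

Lemma comp_sq_continuous (F : (H * H) * (H * H) -> H * H) : continuous F ->
  continuous (fun v => sq (F v)).
Proof. by move=> cF v; apply: (ip2_cvg fi fn); exact: cF. Qed.

Let c1 : continuous (fun v : (H * H) * (H * H) => v.1).
Proof. by move=> v; exact: cvg_fst. Qed.
Let c2 : continuous (fun v : (H * H) * (H * H) => v.2).
Proof. by move=> v; exact: cvg_snd. Qed.

Lemma dist_sq_continuous : continuous dist_sq.
Proof.
by apply: comp_sq_continuous => v; apply: cvgB; [exact: c1|exact: cvg_cst].
Qed.

Lemma noise_sq_continuous : continuous noise_sq.
Proof. exact: comp_sq_continuous. Qed.

Lemma res_sq_continuous : continuous res_sq.
Proof.
apply: comp_sq_continuous => v; apply: cvgB; last exact: c1.
by apply: (cvg_comp fst T (@c1 v)); exact: cT.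
Qed.

Lemma avg_res_sq_continuous : continuous avg_res_sq.
Proof.
have cz : continuous (fun v : (H * H) * (H * H) => v.1 - v.2).
  by move=> v; apply: cvgB; [exact: c1|exact: c2].
apply: comp_sq_continuous => v; apply: cvgB; last exact: cz.
by apply: (cvg_comp (fun v : (H * H) * (H * H) => v.1 - v.2) T (@cz v)); exact: cT.
Qed.

Lemma dist_step k v : (\int[D]_z (dist_sq (noisy_step k v z))%:E <=
  ((1 + 8 * l k ^+ 2) * dist_sq v + 2 * s * l k ^+ 2
   - l k * (1 - l k) * res_sq v)%:E)%E.
Proof.
have := noiseE v.1 (v.1 + l k *: (T v.1 - v.1) - p) (l k).
rewrite (_ : (fun z => _) = (fun z => (dist_sq (noisy_step k v z))%:E)); last first.
  apply/funext => z; rewrite /dist_sq /noisy_step /=; congr (EFin (ip2 _ _ _));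
  by apply: (ip_ext fi2) => h; rewrite !(ipE fi2); ring.
move=> /le_trans; apply; rewrite lee_fin.
have := km_descent fi2 neT v.1 (ltW (l_gt0 k)) Tp.
rewrite /dist_sq /res_sq => h; nra.
Qed.

Lemma noise_step_sq k v : (\int[D]_z (noise_sq (noisy_step k v z))%:E <=
  ((1 - l k) ^+ 2 * noise_sq v + l k ^+ 2 * (8 * dist_sq v + 2 * s))%:E)%E.
Proof.
apply: le_trans (noiseE v.1 ((1 - l k) *: v.2) (l k)) _.
by rewrite lee_fin /noise_sq !(ipZl fi2) !(ipZr fi2) mulrA -expr2.
Qed.

Lemma avg_res_step k v z : avg_res_sq (noisy_step k v z) <=
  avg_res_sq v + l k / (1 - l k) * noise_sq v.
Proof.
apply: (km_residual fi2 neT); first by rewrite l_gt0 l_lt1.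
rewrite /= subrK; apply: (ip_ext fi2) => h; rewrite !(ipE fi2); ring.
Qed.

Lemma avg_res_le v : avg_res_sq v <= 2 * res_sq v + 8 * noise_sq v.
Proof.
have := residual_perturb fi2 neT (v.1 - v.2) (- v.2).
by rewrite opprK subrK !(ipNl fi2) !(ipNr fi2) opprK.
Qed.

Lemma res_le_avg v : res_sq v <= 2 * avg_res_sq v + 8 * noise_sq v.
Proof. exact: residual_perturb. Qed.

Lemma res_le_dist v : res_sq v <= 4 * dist_sq v.
Proof.
have h := neT v.1 p; rewrite Tp in h.
have := ip_sqB fi2 (T v.1 - p) (v.1 - p).
have -> : T v.1 - p - (v.1 - p) = T v.1 - v.1 by rewrite opprB addrA subrK.
by rewrite /res_sq /dist_sq => h2; lra.
Qed.

Definition gauge (v : (H * H) * (H * H)) : R := 1 + (dist_sq v + noise_sq v).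

Let gauge0 v : 0 <= gauge v.
Proof. by apply: addr_ge0 => //; apply: addr_ge0; exact: sq0. Qed.

Lemma gauge_continuous : continuous gauge.
Proof.
move=> v; apply: cvgD; first exact: cvg_cst.
by apply: cvgD; [exact: dist_sq_continuous|exact: noise_sq_continuous].
Qed.

Lemma sum_step k v : (\int[D]_z (dist_sq (noisy_step k v z) +
   noise_sq (noisy_step k v z))%:E <=
  ((1 + 16 * l k ^+ 2) * (dist_sq v + noise_sq v) + 4 * s * l k ^+ 2)%:E)%E.
Proof.
have [e4 he4] := dense4.
have md : measurable_fun setT (fun z => (dist_sq (noisy_step k v z))%:E).
  apply/measurable_EFinP.
  exact: (measurable_comp_continuous he4 (noisy_step_measurable k v) dist_sq_continuous).
have mn : measurable_fun setT (fun z => (noise_sq (noisy_step k v z))%:E).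
  apply/measurable_EFinP.
  exact: (measurable_comp_continuous he4 (noisy_step_measurable k v) noise_sq_continuous).
under eq_integral do rewrite EFinD.
rewrite ge0_integralD//; try by move=> z _; rewrite lee_fin; exact: sq0.
apply: le_trans (leeD (dist_step k v) (noise_step_sq k v)) _.
rewrite -EFinD lee_fin.
have h1 : 0 <= l k * (1 - l k) * res_sq v.
  by rewrite !mulr_ge0 ?sq0// ?subr_ge0 ltW.
have h2 : (1 - l k) ^+ 2 * noise_sq v <= 1 * noise_sq v.
  rewrite ler_wpM2r ?sq0// expr_le1// ?subr_ge0 ?gerBl ?(ltW (l_gt0 k))//.
  exact: ltW (l_lt1 k).
have h3 : 0 <= l k ^+ 2 * noise_sq v by rewrite mulr_ge0 ?sq0 ?sqr_ge0.
by lra.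
Qed.

Lemma gauge_step k v : (\int[D]_z (gauge (noisy_step k v z))%:E <=
  ((17 + 4 * s) * gauge v)%:E)%E.
Proof.
have [e4 he4] := dense4.
have ms : measurable_fun setT (fun z => (dist_sq (noisy_step k v z) +
   noise_sq (noisy_step k v z))%:E).
  apply/measurable_EFinP.
  apply: (measurable_comp_continuous (F := fun v => dist_sq v + noise_sq v) he4 (noisy_step_measurable k v)).
  by move=> u; apply: cvgD; [exact: dist_sq_continuous|exact: noise_sq_continuous].
rewrite /gauge; under eq_integral do rewrite EFinD.
rewrite ge0_integralD//; last by move=> z _; rewrite lee_fin; apply: addr_ge0; exact: sq0.
rewrite probability_integral_cst.
apply: le_trans (leeD2l _ (sum_step k v)) _; rewrite -EFinD lee_fin.
have l1 : l k ^+ 2 <= 1 by rewrite expr_le1// ltW.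
have q0 : 0 <= dist_sq v + noise_sq v by apply: addr_ge0; exact: sq0.
have h1 : l k ^+ 2 * (dist_sq v + noise_sq v) <= 1 * (dist_sq v + noise_sq v).
  by rewrite ler_wpM2r.
have h2 : s * l k ^+ 2 <= s * 1 by rewrite ler_wpM2l.
have h3 : 0 <= s * (dist_sq v + noise_sq v) by rewrite mulr_ge0.
by lra.
Qed.

Lemma gauge_integrable k : P.-integrable setT (fun w => (gauge (state k w))%:E).
Proof.
apply/integrableP; split.
  by apply/measurable_EFinP; exact: (state_measurable k gauge_continuous).
under eq_integral do rewrite gee0_abs ?lee_fin ?gauge0//.
elim: k => [|k IH].
  by rewrite /state /= probability_integral_cst ltry.
have T0 : <<s history xi k >> setT by have := @measurableT _ (Om xi k).
have c0 : 0 <= 17 + 4 * s by rewrite addr_ge0// mulr_ge0.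
apply: (le_lt_trans (state_markov (psi := fun v => (17 + 4 * s) * gauge v) _ _ _ _ _ T0)).
- exact: gauge_continuous.
- exact: gauge0.
- by move=> v; apply: cvgM; [exact: cvg_cst|exact: gauge_continuous].
- by move=> v; rewrite mulr_ge0.
- exact: gauge_step.
under eq_integral do rewrite EFinM.
rewrite ge0_integralZl_EFin//.
- exact: lte_mul_pinfty.
- by move=> w _; rewrite lee_fin gauge0.
- by apply/measurable_EFinP; exact: (state_measurable k gauge_continuous).
Qed.

Definition dominated (phi : (H * H) * (H * H) -> R) : Prop :=
  continuous phi /\ exists c, forall v, `|phi v| <= c * gauge v.

Lemma dominated_integrable k phi : dominated phi ->
  P.-integrable setT (fun w => (phi (state k w))%:E).
Proof.
move=> [cphi [c hc]].
have ic := integrableZl measurableT c (gauge_integrable k).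
apply: (le_integrable measurableT _ _ ic).
  by apply/measurable_EFinP; exact: state_measurable.
move=> w _ /=; rewrite lee_fin; apply: le_trans (hc _) _; exact: ler_norm.
Qed.

Lemma dominatedD phi psi : dominated phi -> dominated psi ->
  dominated (fun v => phi v + psi v).
Proof.
move=> [c1' [a ha]] [c2' [b hb]]; split.
  by move=> v; apply: cvgD; [exact: c1'|exact: c2'].
exists (a + b) => v; rewrite mulrDl.
by apply: le_trans (ler_normD _ _) _; exact: lerD.
Qed.

Lemma dominatedZ c phi : dominated phi -> dominated (fun v => c * phi v).
Proof.
move=> [c1' [a ha]]; split.
  by move=> v; apply: cvgM; [exact: cvg_cst|exact: c1'].
by exists (`|c| * a) => v; rewrite normrM -mulrA ler_wpM2l.
Qed.

Lemma dominated_cst c : dominated (fun=> c).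
Proof.
split; first by move=> v; exact: cvg_cst.
exists `|c| => v; rewrite -[leLHS]mulr1 ler_wpM2l// /gauge lerDl addr_ge0//; exact: sq0.
Qed.

Lemma dominated_ge0 (phi : (H * H) * (H * H) -> R) c : continuous phi -> (forall v, 0 <= phi v) ->
  (forall v, phi v <= c * (dist_sq v + noise_sq v)) -> 0 <= c -> dominated phi.
Proof.
move=> cphi phi0 hc c0; split=> //; exists c => v; rewrite ger0_norm//.
by apply: le_trans (hc v) _; rewrite ler_wpM2l// /gauge lerDr.
Qed.

Lemma dominated_dist : dominated dist_sq.
Proof.
apply: (dominated_ge0 (c := 1)) => //; first exact: dist_sq_continuous.
  by move=> v; exact: sq0.
by move=> v; rewrite mul1r lerDl sq0.
Qed.

Lemma dominated_noise : dominated noise_sq.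
Proof.
apply: (dominated_ge0 (c := 1)) => //; first exact: noise_sq_continuous.
  by move=> v; exact: sq0.
by move=> v; rewrite mul1r lerDr sq0.
Qed.

Lemma dominated_res : dominated res_sq.
Proof.
apply: (dominated_ge0 (c := 4)) => //; first exact: res_sq_continuous.
  by move=> v; exact: sq0.
move=> v; have := res_le_dist v; have := sq0 v.2; rewrite -/(noise_sq v); lra.
Qed.

Lemma dominated_avg_res : dominated avg_res_sq.
Proof.
apply: (dominated_ge0 (c := 8)) => //; first exact: avg_res_sq_continuous.
  by move=> v; exact: sq0.
move=> v; have := res_le_dist v; have := avg_res_le v; lra.
Qed.

Definition mean (k : nat) (phi : (H * H) * (H * H) -> R) : R :=
  fine (\int[P]_w (phi (state k w))%:E)%E.

Lemma meanE k phi : dominated phi -> (\int[P]_w (phi (state k w))%:E = (mean k phi)%:E)%E.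
Proof.
move=> dphi; rewrite fineK//; apply: integrable_fin_num => //.
exact: dominated_integrable.
Qed.

Lemma meanD k phi psi : dominated phi -> dominated psi ->
  mean k (fun v => phi v + psi v) = mean k phi + mean k psi.
Proof.
move=> h1 h2; apply: EFin_inj; rewrite -meanE ?EFinD; last exact: dominatedD.
under eq_integral do rewrite EFinD.
by rewrite integralD// ?meanE//; exact: dominated_integrable.
Qed.

Lemma meanZ k c phi : dominated phi -> mean k (fun v => c * phi v) = c * mean k phi.
Proof.
move=> h; apply: EFin_inj; rewrite -meanE ?EFinM; last exact: dominatedZ.
under eq_integral do rewrite EFinM.
by rewrite integralZl// ?meanE//; exact: dominated_integrable.
Qed.

Lemma mean_cst k c : mean k (fun=> c) = c.
Proof. by rewrite /mean probability_integral_cst. Qed.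

Lemma mean_ge0 k phi : (forall v, 0 <= phi v) -> 0 <= mean k phi.
Proof. by move=> h; apply/fine_ge0/integral_ge0 => w _; rewrite lee_fin. Qed.

Lemma le_mean k phi psi : dominated phi -> dominated psi ->
  (forall v, phi v <= psi v) -> mean k phi <= mean k psi.
Proof.
move=> h1 h2 h; rewrite -lee_fin -!meanE//.
apply: le_integral => //; try exact: dominated_integrable.
by move=> w _; rewrite lee_fin.
Qed.

Lemma mean_step k phi psi : dominated phi -> (forall v, 0 <= phi v) ->
  dominated psi ->
  (forall v, \int[D]_z (phi (noisy_step k v z))%:E <= (psi v)%:E)%E ->
  mean k.+1 phi <= mean k psi.
Proof.
move=> dphi phi0 dpsi h; rewrite -lee_fin -!meanE//.
have T0 : <<s history xi k >> setT by have := @measurableT _ (Om xi k).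
apply: state_markov => //; [exact: dphi.1|exact: dpsi.1|].
move=> v; rewrite -lee_fin; apply: le_trans (h v).
by apply: integral_ge0 => z _; rewrite lee_fin.
Qed.

Local Notation a := (mean^~ dist_sq).
Local Notation r := (mean^~ res_sq).
Local Notation u := (mean^~ noise_sq).
Local Notation g := (mean^~ avg_res_sq).

Lemma mean_dist_step k : a k.+1 <=
  (1 + 8 * l k ^+ 2) * a k + 2 * s * l k ^+ 2 - l k * (1 - l k) * r k.
Proof.
apply: (@le_trans _ _ (mean k (fun v => (1 + 8 * l k ^+ 2) * dist_sq v +
   (2 * s * l k ^+ 2 + - (l k * (1 - l k)) * res_sq v)))).
  apply: mean_step; first exact: dominated_dist.
  - by move=> v; exact: sq0.
  - apply: dominatedD; first exact/dominatedZ/dominated_dist.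
    by apply: dominatedD; [exact: dominated_cst|exact/dominatedZ/dominated_res].
  - by move=> v; apply: le_trans (dist_step k v) _; rewrite lee_fin; lra.
have dd := dominatedZ (1 + 8 * l k ^+ 2) dominated_dist.
have dr := dominatedZ (- (l k * (1 - l k))) dominated_res.
have dc := dominated_cst (2 * s * l k ^+ 2).
rewrite meanD//; last exact: dominatedD.
rewrite meanD// mean_cst meanZ; last exact: dominated_dist.
rewrite meanZ; last exact: dominated_res.
lra.
Qed.

Lemma mean_noise_step k : u k.+1 <= (1 - l k) * u k + l k ^+ 2 * (8 * a k + 2 * s).
Proof.
have dn := dominatedZ (1 - l k) dominated_noise.
have dd := dominatedZ (8 * l k ^+ 2) dominated_dist.
have dc := dominated_cst (2 * s * l k ^+ 2).
apply: (@le_trans _ _ (mean k (fun v => (1 - l k) * noise_sq v +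
   (8 * l k ^+ 2 * dist_sq v + 2 * s * l k ^+ 2)))).
  apply: mean_step; first exact: dominated_noise.
  - by move=> v; exact: sq0.
  - by do 2 apply: dominatedD => //.
  - move=> v; apply: le_trans (noise_step_sq k v) _; rewrite lee_fin.
    have : (1 - l k) ^+ 2 * noise_sq v <= (1 - l k) * noise_sq v.
      rewrite ler_wpM2r ?sq0// expr2 ler_piMl ?subr_ge0 ?gerBl ?(ltW (l_gt0 k))//.
      exact: ltW (l_lt1 k).
    lra.
rewrite meanD//; last exact: dominatedD.
rewrite meanD// mean_cst !meanZ;
  first [exact: dominated_dist|exact: dominated_noise|lra].
Qed.

Lemma mean_avg_res_step k : g k.+1 <= g k + l k / (1 - l k) * u k.
Proof.
have dn := dominatedZ (l k / (1 - l k)) dominated_noise.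
apply: (@le_trans _ _ (mean k (fun v => avg_res_sq v + l k / (1 - l k) * noise_sq v))).
  apply: mean_step; first exact: dominated_avg_res.
  - by move=> v; exact: sq0.
  - by apply: dominatedD => //; exact: dominated_avg_res.
  - move=> v; rewrite -[leRHS](probability_integral_cst D).
    by apply: ge0_integral_mono => z; rewrite lee_fin ?sq0// avg_res_step.
rewrite meanD//; last exact: dominated_avg_res.
by rewrite meanZ//; exact: dominated_noise.
Qed.

Lemma mean_avg_res_le k : g k <= 2 * r k + 8 * u k.
Proof.
have dr := dominatedZ 2 dominated_res; have dn := dominatedZ 8 dominated_noise.
apply: (@le_trans _ _ (mean k (fun v => 2 * res_sq v + 8 * noise_sq v))).
  apply: le_mean; [exact: dominated_avg_res|exact: dominatedD|exact: avg_res_le].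
by rewrite meanD// !meanZ//; first [exact: dominated_noise|exact: dominated_res].
Qed.

Lemma mean_res_le k : r k <= 2 * g k + 8 * u k.
Proof.
have dg := dominatedZ 2 dominated_avg_res; have dn := dominatedZ 8 dominated_noise.
apply: (@le_trans _ _ (mean k (fun v => 2 * avg_res_sq v + 8 * noise_sq v))).
  apply: le_mean; [exact: dominated_res|exact: dominatedD|exact: res_le_avg].
by rewrite meanD// !meanZ//; first [exact: dominated_noise|exact: dominated_avg_res].
Qed.

Lemma mean_dist0 : a 0%N = sq (x0 - p).
Proof. by rewrite /mean /state /= probability_integral_cst. Qed.

Lemma mean_noise0 : u 0%N = 0.
Proof. by rewrite /mean /state /= probability_integral_cst /noise_sq /= (ip0l fi2). Qed.

Let a_ge0 k : 0 <= a k. Proof. by apply: mean_ge0 => v; exact: sq0. Qed.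
Let r_ge0 k : 0 <= r k. Proof. by apply: mean_ge0 => v; exact: sq0. Qed.
Let u_ge0 k : 0 <= u k. Proof. by apply: mean_ge0 => v; exact: sq0. Qed.

Lemma mean_res_sum K M : \sum_(k < K) l k ^+ 2 <= M ->
  \sum_(k < K) l k * r k <= bound_lr s lb M (sq (x0 - p)).
Proof.
move=> lM; rewrite -mean_dist0.
apply: (recursion_lr (r := r) (fun k _ => l_bound k) lb_lt1 a_ge0 r_ge0 s_ge0 lM).
by move=> k _; exact: mean_dist_step.
Qed.

Lemma mean_res_last K M : \sum_(k < K) l k ^+ 2 <= M ->
  (\sum_(j < K) l j) * r K <= bound_last s lb M (sq (x0 - p)) *
    (1 + \sum_(k < K) l k ^+ 2 * (1 + \sum_(j < k.+1) l j)).
Proof.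
move=> lM; rewrite -mean_dist0.
exact: (recursion_last (fun k _ => l_bound k) lb_lt1 a_ge0 r_ge0 s_ge0 lM
  (fun k _ => mean_dist_step k) u_ge0 mean_noise0 (fun k _ => mean_noise_step k)
  (fun k _ => mean_avg_res_step k) mean_avg_res_le mean_res_le).
Qed.

Lemma sqrt_le_young (th t : R) : 0 < th -> 0 <= t ->
  Num.sqrt t <= th / 2 + (2 * th)^-1 * t.
Proof.
move=> th0 t0; have := sqr_sqrtr t0; set y := Num.sqrt t => <-.
have h : 0 <= (2 * th)^-1 * (y - th) ^+ 2 by rewrite mulr_ge0 ?sqr_ge0// invr_ge0 mulr_ge0// ltW.
have e1 : (2 * th)^-1 * (y - th) ^+ 2 = (2 * th)^-1 * y ^+ 2 - y + th / 2.
  by field; rewrite gt_eqF.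
by rewrite e1 in h; lra.
Qed.

Lemma integral_residual_le k th (f : Omega -> R) : 0 < th -> (forall w, 0 <= f w) ->
  {ae P, forall w, f w = Num.sqrt (res_sq (state k w))} ->
  (\int[P]_w (f w)%:E <= (th / 2 + (2 * th)^-1 * r k)%:E)%E.
Proof.
move=> th0 f0 hf.
have th20 : 0 <= (2 * th)^-1 by rewrite invr_ge0 mulr_ge0// ltW.
have dr := dominatedZ (2 * th)^-1 dominated_res.
have dd := dominatedD (dominated_cst (th / 2)) dr.
rewrite -meanZ; last exact: dominated_res.
rewrite -{1}(mean_cst k (th / 2)) -meanD//; last exact: dominated_cst.
rewrite -meanE//; apply: ge0_integral_ae_mono.
- by move=> w; rewrite lee_fin.
- by move=> w; rewrite lee_fin addr_ge0 ?mulr_ge0 ?sq0 ?divr_ge0 ?(ltW th0).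
- by apply/measurable_EFinP; exact: (state_measurable k dd.1).
- by apply: filterS hf => w ->; rewrite lee_fin sqrt_le_young// sq0.
Qed.

Lemma integral_random_index K (Nr : {mfun Omega >-> nat}) j :
  random_index P xi l K Nr -> (j < K)%N ->
  (\int[P]_w (\1_(Nr @^-1` [set j]) w * res_sq (state j w))%:E =
   (index_weight l j / (\sum_(i < K) index_weight l i) * r j)%:E)%E.
Proof.
move=> [NK PN indN] jK.
have [e4 he4] := dense4.
pose phi (z : Om xi j * nat) : \bar R :=
  (\1_([set j] : set nat) z.2 * res_sq (state j z.1))%:E.
have mphi : measurable_fun setT phi.
  apply/measurable_EFinP; apply: measurable_funM.
    exact: (@measurableT_comp _ _ _ _ _ _ (\1_([set j] : set nat) : nat -> R)).
  apply: (@measurableT_comp _ _ _ _ _ _ (res_sq \o state j : Om xi j -> R)) => //.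
  apply: (measurable_comp_continuous he4 _ res_sq_continuous).
  exact: (chain_vmeasurable (x0, 0) he4 noisy_step_measurable noisy_step_continuous (leqnn j)).
have phi0 z : (0 <= phi z)%E by rewrite lee_fin mulr_ge0 ?sq0.
have hist : history xi j `<=` \bigcup_k preimage_set_system setT (xi k) measurable.
  by apply: bigcup_subset.
have ind E F : <<s history xi j >> E -> measurable F ->
    P (E `&` Nr @^-1` F) = (P E * distribution P Nr F)%E.
  move=> hE _; rewrite setIC indN; last exact: sub_sigma_algebra2 hE.
  by rewrite muleC.
have := ge0_integral_indep (Z := Nr) (Q := distribution P Nr)
  (@history_measurable _ _ _ _ xi j) ind mphi phi0.
have -> : (\int[P]_w phi (w, Nr w) =
  \int[P]_w (\1_(Nr @^-1` [set j]) w * res_sq (state j w))%:E)%E.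
  by apply: eq_integral => w _; rewrite /phi /= !indicE.
move=> ->.
have dE : distribution P Nr [set j] = (index_weight l j / (\sum_(i < K) index_weight l i))%:E.
  exact: PN.
transitivity (\int[P]_w ((index_weight l j / (\sum_(i < K) index_weight l i))%:E *
   (res_sq (state j w))%:E))%E.
  apply: eq_integral => w _; rewrite -dE.
  transitivity (\int[distribution P Nr]_n ((res_sq (state j w))%:E *
     (\1_([set j] : set nat) n)%:E))%E.
    by apply: eq_integral => n _; rewrite /phi /= mulrC EFinM.
  rewrite ge0_integralZl_EFin.
  - by rewrite integral_indic// setIT muleC.
  - exact: measurableT.
  - by move=> n _; rewrite lee_fin.
  - exact/measurable_EFinP.
  - exact: sq0.
under eq_integral do rewrite -EFinM.
set c := index_weight l j / _.
rewrite (meanE j (phi := fun v => c * res_sq v)); last exact/dominatedZ/dominated_res.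
by rewrite meanZ//; exact: dominated_res.
Qed.

Lemma integral_residual_random K th (f : Omega -> R) (Nr : {mfun Omega >-> nat}) :
  0 < th -> (forall w, 0 <= f w) -> random_index P xi l K Nr ->
  {ae P, forall w, f w = Num.sqrt (res_sq (state (Nr w) w))} ->
  (\int[P]_w (f w)%:E <= (th / 2 + (2 * th)^-1 *
    \sum_(j < K) index_weight l j / (\sum_(i < K) index_weight l i) * r j)%:E)%E.
Proof.
move=> th0 f0 hN hf; have [NK _ _] := hN.
have th20 : 0 <= (2 * th)^-1 by rewrite invr_ge0 mulr_ge0// ltW.
pose h j w : R := \1_(Nr @^-1` [set j]) w * res_sq (state j w).
have h0 j w : 0 <= h j w by rewrite mulr_ge0 ?sq0.
have mh j : measurable_fun setT (h j).
  apply: measurable_funM; last exact: (state_measurable j res_sq_continuous).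
  apply: measurable_indic; rewrite -[X in measurable X]setTI.
  exact: (measurable_funP Nr measurableT).
have msum : measurable_fun setT (fun w => \sum_(j < K) h j w).
  exact: measurable_sum.
have s0 w : 0 <= \sum_(j < K) h j w by apply: sumr_ge0.
apply: (@le_trans _ _ (\int[P]_w ((th / 2)%:E + (2 * th)^-1%:E * (\sum_(j < K) h j w)%:E))%E).
  apply: ge0_integral_ae_mono.
  - by move=> w; rewrite lee_fin.
  - by move=> w; rewrite -EFinM -EFinD lee_fin addr_ge0 ?divr_ge0 ?mulr_ge0 ?(ltW th0).
  - apply: emeasurable_funD; first exact: measurable_cst.
    by apply: measurable_funeM; exact/measurable_EFinP.
  - apply: filterS hf => w ->; rewrite -EFinM -EFinD lee_fin.
    have -> : \sum_(j < K) h j w = res_sq (state (Nr w) w).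
      rewrite (bigD1 (Ordinal (NK w)))//= big1 ?addr0 => [|j jN].
        by rewrite /h indicE mem_set// mul1r.
      rewrite /h indicE memNset ?mul0r//= => jE.
      by move/eqP: jN; apply; apply/val_inj => /=; rewrite jE.
    by rewrite sqrt_le_young// sq0.
rewrite ge0_integralD//; last 3 first.
- by move=> w _; rewrite lee_fin divr_ge0// ltW.
- by move=> w _; rewrite -EFinM lee_fin mulr_ge0.
- by apply: measurable_funeM; exact/measurable_EFinP.
rewrite probability_integral_cst ge0_integralZl_EFin//; last 2 first.
- by move=> w _; rewrite lee_fin.
- exact/measurable_EFinP.
under eq_integral do rewrite -sumEFin.
rewrite ge0_integral_sum//; last 2 first.
- by move=> j; exact/measurable_EFinP.
- by move=> j w _; rewrite lee_fin.
rewrite (eq_bigr (fun j : 'I_K => (index_weight l j / (\sum_(i < K) index_weight l i) * r j)%:E)).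
  by rewrite sumEFin -EFinM -EFinD.
by move=> j _; exact: integral_random_index.
Qed.

Lemma Lambda_bounds k M : \sum_(j < k) l j ^+ 2 <= M ->
  expR (- (2 * M)) <= Lambda l k <= 1.
Proof.
move=> lM; apply/andP; split; last first.
  apply: prodr_ile1 => j _.
  have d1 : 1 <= 1 + 2 * l j ^+ 2 by rewrite lerDl mulr_ge0 ?sqr_ge0.
  by rewrite invr_ge0 (le_trans ler01 d1)/= invf_le1// (lt_le_trans ltr01).
apply: (@le_trans _ _ (expR (- (2 * \sum_(j < k) l j ^+ 2)))).
  by rewrite ler_expR lerN2 ler_pM2l.
rewrite /Lambda; elim: k {lM} => [|k IH].
  by rewrite !big_ord0 mulr0 oppr0 expR0.
rewrite !big_ord_recr /= [2 * _]mulrDr opprD expRD.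
apply: ler_pM IH _; rewrite ?expR_ge0// expRN.
have d0 : 0 < 1 + 2 * l k ^+ 2 by apply: ltr_wpDr => //; rewrite mulr_ge0 ?sqr_ge0.
by rewrite lef_pV2 ?posrE ?expR_gt0// expR_ge1Dx.
Qed.

Lemma lottery_le K M : (0 < K)%N -> \sum_(k < K) l k ^+ 2 <= M ->
  \sum_(j < K) index_weight l j / (\sum_(i < K) index_weight l i) * r j <=
  bound_lr s lb M (sq (x0 - p)) / (expR (- (2 * M)) * (1 - lb) * \sum_(j < K) l j).
Proof.
move=> K0 lM; have lb0 : 0 < 1 - lb by rewrite subr_gt0.
have S0 : 0 < \sum_(j < K) l j.
  case: K K0 {lM} => // K _; rewrite big_ord_recr /= ltr_wpDl//.
  by apply: sumr_ge0 => j _; exact: ltW.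
have LM (j : 'I_K) : expR (- (2 * M)) <= Lambda l j.+1 <= 1.
  by apply: Lambda_bounds; exact: (partial_sum_le lM (ltn_ord j)).
have w1 (j : 'I_K) : index_weight l j <= l j.
  have /andP[L0 L1] := LM j.
  have L0' : 0 <= Lambda l j.+1 by apply: le_trans L0; rewrite expR_ge0.
  rewrite /index_weight mulrAC ler_piMl// ?(ltW (l_gt0 j))//.
  rewrite mulr_ile1// ?subr_ge0 ?gerBl ?(ltW (l_gt0 j))//.
  exact: ltW (l_lt1 j).
have w2 (j : 'I_K) : expR (- (2 * M)) * (1 - lb) * l j <= index_weight l j.
  have /andP[L0 L1] := LM j.
  rewrite /index_weight -[leRHS]mulrA [l j * _]mulrC -[leLHS]mulrA.
  apply: ler_pM => //.
    by rewrite mulr_ge0// ltW.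
  rewrite ler_wpM2r ?(ltW (l_gt0 j))// lerD2l lerN2.
  by case/andP: (l_bound j).
set W := \sum_(i < K) index_weight l i.
have cW : expR (- (2 * M)) * (1 - lb) * \sum_(j < K) l j <= W.
  by rewrite mulr_sumr; apply: ler_sum => j _; exact: w2.
have c0 : 0 < expR (- (2 * M)) * (1 - lb) * \sum_(j < K) l j.
  by rewrite !mulr_gt0 ?expR_gt0.
have W0 : 0 < W by apply: lt_le_trans cW.
have -> : \sum_(j < K) index_weight l j / W * r j = (\sum_(j < K) index_weight l j * r j) / W.
  by rewrite mulr_suml; apply: eq_bigr => j _; rewrite mulrAC.
apply: ler_pM.
- by apply: sumr_ge0 => j _; rewrite mulr_ge0// (le_trans _ (w2 j))// !mulr_ge0 ?expR_ge0 ?ltW.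
- by rewrite invr_ge0 ltW.
- apply: le_trans (mean_res_sum lM); apply: ler_sum => j _.
  by rewrite ler_wpM2r.
- by rewrite lef_pV2.
Qed.

Variable M : R.
Hypothesis l_summable : forall n, \sum_(k < n) l k ^+ 2 <= M.

Lemma ae_cvg_functional (phi : (H * H) * (H * H) -> R) : continuous phi ->
  (forall v, 0 <= phi v) ->
  (forall k v, \int[D]_z (phi (noisy_step k v z))%:E <=
     ((1 + 16 * l k ^+ 2) * phi v + 4 * s * l k ^+ 2)%:E)%E ->
  {ae P, forall w, exists L : R, phi (state k w) @[k --> \oo] --> L}.
Proof.
move=> cphi phi0 hphi.
have [e4 he4] := dense4.
pose S n := \sum_(k < n) l k ^+ 2.
pose c n := expR (- (16 * S n)).
have c_gt0 n : 0 < c n by exact: expR_gt0.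
have S0 n : 0 <= S n by apply: sumr_ge0 => k _; exact: sqr_ge0.
have c_le1 n : c n <= 1 by rewrite -expR0 ler_expR oppr_le0 mulr_ge0.
have cS n : c n.+1 * (1 + 16 * l n ^+ 2) <= c n.
  rewrite /c /S big_ord_recr /= [16 * (_ + _)]mulrDr opprD expRD -mulrA ler_piMr ?expR_ge0//.
  rewrite expRN mulrC ler_pdivrMr ?expR_gt0// mul1r; exact: expR_ge1Dx.
have cc n : continuous (fun v => c n * phi v).
  by move=> v; apply: cvgM; [exact: cvg_cst|exact: cphi].
pose Y k w := c k * phi (state k w).
have Y0 k w : 0 <= Y k w by rewrite mulr_ge0// ltW.
have mY k : measurable_fun setT (Y k : g_sigma_algebraType (history xi k) -> R).
  apply: (measurable_comp_continuous (F := fun v => c k * phi v) he4 _ (@cc k)).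
  exact: (chain_vmeasurable (x0, 0) he4 noisy_step_measurable noisy_step_continuous (leqnn k)).
pose eps k := 4 * s * l k ^+ 2.
have eps0 k : 0 <= eps k.
  by apply: mulr_ge0; [rewrite mulr_ge0|exact: sqr_ge0].
have epsS n : \sum_(i < n) eps i <= 4 * s * M.
  by rewrite -mulr_sumr ler_wpM2l ?mulr_ge0.
have Ystep k E : <<s history xi k >> E ->
    (\int[P]_(w in E) (Y k.+1 w)%:E <= \int[P]_(w in E) (Y k w)%:E + (eps k)%:E)%E.
  move=> hE; have mE := history_measurable hE.
  apply: (@le_trans _ _ (\int[P]_(w in E) ((Y k w)%:E + (eps k)%:E))%E).
    apply: (@le_trans _ _ (\int[P]_(w in E) (c k * phi (state k w) + eps k)%:E)%E); last first.
      by under [leRHS]eq_integral do rewrite -EFinD.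
    apply: (state_markov (phi := fun v => c k.+1 * phi v) (psi := fun v => c k * phi v + eps k)) => //.
    - by move=> v; rewrite mulr_ge0// ltW.
    - by move=> v; apply: cvgD; [exact: cc|exact: cvg_cst].
    - by move=> v; rewrite addr_ge0// mulr_ge0// ltW.
    move=> v; under eq_integral do rewrite EFinM.
    rewrite ge0_integralZl_EFin ?(ltW (c_gt0 _))//; last 2 first.
    - by move=> z _; rewrite lee_fin.
    - apply/measurable_EFinP.
      exact: (measurable_comp_continuous he4 (noisy_step_measurable k v) cphi).
    apply: (@le_trans _ _ ((c k.+1)%:E * ((1 + 16 * l k ^+ 2) * phi v + eps k)%:E)%E).
      by rewrite lee_wpmul2l ?lee_fin ?(ltW (c_gt0 _)).
    rewrite -EFinM lee_fin mulrDr; apply: lerD.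
      by rewrite mulrA ler_wpM2r.
    by rewrite ler_piMl.
  rewrite ge0_integralD//; last 3 first.
  - by move=> w _; rewrite lee_fin.
  - apply: measurable_funTS; apply/measurable_EFinP.
    exact: (state_measurable k (@cc k)).
  - by move=> w _; rewrite lee_fin.
  apply: leeD2l; rewrite integral_cst// -[leRHS]mule1.
  by rewrite lee_wpmul2l ?lee_fin// probability_le1.
have hi : (\int[P]_w (Y 0 w)%:E <= (c 0%N * phi (x0, 0))%:E)%E.
  by rewrite /Y /state /= probability_integral_cst.
have h : {ae P, forall w, exists L : R, Y k w @[k --> \oo] --> L}.
  exact: (ae_cvg_supermartingale (P := P) (@history_measurable _ _ _ _ xi)
    (fun k => history_mono (leqnSn k)) Y0 mY epsS Ystep hi).
apply: filterS h => w [L hL].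
have [B cB] : exists B : R, S n @[n --> \oo] --> B.
  suff : cvgn S by move=> /cvg_ex.
  apply: nondecreasing_is_cvgn.
    move=> m n mn; rewrite /S -(subnKC mn) big_split_ord /= lerDl.
    by apply: sumr_ge0 => i _; exact: sqr_ge0.
  by exists M => _ [n _ <-]; exact: l_summable.
exists (expR (16 * B) * L).
have -> : (fun k => phi (state k w)) = (fun k => expR (16 * S k) * Y k w).
  by apply/funext => k; rewrite /Y mulrA -expRD subrr expR0 mul1r.
apply: cvgM => //.
apply: (cvg_comp (fun k => 16 * S k) (@expR R)); last exact: continuous_expR.
by apply: cvgM; [exact: cvg_cst|exact: cB].
Qed.

Lemma ae_cvg_dist : {ae P, forall w, exists L : R, dist_sq (state k w) @[k --> \oo] --> L}.
Proof.
apply: ae_cvg_functional; first exact: dist_sq_continuous.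
  by move=> v; exact: sq0.
move=> k v; apply: le_trans (dist_step k v) _; rewrite lee_fin.
have h1 : 0 <= l k * (1 - l k) * res_sq v.
  by rewrite !mulr_ge0 ?sq0// ?subr_ge0 ltW.
have h2 : 0 <= l k ^+ 2 * dist_sq v by rewrite mulr_ge0 ?sq0 ?sqr_ge0.
have h3 : 0 <= s * l k ^+ 2 by rewrite mulr_ge0 ?sqr_ge0.
lra.
Qed.

Lemma ae_cvg_noise : {ae P, forall w, exists L : R, noise_sq (state k w) @[k --> \oo] --> L}.
Proof.
have h : {ae P, forall w, exists L : R,
    dist_sq (state k w) + noise_sq (state k w) @[k --> \oo] --> L}.
  apply: (@ae_cvg_functional (fun v => dist_sq v + noise_sq v)).
  - by move=> v; apply: cvgD; [exact: dist_sq_continuous|exact: noise_sq_continuous].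
  - by move=> v; apply: addr_ge0; exact: sq0.
  - exact: sum_step.
move: h ae_cvg_dist; apply: filterS2 => w [L1 h1] [L2 h2]; exists (L1 - L2 : R).
rewrite (_ : (fun k => _) = (fun k => (dist_sq (state k w) + noise_sq (state k w)) -
  dist_sq (state k w))).
  exact: cvgB.
by apply/funext => k; rewrite addrAC subrr add0r.
Qed.

Lemma ae_weighted_sum_bounded (phi : (H * H) * (H * H) -> R) B :
  dominated phi -> (forall v, 0 <= phi v) ->
  (forall n, \sum_(k < n) l k * mean k phi <= B) ->
  {ae P, forall w, exists C, forall n, \sum_(k < n) l k * phi (state k w) <= C}.
Proof.
move=> dphi phi0 hB.
have lphi0 k w : 0 <= l k * phi (state k w) by rewrite mulr_ge0// ltW.
have mphi k : measurable_fun setT (fun w => l k * phi (state k w)).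
  by apply: measurable_funM => //; exact: (state_measurable k dphi.1).
apply: (@ae_bounded_nondecreasing _ _ _ P (fun n w => \sum_(k < n) l k * phi (state k w)) B).
- by move=> n w; apply: sumr_ge0 => i _; exact: lphi0.
- by move=> n; exact: measurable_sum.
- move=> w m n mn; rewrite -(subnKC mn) big_split_ord /= lerDl.
  by apply: sumr_ge0 => i _; exact: lphi0.
move=> n; under eq_integral do rewrite -sumEFin.
rewrite ge0_integral_sum//; last 2 first.
- by move=> k; exact/measurable_EFinP.
- by move=> k w _; rewrite lee_fin.
rewrite (eq_bigr (fun k : 'I_n => (l k * mean k phi)%:E)); first by rewrite sumEFin lee_fin; exact: hB.
by move=> k _; rewrite (meanE k (phi := fun v => l k * phi v)) ?meanZ//; exact: dominatedZ.
Qed.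

Hypothesis l_unbounded : forall B, exists n, B < \sum_(k < n) l k.

Lemma ae_residual_cvg0 : {ae P, forall w, forall eps, 0 < eps ->
  exists N, forall k, (N <= k)%N -> res_sq (state k w) < eps}.
Proof.
have hr : {ae P, forall w, exists C, forall n, \sum_(k < n) l k * res_sq (state k w) <= C}.
  apply: (ae_weighted_sum_bounded (B := bound_lr s lb M (sq (x0 - p)))).
  - exact: dominated_res.
  - by move=> v; exact: sq0.
  - by move=> n; exact: mean_res_sum.
have hu : {ae P, forall w, exists C, forall n, \sum_(k < n) l k * noise_sq (state k w) <= C}.
  apply: (ae_weighted_sum_bounded (B := (8 * bound_a s M (a 0%N) + 2 * s) * M)).
  - exact: dominated_noise.
  - by move=> v; exact: sq0.
  move=> n; apply: (@le_trans _ _ (u n + \sum_(k < n) l k * u k)); first by rewrite lerDr.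
  have := recursion_noise_sum (fun k _ => l_bound k) lb_lt1 a_ge0 r_ge0 s_ge0 (l_summable n)
    (fun k _ => mean_dist_step k) mean_noise0 (fun k _ => mean_noise_step k).
  move/le_trans; apply; rewrite ler_wpM2l//.
  apply: addr_ge0; last by rewrite mulr_ge0.
  apply: mulr_ge0 => //; apply: mulr_ge0; [exact: expR_ge0|exact: addr_ge0].
move: hr hu ae_cvg_noise; apply: filterS3 => w [Cr hr] [Cu hu] [L hL] eps eps0.
have u0 k : 0 <= noise_sq (state k w) by exact: sq0.
have g0 k : 0 <= avg_res_sq (state k w) by exact: sq0.
have lb1 : 0 < 1 - lb by rewrite subr_gt0.
pose d k := (1 - lb)^-1 * (l k * noise_sq (state k w)).
have d0 k : 0 <= d k by rewrite !mulr_ge0 ?invr_ge0 ?(ltW lb1) ?(ltW (l_gt0 k)).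
have gd k : avg_res_sq (state k.+1 w) <= avg_res_sq (state k w) + d k.
  apply: le_trans (avg_res_step k (state k w) (xi k w)) _.
  rewrite lerD2l /d mulrA [_^-1 * _]mulrC ler_wpM2r// ler_wpM2l ?(ltW (l_gt0 k))//.
  rewrite lef_pV2 ?posrE ?subr_gt0// lerD2l lerN2.
  by case/andP: (l_bound k).
have dB n : \sum_(k < n) d k <= (1 - lb)^-1 * Cu.
  by rewrite -mulr_sumr ler_wpM2l// invr_ge0 ltW.
have gB n : \sum_(k < n) l k * avg_res_sq (state k w) <= 2 * Cr + 8 * Cu.
  apply: (@le_trans _ _ (2 * (\sum_(k < n) l k * res_sq (state k w)) +
      8 * \sum_(k < n) l k * noise_sq (state k w))).
    rewrite !mulr_sumr -big_split /=; apply: ler_sum => k _.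
    by have := ler_wpM2l (ltW (l_gt0 k)) (avg_res_le (state k w)); lra.
  by apply: lerD; rewrite ler_pM2l.
have e4 : 0 < eps / 4 by rewrite divr_gt0.
have e16 : 0 < eps / 16 by rewrite divr_gt0.
have [N1 hN1] := almost_monotone_cvg0 l_gt0 l_unbounded e4 g0 d0 gd dB gB.
have [N2 hN2] := weighted_cvg0 l_gt0 l_unbounded u0 hu hL e16.
exists (maxn N1 N2) => k; rewrite geq_max => /andP[/hN1 h1 /hN2 h2].
by have := res_le_avg (state k w); lra.
Qed.

End Process.

(** * Step size schedules *)

Section Schedules.
Context {R : realType}.

Lemma powR_root (x : R) n : 0 < x -> (0 < n)%N -> (x `^ n%:R^-1) ^+ n = x.
Proof.
move=> x0 n0; rewrite -powR_mulrn ?powR_ge0// -powRrM mulVf ?powRr1 ?ltW//.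
by rewrite pnatr_eq0 -lt0n.
Qed.

Lemma powR_frac (x : R) (m n : nat) : 0 < x ->
  x `^ (- (m%:R / n%:R)) = ((x `^ n%:R^-1) ^+ m)^-1.
Proof.
move=> x0; rewrite powRN [m%:R / _]mulrC powRrM powR_mulrn//.
exact: powR_ge0.
Qed.

Lemma powR_frac1 (x : R) (n : nat) : x `^ (- (1 / n%:R)) = (x `^ n%:R^-1)^-1.
Proof. by rewrite powRN div1r. Qed.

Lemma root_ge1 (x : R) n : 1 <= x -> 1 <= x `^ n%:R^-1.
Proof.
move=> x1; have {1}-> : 1 = 1 `^ n%:R^-1 :> R by rewrite powR1.
by rewrite ge0_ler_powR ?nnegrE// (le_trans ler01).
Qed.

Lemma ln_diff_le (x y : R) : 0 < x -> 0 < y -> ln y - ln x <= (y - x) / x.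
Proof.
move=> x0 y0; rewrite -ln_div ?posrE//.
have := @le_ln1Dx R (y / x - 1); rewrite [1 + _]addrC subrK => h.
rewrite mulrBl divff ?gt_eqF//; apply: h.
by rewrite ltrBrDr addNr divr_gt0.
Qed.

Lemma ln_diff_ge (x y : R) : 0 < x -> 0 < y -> (y - x) / y <= ln y - ln x.
Proof.
move=> x0 y0; have := ln_diff_le y0 x0.
have -> : (y - x) / y = - ((x - y) / y) by rewrite -mulNr opprB.
by set q := _ / _; lra.
Qed.

Lemma harmonic_sum_ub n : \sum_(j < n.+1) j.+1%:R^-1 <= 1 + ln n.+1%:R :> R.
Proof.
elim: n => [|n IH]; first by rewrite big_ord_recr big_ord0 /= add0r invr1 ln1 addr0.
rewrite big_ord_recr /=; apply: (@le_trans _ _ (1 + ln n.+1%:R + n.+2%:R^-1)).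
  by rewrite lerD2r.
rewrite -addrA lerD2l -lerBrDl.
have := @ln_diff_ge n.+1%:R n.+2%:R ltac:(by []) ltac:(by []).
by rewrite -[n.+2%:R]natr1 addrAC subrr add0r div1r.
Qed.

Lemma harmonic_sum_unbounded (B : R) : exists n, B < \sum_(j < n) j.+1%:R^-1.
Proof.
have lb n : ln n.+1%:R <= \sum_(j < n) j.+1%:R^-1 :> R.
  elim: n => [|n IH]; first by rewrite ln1 big_ord0.
  rewrite big_ord_recr /=; apply: (@le_trans _ _ (ln n.+1%:R + n.+1%:R^-1)); last first.
    by rewrite lerD2r.
  rewrite -lerBlDl.
  have := @ln_diff_le n.+1%:R n.+2%:R ltac:(by []) ltac:(by []).
  by rewrite -[n.+2%:R]natr1 addrAC subrr add0r div1r.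
exists (Num.truncn (expR B)); apply: lt_le_trans (lb _).
by rewrite -{1}[B]expRK ltr_ln ?posrE ?expR_gt0// truncnS_gt.
Qed.

Let cbrt j := j%:R `^ 3%:R^-1 : R.

Let cbrt_ge1 j : 1 <= cbrt j.+1.
Proof. by apply: root_ge1; rewrite ler1n. Qed.

Let cbrt3 j : cbrt j.+1 ^+ 3 = j.+1%:R.
Proof. exact: powR_root. Qed.

Let cbrt0 : cbrt 0 = 0.
Proof. by rewrite /cbrt powR0// invr_eq0 pnatr_eq0. Qed.

Let cbrt_diff j : 0 <= cbrt j <= cbrt j.+1 /\
  1 <= (cbrt j.+1 - cbrt j) * (3 * cbrt j.+1 ^+ 2).
Proof.
have b0 : 0 <= cbrt j by exact: powR_ge0.
have a1 := cbrt_ge1 j.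
have e : cbrt j.+1 ^+ 3 - cbrt j ^+ 3 = 1.
  rewrite cbrt3; case: j {b0 a1} => [|j]; first by rewrite cbrt0 expr0n subr0.
  by rewrite cbrt3 -[j.+2%:R]natr1 addrAC subrr add0r.
have ba : cbrt j <= cbrt j.+1.
  rewrite leNgt; apply/negP => h.
  have : cbrt j.+1 ^+ 3 < cbrt j ^+ 3 by rewrite ltrXn2r//; lra.
  lra.
split; first by rewrite b0 ba.
move: e b0 a1 ba; set a := cbrt j.+1; set b := cbrt j => e b0 a1 ba.
have h : 0 <= (a - b) * ((a - b) * (2 * a + b)).
  by rewrite !mulr_ge0// ?subr_ge0//; lra.
nra.
Qed.

Lemma two_thirds_sum_ub n :
  \sum_(j < n) (j.+1%:R : R) `^ (- (2 / 3)) <= 3 * n%:R `^ 3%:R^-1.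
Proof.
rewrite -/(cbrt n); elim: n => [|n IH]; first by rewrite big_ord0 mulr_ge0// powR_ge0.
rewrite big_ord_recr /= powR_frac// -/(cbrt n.+1).
have [_ h] := cbrt_diff n; have a1 := cbrt_ge1 n.
have : (cbrt n.+1 ^+ 2)^-1 <= (cbrt n.+1 - cbrt n) * 3.
  by rewrite -[_^-1]mul1r ler_pdivrMr -?mulrA// exprn_gt0//; lra.
lra.
Qed.

Lemma four_thirds_sum_ub n :
  \sum_(j < n) ((j.+1%:R : R) `^ (- (2 / 3))) ^+ 2 <= 4.
Proof.
case: n => [|n]; first by rewrite big_ord0.
suff : \sum_(j < n.+1) ((j.+1%:R : R) `^ (- (2 / 3))) ^+ 2 <= 4 - 3 / cbrt n.+1.
  move=> h; apply: le_trans h _; rewrite gerBl divr_ge0//.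
  by apply: le_trans (cbrt_ge1 n).
elim: n => [|n IH].
  by rewrite big_ord_recr big_ord0 /= /cbrt !powR1 expr1n add0r; lra.
rewrite big_ord_recr /= powR_frac// -/(cbrt n.+2).
have [/andP[b0 ba] h] := cbrt_diff n.+1.
have a1 := cbrt_ge1 n.+1; have b1 := cbrt_ge1 n.
move: IH b0 ba h a1 b1; set b := cbrt n.+1; set a := cbrt n.+2.
move=> IH b0 ba h a1 b1.
suff : ((a ^+ 2)^-1) ^+ 2 <= 3 / b - 3 / a by lra.
have -> : 3 / b - 3 / a = (3 * (a - b)) / (a * b).
  by field; rewrite !gt_eqF//; lra.
have ab0 : 0 < a * b by rewrite mulr_gt0//; lra.
have a20 : 0 < a ^+ 2 by rewrite exprn_gt0//; lra.
rewrite ler_pdivlMr//.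
apply: (@le_trans _ _ (a ^+ 2)^-1).
  rewrite expr2 -mulrA -[leRHS]mulr1 ler_wpM2l ?invr_ge0 ?(ltW a20)//.
  by rewrite mulrC ler_pdivrMr// mul1r expr2 ler_wpM2l//; lra.
by rewrite -[leLHS]mul1r ler_pdivrMr//; lra.
Qed.

Let t j : R := ln (j%:R + expR 1).

Let E_ge2 : 2 <= expR 1 :> R.
Proof. by have := @expR_ge1Dx R 1; rewrite -natr1. Qed.

Let targ_gt0 j : 0 < j%:R + expR 1 :> R.
Proof. by rewrite ltr_wpDl// expR_gt0. Qed.

Lemma ln_shift_ge1 j : 1 <= ln (j%:R + expR 1) :> R.
Proof.
by rewrite -{1}[1]expRK ler_ln ?posrE ?expR_gt0// lerDr.
Qed.

Lemma log_sum_ub n :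
  \sum_(j < n) ((j.+1%:R : R) `^ (- (1 / 2)) * (ln (j%:R + expR 1))^-1) ^+ 2
  <= 1 + expR 1.
Proof.
have E0 : 0 <= expR 1 :> R by rewrite expR_ge0.
case: n => [|n]; first by rewrite big_ord0 addr_ge0.
suff : \sum_(j < n.+1) ((j.+1%:R : R) `^ (- (1 / 2)) * (ln (j%:R + expR 1))^-1) ^+ 2
    <= 1 + expR 1 - expR 1 / t n.
  move=> h; apply: le_trans h _; rewrite gerBl divr_ge0//.
  by apply: le_trans (ln_shift_ge1 n).
have termE j : ((j.+1%:R : R) `^ (- (1 / 2)) * (t j)^-1) ^+ 2 = (j.+1%:R * t j ^+ 2)^-1.
  rewrite powR_frac1 exprMn !exprVn powR_root//.
  by rewrite [RHS]invfM.
elim: n => [|n IH].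
  have t0 : t 0 = 1 by rewrite /t mulr0n add0r expRK.
  by rewrite big_ord_recr big_ord0 /= -/(t 0) termE t0 expr1n mulr1 invr1; lra.
rewrite big_ord_recr /= -/(t n.+1) termE.
have t1 : 1 <= t n by exact: ln_shift_ge1.
have s1 : 1 <= t n.+1 by exact: ln_shift_ge1.
have := ln_diff_ge (targ_gt0 n) (targ_gt0 n.+1); rewrite -/(t n.+1) -/(t n).
have -> : n.+1%:R + expR 1 - (n%:R + expR 1) = 1 :> R by rewrite -natr1; ring.
move=> h.
have h2 : n.+2%:R^-1 <= expR 1 * (t n.+1 - t n).
  apply: (@le_trans _ _ (expR 1 * (1 / (n.+1%:R + expR 1)))); last by rewrite ler_wpM2l.
  rewrite mul1r ler_pdivlMr ?targ_gt0// mulrC ler_pdivrMr// -[n.+2%:R]natr1.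
  have n0 : 0 <= n.+1%:R :> R by [].
  have := E_ge2; set q := n.+1%:R in n0 *; nra.
have ts : t n <= t n.+1.
  by rewrite ler_ln ?posrE ?targ_gt0// lerD2r ler_nat.
suff : (n.+2%:R * t n.+1 ^+ 2)^-1 <= expR 1 / t n - expR 1 / t n.+1.
  move: IH; set x := expR 1 / t n; set y := expR 1 / t n.+1 => IH hxy.
  by apply: le_trans (lerD IH hxy) _; lra.
have -> : expR 1 / t n - expR 1 / t n.+1 = expR 1 * (t n.+1 - t n) / (t n.+1 * t n).
  by field; rewrite !gt_eqF//; lra.
have h3 : (t n.+1 ^+ 2)^-1 <= (t n.+1 * t n)^-1.
  rewrite lef_pV2 ?posrE ?exprn_gt0 ?mulr_gt0 ?expr2 ?ler_wpM2l//; lra.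
rewrite invfM; apply: ler_pM h2 h3; first by rewrite invr_ge0.
by rewrite invr_ge0 sqr_ge0.
Qed.

Lemma decr_half_ge j : (3 * j.+1%:R)^-1 <=
  (j.+1%:R : R) `^ (- (1 / 2)) * (ln (j%:R + expR 1))^-1.
Proof.
set r := (j.+1%:R : R) `^ 2%:R^-1.
have r2 : r ^+ 2 = j.+1%:R by exact: powR_root.
have r1 : 1 <= r by apply: root_ge1; rewrite ler1n.
rewrite powR_frac1 -/r -invfM lef_pV2 ?posrE ?mulr_gt0//; last 2 first.
- lra.
- by apply: lt_le_trans (ln_shift_ge1 j).
rewrite -r2 expr2 mulrCA ler_wpM2l//; first lra.
apply: (@le_trans _ _ (1 + 2 * r)); last by lra.
apply: (@le_trans _ _ (ln (expR 1 * r ^+ 2))).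
  rewrite ler_ln ?posrE ?targ_gt0//; last by rewrite mulr_gt0 ?expR_gt0 ?exprn_gt0//; lra.
  rewrite r2 -natr1; have j0 : 0 <= j%:R :> R by [].
  have := E_ge2; set q := j%:R in j0 *; nra.
rewrite lnM ?posrE ?expR_gt0 ?exprn_gt0//; try lra.
rewrite expRK lnXn; last lra.
have := @ln_sublinear R r; rewrite mulr2n => h; have := h ltac:(lra); lra.
Qed.

Lemma decr_two_thirds_ge j : j.+1%:R^-1 <= (j.+1%:R : R) `^ (- (2 / 3)).
Proof.
have a1 := cbrt_ge1 j; rewrite powR_frac// -/(cbrt j.+1) lef_pV2 ?posrE ?exprn_gt0//; try lra.
by rewrite -cbrt3 ler_weXn2l.
Qed.

End Schedules.

Section Rates.
Context {R : realType}.

(* A bound by [th / 2 + r / (2 th)] for every [th] is a bound by [sqrt r]. *)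
Lemma bigO_infty_young (E : nat -> \bar R) (q r : nat -> R) (c : R) :
  (\forall K \near \oo, [/\ 0 < q K, r K <= c * q K ^+ 2 &
     forall th, 0 < th -> (E K <= (th / 2 + (2 * th)^-1 * r K)%:E)%E]) ->
  bigO_infty E q.
Proof.
move=> h; exists ((1 + c) / 2); apply: filterS h => K [q0 rq hE].
apply: le_trans (hE _ q0) _; rewrite lee_fin.
apply: (@le_trans _ _ (q K / 2 + (2 * q K)^-1 * (c * q K ^+ 2))).
  by rewrite lerD2l ler_wpM2l// invr_ge0 mulr_ge0// ltW.
rewrite le_eqVlt; apply/orP; left; apply/eqP; field.
by rewrite gt_eqF.
Qed.

Variable lbar : R.
Hypothesis lbar_range : 0 < lbar < 1.
Let lbar0 : 0 < lbar. Proof. by case/andP: lbar_range. Qed.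
Let lbar1 : lbar <= 1. Proof. by case/andP: lbar_range => _ /ltW. Qed.

Let neg_powR_le1 (x y : R) : 1 <= x -> 0 <= y -> 0 < x `^ (- y) <= 1.
Proof.
move=> x1 y0; have x0 : 0 < x by apply: lt_le_trans x1.
rewrite powR_gt0//= powRN invf_le1 ?powR_gt0//.
by rewrite -(powRr0 x) ler_powR.
Qed.

Let nat_ge1 K : (0 < K)%N -> 1 <= K%:R :> R. Proof. by rewrite ler1n. Qed.

Let scaled_range (x : R) : 0 < x <= 1 -> 0 < lbar * x <= lbar.
Proof. by case/andP=> x0 x1; rewrite mulr_gt0//= ler_piMr// ltW. Qed.

Lemma const_half_range K : (0 < K)%N -> 0 < lbar * K%:R `^ (- (1 / 2)) <= lbar.
Proof. by move=> /nat_ge1 K1; apply/scaled_range/neg_powR_le1. Qed.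

Lemma const_two_thirds_range K : (0 < K)%N -> 0 < lbar * K%:R `^ (- (2 / 3)) <= lbar.
Proof. by move=> /nat_ge1 K1; apply/scaled_range/neg_powR_le1. Qed.

Lemma decr_two_thirds_range k : 0 < lbar * k.+1%:R `^ (- (2 / 3)) <= lbar.
Proof. exact: const_two_thirds_range. Qed.

Lemma decr_half_range k :
  0 < lbar * k.+1%:R `^ (- (1 / 2)) * (ln (k%:R + expR 1))^-1 <= lbar.
Proof.
have l1 : 1 <= ln (k%:R + expR 1) :> R by exact: ln_shift_ge1.
have l0 := lt_le_trans ltr01 l1.
have /andP[h0 h1] := @const_half_range k.+1 isT.
apply/andP; split; first by rewrite mulr_gt0// invr_gt0.
by apply: le_trans h1; rewrite ler_piMr ?(ltW h0)// invf_le1.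
Qed.

Lemma const_half_sum_sq K : (0 < K)%N ->
  \sum_(k < K) (lbar * K%:R `^ (- (1 / 2))) ^+ 2 <= 1.
Proof.
move=> K0; have K1 := nat_ge1 K0; have Kp := lt_le_trans ltr01 K1.
rewrite sumr_const card_ord -[_ ^+ 2 *+ K]mulr_natl.
have -> : 1 / 2 = 2%:R / 4%:R :> R by field.
rewrite powR_frac//.
have := powR_root Kp (isT : (0 < 4)%N); have := root_ge1 4 K1.
set b := _ `^ _ => b1 b4; rewrite -b4.
have b0 : b != 0 by rewrite gt_eqF// (lt_le_trans ltr01).
rewrite (_ : _ * _ = lbar ^+ 2); last by field.
by rewrite expr_le1// ltW.
Qed.

Let root_gt0 K n : (0 < K)%N -> 0 < (K%:R : R) `^ n%:R^-1.
Proof. by move=> K0; rewrite powR_gt0// ltr0n. Qed.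

Lemma const_half_sum K : (0 < K)%N ->
  (\sum_(k < K) lbar * K%:R `^ (- (1 / 2))) * (K%:R `^ (- (1 / 4))) ^+ 2 = lbar.
Proof.
move=> K0; have Kp : 0 < K%:R :> R by rewrite ltr0n.
rewrite sumr_const card_ord -[_ * _ *+ K]mulr_natl.
have -> : 1 / 2 = 2%:R / 4%:R :> R by field.
rewrite powR_frac// (powR_frac1 K%:R 4).
have := powR_root Kp (isT : (0 < 4)%N); have := root_gt0 4 K0.
set b := _ `^ _ => b0 b4; rewrite -{1}b4; field.
by rewrite gt_eqF.
Qed.

Lemma const_two_thirds_sum K : (0 < K)%N ->
  (\sum_(k < K) lbar * K%:R `^ (- (2 / 3))) * (K%:R `^ (- (1 / 6))) ^+ 2 = lbar.
Proof.
move=> K0; have Kp : 0 < K%:R :> R by rewrite ltr0n.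
rewrite sumr_const card_ord -[_ * _ *+ K]mulr_natl.
have -> : 2 / 3 = 4%:R / 6%:R :> R by field.
rewrite powR_frac// (powR_frac1 K%:R 6).
have := powR_root Kp (isT : (0 < 6)%N); have := root_gt0 6 K0.
set b := _ `^ _ => b0 b6; rewrite -{1}b6; field.
by rewrite gt_eqF.
Qed.

Lemma const_two_thirds_sum_sq K : (0 < K)%N ->
  \sum_(k < K) (lbar * K%:R `^ (- (2 / 3))) ^+ 2 <= 1.
Proof.
move=> K0; have K1 := nat_ge1 K0; have Kp := lt_le_trans ltr01 K1.
rewrite sumr_const card_ord -[_ ^+ 2 *+ K]mulr_natl.
rewrite powR_frac//.
have := powR_root Kp (isT : (0 < 3)%N); have := root_ge1 3 K1.
set b := _ `^ _ => b1 b3; rewrite -b3.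
have b0 : b != 0 by rewrite gt_eqF// (lt_le_trans ltr01).
rewrite (_ : _ * _ = lbar ^+ 2 * b^-1); last by field.
rewrite mulr_ile1 ?sqr_ge0 ?invr_ge0 ?(le_trans ler01 b1)//.
  by rewrite expr_le1// ltW.
by rewrite invf_le1// (lt_le_trans ltr01).
Qed.

Lemma const_two_thirds_noise K : (0 < K)%N ->
  \sum_(k < K) (lbar * K%:R `^ (- (2 / 3))) ^+ 2 *
    (1 + \sum_(j < k.+1) lbar * K%:R `^ (- (2 / 3))) <= 2.
Proof.
move=> K0; have K1 := nat_ge1 K0; have Kp := lt_le_trans ltr01 K1.
have /andP[l0 _] := const_two_thirds_range K0.
set l := lbar * _ in l0 *.
apply: (@le_trans _ _ (\sum_(k < K) l ^+ 2 * (1 + K%:R * l))).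
  apply: ler_sum => k _; rewrite ler_wpM2l ?sqr_ge0// lerD2l.
  by rewrite sumr_const card_ord -[leLHS]mulr_natl ler_wpM2r ?(ltW l0)// ler_nat ltn_ord.
rewrite sumr_const card_ord -[_ ^+ 2 * _ *+ K]mulr_natl mulrDr mulr1 mulrDr.
have h1 : K%:R * l ^+ 2 <= 1.
  by have := const_two_thirds_sum_sq K0; rewrite sumr_const card_ord -[_ ^+ 2 *+ K]mulr_natl.
have h2 : K%:R * (l ^+ 2 * (K%:R * l)) = lbar ^+ 3.
  rewrite /l powR_frac//.
  have := powR_root Kp (isT : (0 < 3)%N); have := root_ge1 3 K1.
  set b := _ `^ _ => b1 b3; rewrite -b3; field.
  by rewrite gt_eqF// (lt_le_trans ltr01).
have h3 : lbar ^+ 3 <= 1 by rewrite expr_le1// ltW.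
by rewrite h2; lra.
Qed.

Lemma decr_two_thirds_sum_sq n :
  \sum_(k < n) (lbar * k.+1%:R `^ (- (2 / 3))) ^+ 2 <= 4.
Proof.
apply: le_trans (four_thirds_sum_ub n); apply: ler_sum => k _.
by rewrite exprMn ler_piMl ?sqr_ge0// expr_le1// ltW.
Qed.

Lemma decr_half_sum_sq n :
  \sum_(k < n) (lbar * k.+1%:R `^ (- (1 / 2)) * (ln (k%:R + expR 1))^-1) ^+ 2 <=
  1 + expR 1.
Proof.
apply: le_trans (log_sum_ub n); apply: ler_sum => k _.
by rewrite -mulrA exprMn ler_piMl ?sqr_ge0// expr_le1// ltW.
Qed.

Let harmonic_scaled_unbounded (c : R) (l : nat -> R) (B : R) : 0 < c ->
  (forall k, c * k.+1%:R^-1 <= l k) -> exists n, B < \sum_(k < n) l k.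
Proof.
move=> c0 cl; have [n hn] := harmonic_sum_unbounded (B / c).
exists n; move: hn; rewrite ltr_pdivrMr// mulrC => /lt_le_trans; apply.
by rewrite mulr_sumr; apply: ler_sum.
Qed.

Lemma decr_two_thirds_unbounded B :
  exists n, B < \sum_(k < n) lbar * k.+1%:R `^ (- (2 / 3)).
Proof.
apply: (@harmonic_scaled_unbounded lbar (fun k => lbar * k.+1%:R `^ (- (2 / 3))) B lbar0) => k.
by rewrite ler_pM2l// decr_two_thirds_ge.
Qed.

Lemma decr_half_unbounded B : exists n,
  B < \sum_(k < n) lbar * k.+1%:R `^ (- (1 / 2)) * (ln (k%:R + expR 1))^-1.
Proof.
apply: (@harmonic_scaled_unbounded (lbar / 3) (fun k =>
  lbar * k.+1%:R `^ (- (1 / 2)) * (ln (k%:R + expR 1))^-1) B) => [|k].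
  by rewrite divr_gt0.
by rewrite -!mulrA ler_pM2l// -invfM decr_half_ge.
Qed.

Let powR_anti (x y z : R) : 0 < x -> x <= y -> 0 <= z -> y `^ (- z) <= x `^ (- z).
Proof.
move=> x0 xy z0; have y0 := lt_le_trans x0 xy.
rewrite !powRN lef_pV2 ?posrE ?powR_gt0//.
by apply: ge0_ler_powR => //; rewrite nnegrE ltW.
Qed.

Lemma decr_two_thirds_sum K : (0 < K)%N ->
  lbar <= (\sum_(k < K) lbar * k.+1%:R `^ (- (2 / 3))) * (K%:R `^ (- (1 / 6))) ^+ 2.
Proof.
move=> K0; rewrite -[leLHS](const_two_thirds_sum K0) ler_wpM2r ?sqr_ge0//.
apply: ler_sum => k _; rewrite ler_pM2l// powR_anti//.
by rewrite ler_nat.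
Qed.

Lemma decr_half_sum K : 1 + expR 1 <= K%:R :> R ->
  lbar <= (\sum_(k < K) lbar * k.+1%:R `^ (- (1 / 2)) * (ln (k%:R + expR 1))^-1) *
    (2 * (ln K%:R * (K%:R `^ (- (1 / 4))) ^+ 2)).
Proof.
move=> Ke; have e0 : 0 < expR 1 :> R by exact: expR_gt0.
have Kp : 0 < K%:R :> R by apply: lt_le_trans Ke; rewrite addr_gt0.
have K0 : (0 < K)%N by rewrite -(ltr0n R).
pose t : R := ln (K%:R + expR 1).
have t1 : 1 <= t by exact: ln_shift_ge1.
have t0 := lt_le_trans ltr01 t1.
have t2 : t <= 2 * ln K%:R.
  rewrite mulr_natl -lnXn// ler_ln ?posrE ?addr_gt0 ?exprn_gt0//; nra.
apply: (@le_trans _ _ ((\sum_(k < K) lbar * K%:R `^ (- (1 / 2)) * t^-1) *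
    (t * (K%:R `^ (- (1 / 4))) ^+ 2))).
  by rewrite -mulr_suml [leRHS]mulrA divfK ?gt_eqF// const_half_sum.
apply: ler_pM.
- by apply: sumr_ge0 => k _; rewrite !mulr_ge0 ?invr_ge0 ?powR_ge0// ltW.
- by rewrite mulr_ge0 ?sqr_ge0// ltW.
- apply: ler_sum => k _; apply: ler_pM.
  + by rewrite mulr_ge0 ?powR_ge0// ltW.
  + by rewrite invr_ge0 ltW.
  + by rewrite ler_pM2l// powR_anti// ler_nat.
  + have k1 : 1 <= ln (k%:R + expR 1) :> R by exact: ln_shift_ge1.
    rewrite lef_pV2 ?posrE ?(lt_le_trans ltr01 k1)// ler_ln ?posrE ?ltr_wpDl//.
    by rewrite lerD2r ler_nat ltnW.
- by rewrite mulrA ler_wpM2r ?sqr_ge0.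
Qed.

Lemma decr_two_thirds_noise K : (0 < K)%N ->
  \sum_(k < K) (lbar * k.+1%:R `^ (- (2 / 3))) ^+ 2 *
    (1 + \sum_(j < k.+1) lbar * j.+1%:R `^ (- (2 / 3))) <= 7 + 3 * ln K%:R.
Proof.
move=> K0; have -> : 7 + 3 * ln K%:R = 4 + 3 * (1 + ln K%:R) :> R by ring.
have hK : \sum_(k < K) k.+1%:R^-1 <= 1 + ln K%:R :> R.
  by case: K K0 => // K _; exact: harmonic_sum_ub.
apply: (@le_trans _ _ (\sum_(k < K) ((lbar * k.+1%:R `^ (- (2 / 3))) ^+ 2 +
    3 * k.+1%:R^-1))); last first.
  rewrite big_split /= -mulr_sumr; apply: lerD; first exact: decr_two_thirds_sum_sq.
  by rewrite ler_pM2l.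
apply: ler_sum => k _; rewrite mulrDr mulr1 lerD2l.
have kp : 0 < k.+1%:R :> R by rewrite ltr0n.
have hS : \sum_(j < k.+1) lbar * j.+1%:R `^ (- (2 / 3)) <= 3 * k.+1%:R `^ 3%:R^-1 :> R.
  apply: le_trans (two_thirds_sum_ub k.+1); apply: ler_sum => j _.
  by rewrite ler_piMl ?powR_ge0.
apply: le_trans (ler_wpM2l (sqr_ge0 _) hS) _.
rewrite powR_frac//.
have := powR_root kp (isT : (0 < 3)%N); have := root_gt0 3 (ltn0Sn k).
set b := _ `^ _ => b0 b3; rewrite -b3.
rewrite (_ : _ * (3 * b) = lbar ^+ 2 * (3 * (b ^+ 3)^-1)); last first.
  by field; rewrite gt_eqF.
by rewrite ler_piMl ?expr_le1 ?(ltW lbar0)// mulr_ge0// invr_ge0 exprn_ge0// ltW.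
Qed.

End Rates.

Lemma dense_family {R : realType} {V : normedModType R} (e : nat -> V) (S : set V) (p0 : V) :
  dense_seq e -> S p0 -> exists p : nat -> nat -> V,
    (forall i n, S (p i n)) /\
    forall q r, S q -> 0 < r -> exists i n, `|q - p i n| < r.
Proof.
move=> he Sp0.
pose near_e i n := [set q | S q /\ `|q - e i| < n.+1%:R^-1].
exists (fun i n => xget p0 (near_e i n)); split.
  by move=> i n; case: xgetP => [q _ []|].
move=> q r Sq r0; have r2 : 0 < r / 2 by rewrite divr_gt0.
have [n hn] : exists n : nat, n.+1%:R^-1 < r / 2.
  by have [n _ hn] := near_infty_natSinv_lt (PosNum r2); exists n; exact: hn (leqnn n).
have [i hi] := he q n.+1%:R^-1 (ltac:(by rewrite invr_gt0)).
exists i, n; case: xgetP => [q' _ [_ h]|/(_ q)[]]; last by split.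
rewrite (_ : q - q' = (q - e i) - (q' - e i)); last by rewrite opprB addrA subrK.
apply: le_lt_trans (ler_normB _ _) _; apply: lt_trans (ltrD hi h) _.
by rewrite [ltRHS]splitr ltrD.
Qed.

Section OpialSeparable.
Context {R : realType} {H : completeNormedModType R} {ip : H -> H -> R}.
Hypotheses (fi : inner_product ip) (fn : forall x, ip x x = `|x| ^+ 2).
Let fi2 := inner_product_ip2 fi.
Local Notation sq v := (ip2 ip v v).

Lemma cvg_sq_dense (x : nat -> H * H) (q : H * H) :
  (forall r, 0 < r -> exists p, `|q - p| < r /\
     exists L : R, sq (x k - p) @[k --> \oo] --> L) ->
  exists L : R, sq (x k - q) @[k --> \oo] --> L.
Proof.
move=> hq; have [p0 [_ [L0 hL0]]] := hq 1 ltr01.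
have sq0 v : 0 <= sq v by exact: ip_ge0.
have [N0 hN0] : exists N, forall k, (N <= k)%N -> sq (x k - p0) < L0 + 1.
  have [N _ hN] : \forall k \near \oo, sq (x k - p0) < L0 + 1.
    by apply: (cvgr_lt L0 hL0); rewrite ltrDl.
  by exists N => k; exact: hN.
pose B := 2 * (L0 + 1) + 2 * sq (p0 - q).
have hB k : (N0 <= k)%N -> sq (x k - q) <= B.
  move=> /hN0 h; rewrite (_ : x k - q = (x k - p0) + (p0 - q)); last by rewrite addrA subrK.
  have := ip_sqD fi2 (x k - p0) (p0 - q); rewrite /B; lra.
have B0 : 0 <= B by exact: le_trans (sq0 _) (hB _ (leqnn N0)).
apply: cauchy_seq_cvg => eps eps0.
pose d := eps / (8 * (B + 1)).
have d0 : 0 < d by rewrite divr_gt0// mulr_gt0// ltr_wpDl.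
have dB : d * B <= eps / 8.
  rewrite /d mulrAC ler_pdivrMr ?mulr_gt0 ?ltr_wpDl//; nra.
pose D := 1 + d^-1.
have D0 : 0 < D by rewrite ltr_wpDr// invr_ge0 ltW.
have r0 : 0 < Num.sqrt (eps / (16 * D)) by rewrite sqrtr_gt0 divr_gt0// mulr_gt0.
have [p [qp [L hL]]] := hq _ r0.
have hd : D * sq (q - p) <= eps / 8.
  have : `|q - p| ^+ 2 <= eps / (16 * D).
    rewrite -[leRHS]sqr_sqrtr ?divr_ge0 ?mulr_ge0 ?(ltW D0) ?(ltW eps0)//.
    by rewrite ler_sqr ?nnegrE ?sqrtr_ge0 ?normr_ge0// ltW.
  rewrite ler_pdivlMr ?mulr_gt0// => h.
  have := ler_wpM2l (ltW D0) (ip2_le_norm fn (q - p)).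
  lra.
have near k : (N0 <= k)%N -> `|sq (x k - p) - sq (x k - q)| <= eps / 4.
  move=> Nk; have hBk := hB k Nk.
  have -> : sq (x k - p) = sq (x k - q) + 2 * ip2 ip (x k - q) (q - p) + sq (q - p).
    rewrite (_ : x k - p = (x k - q) + (q - p)); last by rewrite addrA subrK.
    by rewrite (ipDl fi2 (x k - q)) !(ipDr fi2 _ (x k - q)) (ipC fi2 (q - p) (x k - q)); ring.
  have e1 := ip_young fi2 (x k - q) (q - p) d0.
  have e2 := ip_young fi2 (x k - q) (- (q - p)) d0.
  rewrite !(ipNr fi2) (ipNl fi2) opprK in e2.
  set X := sq (x k - q) in hBk e1 e2 *; set Y := ip2 ip _ _ in e1 e2 *.
  set Z := sq (q - p) in hd e1 e2 *.
  have dX : d * X <= eps / 8 by apply: le_trans dB; rewrite ler_wpM2l// ltW.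
  have Z0 : 0 <= Z by exact: sq0.
  rewrite /D mulrDl mul1r in hd.
  by rewrite ler_norml; apply/andP; split; lra.
have [N1 hN1] : exists N, forall k, (N <= k)%N -> `|L - sq (x k - p)| < eps / 8.
  have e8 : 0 < eps / 8 by rewrite divr_gt0.
  have /cvgrPdist_lt/(_ _ e8)[N _ hN] := hL.
  by exists N => k; exact: hN.
exists (maxn N0 N1) => m n; rewrite !geq_max => /andP[m0 m1] /andP[n0 n1].
have := near m m0; have := near n n0; have := hN1 m m1; have := hN1 n n1.
rewrite !ltr_norml !ler_norml => /andP[a1 a2] /andP[a3 a4] /andP[a5 a6] /andP[a7 a8].
by apply/andP; split; lra.
Qed.

End OpialSeparable.

(** * Convergence of the splitting algorithm *)

Lemma ratio_le {R : realFieldType} (X W L S q : R) : 0 <= X -> 0 < L -> 0 < S ->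
  L * W <= S * q -> X * W / S <= X / L * q.
Proof.
move=> X0 L0 S0 h; rewrite ler_pdivrMr//.
rewrite (_ : X * W = X / L * (L * W)); last by field; rewrite gt_eqF.
by rewrite -[leRHS]mulrA ler_wpM2l ?divr_ge0 ?(ltW L0)// [q * S]mulrC.
Qed.

Section SplittingProcess.
Context {R : realType} {H : completeNormedModType R} {ip : H -> H -> R}.
Hypotheses (fi : inner_product ip) (fn : forall x, ip x x = `|x| ^+ 2).
Variable e : nat -> H.
Hypothesis e_dense : dense_seq e.
Context {dXi : measure_display} {Xi : measurableType dXi} {D : probability Xi R}.
Context {dOmega : measure_display} {Omega : measurableType dOmega}
  {P : probability Omega R}.
Variables (A B : H -> set H) (rho tau : R) (C : H -> H) (Cs : Xi -> H -> H).
Hypotheses (maxA : maximally_monotone ip A) (maxB : maximally_monotone ip B).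
Hypotheses (tau_gt0 : 0 < tau) (rho_gt0 : 0 < rho) (rho_le : rho <= 2 * tau).
Hypothesis cocoC : cocoercive ip tau C.
Hypothesis intCs : forall x, bochner_integrable D (fun xi => Cs xi x).
Hypothesis meanC : forall x, C x = bochner D (fun xi => Cs xi x).
Variables (Cm : Xi -> H -> H) (N : set Xi).
Hypotheses (mN : measurable N) (DN : D N = 0%E).
Hypothesis cocoCm : forall xi, cocoercive ip tau (Cm xi).
Hypothesis mCm : forall x, vmeasurable (Cm ^~ x).
Hypothesis CmCs : forall xi, ~ N xi -> Cm xi = Cs xi.

Let fi2 := inner_product_ip2 fi.
Local Notation sq v := (ip2 ip v v).
Local Notation T := (splitting_op rho A B C).
Local Notation Tx := (fun xi => splitting_op rho A B (Cm xi)).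

Variables (p : H * H) (s : R).
Hypotheses (Tp : T p = p) (s_ge0 : 0 <= s).
Hypothesis noise_p : (\int[D]_xi (sq (Tx xi p - T p))%:E <= s%:E)%E.
Variables (x0 : H * H) (lb : R).
Hypothesis lb_lt1 : lb < 1.

Let neT x y : sq (T x - T y) <= sq (x - y).
Proof. exact: (splitting_op_nonexpansive fi fn maxA maxB rho_gt0 x y rho_le cocoC). Qed.

Let neTx z x y : sq (Tx z x - Tx z y) <= sq (x - y).
Proof. exact: (splitting_op_nonexpansive fi fn maxA maxB rho_gt0 x y rho_le (cocoCm z)). Qed.

Let mTx x : vmeasurable (Tx ^~ x).
Proof.
exact: (Tx_vmeasurable fi fn e_dense maxA maxB rho_gt0 mCm x).
Qed.

Let noiseE q s' : 0 <= s' -> (\int[D]_xi (sq (Tx xi q - T q))%:E <= s'%:E)%E ->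
  forall x b c, (\int[D]_z (sq (b + c *: (Tx z x - T x)))%:E <=
    (sq b + c ^+ 2 * (8 * sq (x - q) + 2 * s'))%:E)%E.
Proof.
move=> s0 hq x b c.
exact: (noise_step fi fn e_dense maxA maxB rho_gt0 rho_le cocoC intCs meanC
  mN DN cocoCm mCm CmCs).
Qed.

Local Notation iter xi l k w := (iterate rho A B (fun j => Cs (xi j w)) l x0 k).

Local Notation residual z := (norm2 (T z - z)).

Section Run.
Variable xi : nat -> {mfun Omega >-> Xi}.
Hypothesis xi_iid : iid P D xi.

Lemma iterate_state l :
  {ae P, forall w, forall k, iter xi l k w = (state xi T Tx l x0 k w).1}.
Proof.
have hN : {ae P, forall w, forall k, ~ N (xi k w)}.
  apply: ae_foralln => k; exists (xi k @^-1` N); split.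
  - by rewrite -[X in measurable X]setTI; exact: (measurable_funP (xi k)).
  - by have := xi_iid.1 k N mN; rewrite DN.
  - by move=> w /= /contrapT.
apply: filterS hN => w hw k; elim: k => [//|k IH] /=.
by rewrite IH (iter_stepE fi fn maxA maxB rho_gt0) -CmCs.
Qed.

Variable l : nat -> R.
Hypothesis l_bound : forall k, 0 < l k <= lb.

Let residual_ge0 z : 0 <= residual z. Proof. exact: sqrtr_ge0. Qed.

Let a0 := sq (x0 - p).

Lemma expectation_residual_random K M th (Nr : {mfun Omega >-> nat}) : (0 < K)%N ->
  \sum_(k < K) l k ^+ 2 <= M -> 0 < th -> random_index P xi l K Nr ->
  ('E_P[(fun w => residual (iter xi l (Nr w) w))] <=
    (th / 2 + (2 * th)^-1 *
      (bound_lr s lb M a0 / (expR (- (2 * M)) * (1 - lb) * \sum_(j < K) l j)))%:E)%E.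
Proof.
move=> K0 lM th0 hN; rewrite unlock.
apply: le_trans (integral_residual_random (l := l) (x0 := x0) (lb := lb) (p := p) (s := s)
  fi fn e_dense xi_iid neT neTx mTx l_bound lb_lt1 Tp s_ge0 (noiseE s_ge0 noise_p)
  th0 _ hN _) _.
- by move=> w; exact: residual_ge0.
- by apply: filterS (iterate_state l) => w hw; rewrite hw (norm2E fn).
rewrite lee_fin lerD2l ler_wpM2l ?invr_ge0 ?mulr_ge0 ?(ltW th0)//.
exact: (lottery_le fi fn e_dense xi_iid neT neTx mTx x0 l_bound lb_lt1 Tp s_ge0
  (noiseE s_ge0 noise_p) K0 lM).
Qed.

Lemma expectation_residual_last K M th : (0 < K)%N ->
  \sum_(k < K) l k ^+ 2 <= M -> 0 < th ->
  ('E_P[(fun w => residual (iter xi l K w))] <=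
    (th / 2 + (2 * th)^-1 * (bound_last s lb M a0 *
      (1 + \sum_(k < K) l k ^+ 2 * (1 + \sum_(j < k.+1) l j)) / \sum_(j < K) l j))%:E)%E.
Proof.
move=> K0 lM th0; rewrite unlock.
apply: le_trans (integral_residual_le (k := K) (l := l) (x0 := x0) (lb := lb) (p := p) (s := s)
  fi fn e_dense xi_iid neT neTx mTx l_bound lb_lt1 Tp s_ge0 (noiseE s_ge0 noise_p)
  th0 _ _) _.
- by move=> w; exact: residual_ge0.
- by apply: filterS (iterate_state l) => w hw; rewrite hw (norm2E fn).
rewrite lee_fin lerD2l ler_wpM2l ?invr_ge0 ?mulr_ge0 ?(ltW th0)//.
rewrite ler_pdivlMr; last first.
  have l0 k : 0 < l k by case/andP: (l_bound k).
  case: K K0 {lM} => // K _; rewrite big_ord_recr /= ltr_wpDl//.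
  by apply: sumr_ge0 => j _; exact: ltW.
rewrite mulrC.
exact: (mean_res_last fi fn e_dense xi_iid neT neTx mTx x0 l_bound lb_lt1 Tp s_ge0
  (noiseE s_ge0 noise_p) lM).
Qed.

Variable M : R.
Hypothesis l_summable : forall n, \sum_(k < n) l k ^+ 2 <= M.
Hypothesis l_unbounded : forall B, exists n, B < \sum_(k < n) l k.

Let ae_res : {ae P, forall w, forall eps, 0 < eps -> exists n, forall k, (n <= k)%N ->
  sq (T (iter xi l k w) - iter xi l k w) < eps}.
Proof.
have := ae_residual_cvg0 fi fn e_dense xi_iid neT neTx mTx x0 l_bound lb_lt1 Tp s_ge0
  (noiseE s_ge0 noise_p) l_summable l_unbounded.
move: (iterate_state l); apply: filterS2 => w hw hr eps eps0.
by have [n hn] := hr eps eps0; exists n => k nk; rewrite hw; exact: hn.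
Qed.

Lemma ae_residual_cvg : {ae P, forall w, residual (iter xi l k w) @[k --> \oo] --> (0 : R)}.
Proof.
apply: filterS ae_res => w hr; apply/cvgrPdist_lt => eps eps0.
have [n hn] := hr _ (exprn_gt0 2 eps0); exists n => // k /= nk.
rewrite sub0r normrN ger0_norm ?residual_ge0// (norm2E fn).
rewrite -(ltr_pXn2r (n := 2)) ?nnegrE ?sqrtr_ge0 ?(ltW eps0)//.
by rewrite sqr_sqrtr ?hn//; exact: (ip_ge0 fi2).
Qed.

Lemma ae_weak_cvg : {ae P, forall w, exists xh : H * H,
  [/\ weak_cvg2 ip (fun k => iter xi l k w) xh, T xh = xh
    & zer (op_add (op_add A B) (op_fun C)) (resolvent (op_scale rho A) xh.1)]}.
Proof.
have [e2 he2] := dense_seq_pair e_dense e_dense.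
have [q [Tq hq]] := @dense_family _ _ e2 [set q | T q = q] p he2 Tp.
have hdist : {ae P, forall w, forall i n, exists L : R,
    dist_sq (ip := ip) (q i n) (state xi T Tx l x0 k w) @[k --> \oo] --> L}.
  apply: ae_foralln => i; apply: ae_foralln => n.
  have [s' s'0 hs'] := noise_second_moment fi fn e_dense maxA maxB rho_gt0 rho_le cocoC
    cocoCm mCm noise_p (q i n).
  exact: (ae_cvg_dist fi fn e_dense xi_iid neT neTx mTx x0 l_bound lb_lt1 (Tq i n) s'0
    (noiseE s'0 hs') l_summable).
move: (iterate_state l) hdist ae_res; apply: filterS3 => w hw hd hr.
have hcvg z : T z = z -> exists L, sq (iter xi l k w - z) @[k --> \oo] --> (L : R).
  move=> Tz; apply: (cvg_sq_dense fi fn) => r r0.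
  have [i [n hin]] := hq z r Tz r0; exists (q i n); split=> //.
  have [L hL] := hd i n; exists L.
  rewrite (_ : (fun k => _) = (fun k => dist_sq (ip := ip) (q i n) (state xi T Tx l x0 k w)))//.
  by apply/funext => k; rewrite /dist_sq hw.
have [c [Tc hc]] := opial_weak_cvg fi2 (ip2_complete fi fn) neT Tp hcvg hr.
exists c; split=> //.
exact: (fixpoint_splitting_op_zero fi fn maxA maxB rho_gt0 Tc).
Qed.

End Run.

Let bound_lr_ge0 M : 0 <= M -> 0 <= bound_lr s lb M (sq (x0 - p)).
Proof.
move=> M0; have := ip_ge0 fi2 (x0 - p); set a := sq _; clearbody a => a0.
have e0 : 0 <= expR (8 * M) by exact: expR_ge0.
by rewrite /bound_lr /bound_a divr_ge0 ?subr_ge0 ?(ltW lb_lt1)// !(addr_ge0, mulr_ge0).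
Qed.

Let bound_last_ge0 M : 0 <= M -> 0 <= bound_last s lb M (sq (x0 - p)).
Proof.
move=> M0; have h := bound_lr_ge0 M0; have := ip_ge0 fi2 (x0 - p); move: h.
set a := sq _; clearbody a => h a0.
have e0 : 0 <= expR (8 * M) by exact: expR_ge0.
have d0 : 0 <= 2 / (1 - lb) by rewrite divr_ge0 ?subr_ge0 ?(ltW lb_lt1).
rewrite /bound_last /bound_a; apply: addr_ge0; first by rewrite mulr_ge0.
by apply: mulr_ge0; [exact: addr_ge0|rewrite !(addr_ge0, mulr_ge0)].
Qed.

Variables (l : nat -> nat -> R) (xi : nat -> nat -> {mfun Omega >-> Xi}) (M L : R) (q : nat -> R).
Hypotheses (M_ge0 : 0 <= M) (L_gt0 : 0 < L).
Hypothesis xi_iid : forall K, iid P D (xi K).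

Lemma bigO_residual_random (Nr : nat -> {mfun Omega >-> nat}) :
  (\forall K \near \oo, [/\ (0 < K)%N, forall k, 0 < l K k <= lb,
     \sum_(k < K) l K k ^+ 2 <= M, 0 < q K & L <= (\sum_(j < K) l K j) * q K ^+ 2]) ->
  (forall K, (0 < K)%N -> random_index P (xi K) (l K) K (Nr K)) ->
  bigO_infty (fun K => 'E_P[(fun w => residual (iter (xi K) (l K) (Nr K w) w))]%E) q.
Proof.
move=> hK hN; pose Y := expR (- (2 * M)) * (1 - lb).
have Y0 : 0 < Y by rewrite mulr_gt0 ?expR_gt0 ?subr_gt0.
pose X := bound_lr s lb M (sq (x0 - p)).
apply: (@bigO_infty_young _ _ _ (fun K => X / (Y * \sum_(j < K) l K j)) (X / (Y * L))).
apply: filterS hK => K [K0 lK lM q0 LS]; split=> //; last first.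
  by move=> th th0; apply: expectation_residual_random => //; exact: hN.
have S0 : 0 < \sum_(j < K) l K j by rewrite -(pmulr_lgt0 _ (exprn_gt0 2 q0)) (lt_le_trans L_gt0).
have h := @ratio_le _ X 1 (Y * L) (Y * \sum_(j < K) l K j) (q K ^+ 2).
rewrite !mulr1 in h; apply: h; [exact: bound_lr_ge0|exact: mulr_gt0|exact: mulr_gt0|].
by rewrite -[leRHS]mulrA ler_pM2l.
Qed.

Lemma bigO_residual_last :
  (\forall K \near \oo, [/\ (0 < K)%N, forall k, 0 < l K k <= lb,
     \sum_(k < K) l K k ^+ 2 <= M, 0 < q K &
     L * (1 + \sum_(k < K) l K k ^+ 2 * (1 + \sum_(j < k.+1) l K j)) <=
       (\sum_(j < K) l K j) * q K ^+ 2]) ->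
  bigO_infty (fun K => 'E_P[(fun w => residual (iter (xi K) (l K) K w))]%E) q.
Proof.
move=> hK; pose X := bound_last s lb M (sq (x0 - p)).
apply: (@bigO_infty_young _ _ _ (fun K => X * (1 + \sum_(k < K) l K k ^+ 2 *
  (1 + \sum_(j < k.+1) l K j)) / \sum_(j < K) l K j) (X / L)).
apply: filterS hK => K [K0 lK lM q0]; set W := 1 + _ => LS; split=> //; last first.
  by move=> th th0; exact: expectation_residual_last.
apply: ratio_le => //; first exact: bound_last_ge0.
case: K K0 lK {lM LS W q0} => // K _ lK; rewrite big_ord_recr /= ltr_wpDl//.
  by apply: sumr_ge0 => j _; case/andP: (lK j) => /ltW.
by case/andP: (lK K).
Qed.

End SplittingProcess.

Theorem mainTheorem10
  (R : realType)
  (H : completeNormedModType R) (ip : {dot H for idfun})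
  (ip_norm : forall x : H, ip x x = `|x| ^+ 2)
  (sepH : separable H)
  (dXi : measure_display) (Xi : measurableType dXi) (D : probability Xi R)
  (A B : H -> set H)
  (maxA : maximally_monotone ip A) (maxB : maximally_monotone ip B)
  (tau : R) (tau_gt0 : 0 < tau)
  (C : H -> H) (cocoC : cocoercive ip tau C)
  (Cs : Xi -> H -> H)
  (cocoCs : {ae D, forall xi, cocoercive ip tau (Cs xi)})
  (intCs : forall x : H, bochner_integrable D (fun xi => Cs xi x))
  (meanC : forall x : H, C x = bochner D (fun xi => Cs xi x))
  (zerABC : zer (op_add (op_add A B) (op_fun C)) !=set0)
  (sigma : R)
  (varC : exists2 xh0 : H, zer (op_add (op_add A B) (op_fun C)) xh0 &
     ('E_D[(fun xi => `|C xh0 - Cs xi xh0| ^+ 2)%R] <= (sigma ^+ 2)%:E)%E)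
  (rho : R) (rho_range : 0 < rho < 2 * tau)
  (x0 : H * H)
  (lbar : R) (lbar_range : 0 < lbar < 1)
  (dOmega : measure_display) (Omega : measurableType dOmega)
  (P : probability Omega R) :
  let T := mean_splitting_op rho A B D Cs in
  let x (lambda : nat -> R) (xi : nat -> {mfun Omega >-> Xi})
        (k : nat) (w : Omega) :=
    iterate rho A B (fun j => Cs (xi j w)) lambda x0 k in
  let residual (z : H * H) := norm2 (T z - z) in
  let const_half (K k : nat) := lbar * K%:R `^ (- (1 / 2)) in
  let const_two_thirds (K k : nat) := lbar * K%:R `^ (- (2 / 3)) in
  let decr_half (k : nat) :=
    lbar * k.+1%:R `^ (- (1 / 2)) * (ln (k%:R + expR 1))^-1 in
  let decr_two_thirds (k : nat) := lbar * k.+1%:R `^ (- (2 / 3)) in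
  [/\
    (* for each horizon K, a fresh run driven by (xi K k)_k *)
    forall (xi : nat -> nat -> {mfun Omega >-> Xi})
           (N : nat -> {mfun Omega >-> nat}),
      (forall K, iid P D (xi K)) ->
      (forall K, (0 < K)%N ->
         random_index P (xi K) (const_half K) K (N K)) ->
      bigO_infty
        (fun K => 'E_P[(fun w => residual (x (const_half K) (xi K) (N K w) w))]%E)
        (fun K => K%:R `^ (- (1 / 4))),
    forall (xi : nat -> {mfun Omega >-> Xi})
           (N : nat -> {mfun Omega >-> nat}),
      iid P D xi ->
      (forall K, (0 < K)%N -> random_index P xi decr_half K (N K)) ->
      bigO_infty
        (fun K => 'E_P[(fun w => residual (x decr_half xi (N K w) w))]%E)
        (fun K => ln K%:R `^ (1 / 2) * K%:R `^ (- (1 / 4))),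
    forall xi : nat -> nat -> {mfun Omega >-> Xi},
      (forall K, iid P D (xi K)) ->
      bigO_infty
        (fun K => 'E_P[(fun w => residual (x (const_two_thirds K) (xi K) K w))]%E)
        (fun K => K%:R `^ (- (1 / 6))),
    forall xi : nat -> {mfun Omega >-> Xi},
      iid P D xi ->
      bigO_infty
        (fun K => 'E_P[(fun w => residual (x decr_two_thirds xi K w))]%E)
        (fun K => ln K%:R `^ (1 / 2) * K%:R `^ (- (1 / 6)))
  & forall lambda : nat -> R,
      lambda = decr_half \/ lambda = decr_two_thirds ->
      forall xi : nat -> {mfun Omega >-> Xi},
        iid P D xi ->
        {ae P, forall w, exists xh : H * H,
           [/\ weak_cvg2 ip (fun k => x lambda xi k w) xh,
               fixpoints T xh
             & zer (op_add (op_add A B) (op_fun C))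
                 (resolvent (op_scale rho A) xh.1)]} /\
        {ae P, forall w, residual (x lambda xi k w) @[k --> \oo] --> (0 : R)}].
Proof.
have fi := inner_product_dot ip_norm.
move=> T x residual const_half const_two_thirds decr_half decr_two_thirds.
have [e he] := separable_dense_seq sepH.
have /andP[rho0 /ltW rho_le] := rho_range.
have /andP[lbar0 lbar1] := lbar_range.
have [Cm [N [mN DN cocoCm mCm CmCs]]] :=
  cocoercive_modification fi ip_norm he tau_gt0 cocoC cocoCs intCs.
have TE : T = splitting_op rho A B C.
  apply/funext => z.
  exact: (mean_splitting_opE fi ip_norm he maxA maxB rho0 intCs meanC z).
have [xh0 zer0 var0] := varC.
have [p [Tp pE]] := zero_fixpoint_splitting_op fi ip_norm maxA maxB rho0 zer0.
have noise_p : (\int[D]_z (ip2 ip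
    (splitting_op rho A B (Cm z) p - splitting_op rho A B C p)
    (splitting_op rho A B (Cm z) p - splitting_op rho A B C p))%:E <=
    (sigma ^+ 2)%:E)%E.
  apply: le_trans var0; rewrite unlock.
  rewrite [leRHS](@ge0_integral_ae_eq _ _ _ D _ (fun z => (`|Cm z xh0 - C xh0| ^+ 2)%:E)).
  - apply: ge0_integral_mono => z; first by rewrite lee_fin; exact: (ip_ge0 (inner_product_ip2 fi)).
    rewrite lee_fin (splitting_op_diff fi ip_norm maxA maxB rho0) pE.
    exact: (noise_map_sq fi ip_norm).
  - by move=> z; rewrite lee_fin sqr_ge0.
  - by move=> z; rewrite lee_fin sqr_ge0.
  - apply/measurable_EFinP; apply: measurable_funX; exact: mCm.
  - apply: filterS (CsCm_ae mN DN CmCs xh0) => z ->.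
    by rewrite distrC.
have s0 := sqr_ge0 sigma.
have rand := @bigO_residual_random _ _ _ fi ip_norm e he _ _ D _ _ P A B rho tau C Cs
  maxA maxB rho0 rho_le cocoC intCs meanC Cm N mN DN cocoCm mCm CmCs p (sigma ^+ 2) Tp s0
  noise_p x0 lbar lbar1.
have last := @bigO_residual_last _ _ _ fi ip_norm e he _ _ D _ _ P A B rho tau C Cs
  maxA maxB rho0 rho_le cocoC intCs meanC Cm N mN DN cocoCm mCm CmCs p (sigma ^+ 2) Tp s0
  noise_p x0 lbar lbar1.
split.
- move=> xi Nr xi_iid hN; rewrite /residual /x TE.
  apply: (rand const_half xi 1 lbar) => //.
  apply: filterS (nbhs_infty_gt 0) => K K0; split=> //.
  + by move=> k; exact: const_half_range.
  + exact: const_half_sum_sq.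
  + by rewrite powR_gt0 ?ltr0n.
  + by rewrite const_half_sum.
- move=> xi Nr xi_iid hN; rewrite /residual /x TE.
  apply: (rand (fun=> decr_half) (fun=> xi) (1 + expR 1) (lbar / 2)) => //.
  + by rewrite divr_gt0.
  apply: filterS (nbhs_infty_ger (1 + expR 1 : R)) => K Ke.
  have K1 : 1 < K%:R :> R by apply: lt_le_trans Ke; rewrite ltrDl expR_gt0.
  have Kp := lt_trans ltr01 K1.
  have lnK : 0 < ln K%:R :> R by rewrite ln_gt0.
  split.
  + by rewrite -(ltr0n R).
  + exact: decr_half_range.
  + exact: decr_half_sum_sq.
  + by rewrite mulr_gt0 ?powR_gt0.
  + have h := decr_half_sum lbar_range Ke.
    rewrite exprMn [1 / 2]div1r powR_root//.
    by rewrite ler_pdivrMr// -[leRHS]mulrA [_ * 2]mulrC.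
- move=> xi xi_iid; rewrite /residual /x TE.
  apply: (last const_two_thirds xi 1 (lbar / 3)) => //.
  + by rewrite divr_gt0.
  apply: filterS (nbhs_infty_gt 0) => K K0; split=> //.
  + by move=> k; exact: const_two_thirds_range.
  + exact: const_two_thirds_sum_sq.
  + by rewrite powR_gt0 ?ltr0n.
  + rewrite const_two_thirds_sum// -[leRHS](@divfK _ 3)// ler_pM2l ?divr_gt0//.
    have := const_two_thirds_noise lbar_range K0; rewrite /const_two_thirds; lra.
- move=> xi xi_iid; rewrite /residual /x TE.
  apply: (last (fun=> decr_two_thirds) (fun=> xi) 4 (lbar / 11)) => //.
  + by rewrite divr_gt0.
  apply: filterS (nbhs_infty_ger (1 + expR 1 : R)) => K Ke.
  have eK : expR 1 <= K%:R :> R by apply: le_trans Ke; rewrite lerDr.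
  have Kp : 0 < K%:R :> R by apply: lt_le_trans eK; rewrite expR_gt0.
  have lnK : 1 <= ln K%:R :> R by rewrite -ler_expR lnK.
  have K0 : (0 < K)%N by rewrite -(ltr0n R).
  split=> //.
  + exact: decr_two_thirds_range.
  + exact: decr_two_thirds_sum_sq.
  + by rewrite mulr_gt0 ?powR_gt0// (lt_le_trans ltr01).
  + have h := decr_two_thirds_sum lbar_range K0.
    have hn := decr_two_thirds_noise lbar_range K0.
    rewrite exprMn [1 / 2]div1r powR_root ?(lt_le_trans ltr01)//.
    rewrite mulrCA [leLHS]mulrC.
    apply: (@le_trans _ _ ((11 * ln K%:R) * (lbar / 11))).
      rewrite ler_wpM2r ?divr_ge0 ?(ltW lbar0)//; rewrite /decr_two_thirds; lra.
    rewrite (_ : _ * _ = ln K%:R * lbar); last by field.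
    by rewrite ler_wpM2l// (le_trans ler01).
- move=> lambda hl xi xi_iid; rewrite /residual /x TE.
  have [l_range [M l_sum] l_unb] : [/\ forall k, 0 < lambda k <= lbar,
      exists M, forall n, \sum_(k < n) lambda k ^+ 2 <= M
      & forall b, exists n, b < \sum_(k < n) lambda k].
    case: hl => ->; split.
    - exact: decr_half_range.
    - by exists (1 + expR 1) => n; exact: decr_half_sum_sq.
    - exact: decr_half_unbounded.
    - exact: decr_two_thirds_range.
    - by exists 4 => n; exact: decr_two_thirds_sum_sq.
    - exact: decr_two_thirds_unbounded.
  split.
  + exact: (ae_weak_cvg fi ip_norm he maxA maxB rho0 rho_le cocoC intCs meanC
      mN DN cocoCm mCm CmCs Tp s0 noise_p x0 lbar1 xi_iid l_range l_sum l_unb).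
  + exact: (ae_residual_cvg fi ip_norm he maxA maxB rho0 rho_le cocoC intCs meanC
      mN DN cocoCm mCm CmCs Tp s0 noise_p x0 lbar1 xi_iid l_range l_sum l_unb).
Qed.
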